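(* Let $X=[0,1]$ with Lebesgue measure $m$. (a) Let $(X,T,\alpha)$ be a weakly mixing RU map, let $dP=h\,dm$ be its absolutely continuous invariant probability, and let $C>0$, $r\in(0,1)$ be constants such that $\|\widehat T^{n}f-(\int_X f\,dm)\,h\|_{BV}\le C r^n\|f\|_{BV}$ for all $f\in BV$ and $n\ge 1$. If $\inf_{[h>0]}h>0$, then there exists $B>0$ such that $\phi_-(n)\le B r^n$ for all $n\ge 1$. (b) Let $(X,T,\alpha)$ be a basic, weakly mixing AFU map, let $dP=h\,dm$ be its absolutely continuous invariant probability, and let $C>0$, $r\in(0,1)$ be constants such that $\|\widehat T^{n}f-(\int_X f\,dm)\,h\|_{BV}\le C r^n\|f\|_{BV}$ for all $f\in BV$ and $n\ge 1$. If $\inf\{m(T^na): n\ge 1,\ a\in\alpha_n\}>0$, then there exists $B>0$ such that $\psi(n)\le B r^n$ for all $n\ge 1$. (c) Let $(X,T,\alpha)$ be a PM map with an absolutely continuous invariant probability $P\ll m$, with $\#\alpha<\infty$ and such that $\sigma(\{T^{-n}\alpha: n\ge 0\})=\mathcal B(X)$. If $\inf\{m(T^na): n\ge 1,\ a\in\alpha_n\}=0$, then $\phi_+(n)=1$ for all $n\ge 1$.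
   Context: $X=[0,1]$, $m$ is Lebesgue measure, $\mathcal B(X)$ is the Borel $\sigma$-algebra. PM map: a non-singular piecewise monotonic map $(X,T,\alpha)$ consists of a finite or countable collection $\alpha$ of pairwise disjoint nonempty open subintervals of $X$ with $\bigcup_{a\in\alpha}a=X$ modulo $m$-null sets, and a map $T:X\to X$ such that $T|_a$ is absolutely continuous and strictly monotonic for each $a\in\alpha$, and $m\circ T^{-1}\ll m$. For $n\ge 1$, $\alpha_n$ is the collection of nonempty sets of the form $\bigcap_{k=0}^{n-1}T^{-k}a_k$ with $a_0,\dots,a_{n-1}\in\alpha$; $(X,T^n,\alpha_n)$ is again a PM map. For $a\in\alpha_n$, $v_a:T^na\to a$ is $v_a=(T^n|_a)^{-1}$. $\sigma(\alpha_n)$ is the $\sigma$-algebra generated by $\alpha_n$, and $T^{-n}\alpha=\{T^{-n}a:a\in\alpha\}$. The transfer operator $\widehat T:L^1(m)\to L^1(m)$ is defined by $\int_X (\widehat T g) f\,dm=\int_X g\,(f\circ T)\,dm$ for $g\in L^1(m)$, $f\in L^\infty(m)$. $\|f\|_{BV}=\|f\|_\infty+\bigvee_X f$, where $\bigvee_X f$ is the total variation on $X$ (of the version of $f$ minimizing variation), and $BV$ is the space of functions with $\|f\|_{BV}<\infty$. RU map: a PM map such that (U) $\inf_{x\in a\in\alpha}|T'(x)|>1$, and (R) $\sum_{a\in\alpha}\|1_{Ta}v_a'\|_{BV}<\infty$ (with the version of $v_a'$ minimizing variation). AFU map: a PM map such that for all $a\in\alpha$, $T:\overline a\to\overline{Ta}$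 is a $C^2$ diffeomorphism (i.e. $T|_a$ extends to one), and such that (U) holds, (F) $\{Ta:a\in\alpha\}$ is finite, and (A) $\sup_X |T''|/(T')^2<\infty$. Every AFU map is an RU map. An RU map that is ergodic with respect to $m$ has a unique absolutely continuous $T$-invariant probability $dP=h\,dm$, with $h\in BV$, $h\ge0$, $\int_X h\,dm=1$, $\widehat T h=h$. An RU map is basic if it is conservative and ergodic with respect to $m$ (in which case $h>0$ a.e.). An ergodic RU map (not necessarily basic) is weakly mixing if the probability preserving transformation $(X,\mathcal B(X),P,T)$ is weakly mixing. For a weakly mixing RU map it is known (Rychlik) that constants $C>0$, $r\in(0,1)$ as in (a), (b) exist. Mixing coefficients: for sub-$\sigma$-algebras $\mathcal A,\mathcal D$ of a probability space with probability $P$, $$\psi(\mathcal A,\mathcal D)=\sup\Big\{\Big|\tfrac{P(A\cap D)-P(A)P(D)}{P(A)P(D)}\Big|: A\in\mathcal A,\ D\in\mathcal D,\ P(A)>0,\ P(D)>0\Big\},$$ $$\phi(\mathcal A,\mathcal D)=\sup\Big\{\Big|\tfrac{P(A\cap D)}{P(A)}-P(D)\Big|: A\in\mathcal A,\ D\in\mathcal D,\ P(A)>0,\ P(D)>0\Big\},$$ $\phi_+(\mathcal A,\mathcal D)=\phi(\mathcal A,\mathcal D)$ and $\phi_-(\mathcal A,\mathcal D)=\phi(\mathcal D,\mathcal A)$. For a PM map with absolutely continuous invariant probability $P$, and $\xi\in\{\psi,\phi_+,\phi_-\}$, $$\xi(n)=\sup_{k\ge1}\xi\big(\sigma(\alpha_k),\,T^{-(n+k)}\mathcal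 B(X)\big),\qquad n\ge 1.$$
   Formalization: In (c) the infimum of m(T^n a) is taken only over cylinders a with P(a)>0; over all cylinders the claim fails when P is not equivalent to m, since P-null cylinders may have arbitrarily small images while P is an independent process. If P is equivalent to m nothing changes. *)

(* Defs.v *)
From HB Require Import structures.
From mathcomp Require Import all_boot all_order all_algebra.
From mathcomp Require Import all_classical all_reals all_analysis ess_sup_inf.

Set Implicit Arguments.
Unset Strict Implicit.
Unset Printing Implicit Defensive.

Import Order.TTheory GRing.Theory Num.Theory.
Import numFieldNormedType.Exports.

Local Open Scope classical_set_scope.
Local Open Scope ring_scope.

(* The unit interval X is a subset of the line: a map X -> X is a function
   R -> R sending X to X, a function on X is a function R -> R whose values
   off X are irrelevant, and B(X) is the set of Borel subsets of R contained
   in X. *)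

Section UnitInterval.
Context {R : realType}.

Definition X : set R := `[0, 1].

Lemma measurableX : measurable (X : set (measurableTypeR R)).
Proof. exact: measurable_itv. Qed.

Definition m : {measure set (measurableTypeR R) -> \bar R} :=
  mrestr lebesgue_measure measurableX.

Definition borelX : set (set (measurableTypeR R)) :=
  [set A | measurable A /\ A `<=` X].

(* T^{-n} A *)
Definition preX (T : R -> R) (n : nat) (A : set R) : set R :=
  X `&` iter n T @^-1` A.

(* Total variation on X of the version of f minimizing variation. *)
Definition essTV (f : R -> R) : \bar R :=
  ereal_inf [set total_variation 0 1 g | g in
    [set g : R -> R | \forall x \ae m, g x = f x]].

Definition BVnorm (f : R -> R) : \bar R :=
  (ess_sup m (fun x => `|f x|%:E) + essTV f)%E.

Definition BV (f : R -> R) : Prop :=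
  measurable_fun (X : set (measurableTypeR R)) f /\ (BVnorm f < +oo)%E.

Definition is_transfer (T g g' : R -> R) : Prop :=
  m.-integrable X (EFin \o g') /\
  forall f : R -> R, measurable_fun (X : set (measurableTypeR R)) f ->
    (ess_sup m (fun x => `|f x|%:E) < +oo)%E ->
    (\int[m]_(x in X) (g' x * f x)%:E = \int[m]_(x in X) (g x * f (T x))%:E)%E.

(* The transfer operator is determined up to a.e. equality only; [transfer]
   picks a representative. *)
Definition transfer (T g : R -> R) : R -> R :=
  xget (fun=> 0) [set g' | is_transfer T g g'].

End UnitInterval.

Section PiecewiseMonotonic.
Context {R : realType}.
Implicit Types (T : R -> R) (alpha : set (set R)) (a : set R).

Definition abs_cont_on (D : set R) (f : R -> R) : Prop :=
  forall e : R, 0 < e -> exists2 d : R, 0 < d &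
    forall (n : nat) (x y : 'I_n -> R),
      (forall i, [/\ x i <= y i & `[x i, y i] `<=` D]) ->
      trivIset setT (fun i => `]x i, y i[%classic) ->
      \sum_i (y i - x i) < d -> \sum_i `|f (y i) - f (x i)| < e.

Definition strictly_monotonic_on (D : set R) (f : R -> R) : Prop :=
  (forall x y, D x -> D y -> x < y -> f x < f y) \/
  (forall x y, D x -> D y -> x < y -> f y < f x).

Record pm_map T alpha : Prop := PMMap {
  pm_countable : countable alpha;
  pm_interval : forall a, alpha a ->
    exists c d : R, [/\ 0 <= c, c < d, d <= 1 & a = `]c, d[%classic];
  pm_disjoint : trivIset alpha id;
  pm_cover : m (X `\` \bigcup_(a in alpha) a) = 0%E;
  pm_self : forall x, X x -> X (T x);
  pm_measurable : measurable_fun (X : set (measurableTypeR R)) T;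
  pm_abs_cont : forall a, alpha a -> abs_cont_on a T;
  pm_monotonic : forall a, alpha a -> strictly_monotonic_on a T;
  pm_nonsingular : forall A : set R, borelX A -> m A = 0%E ->
    m (preX T 1 A) = 0%E }.

(* alpha_n, for n >= 1 *)
Definition cylinders T alpha (n : nat) : set (set R) :=
  [set A | A !=set0 /\ exists2 s : nat -> set R,
    (forall k, (k < n)%N -> alpha (s k)) &
    A = \bigcap_(k in `I_n) preX T k (s k)].

(* If P is only assumed to be << m, P-null cylinders may have arbitrarily
   small images while P does not see them: take the doubling map on [1/2, 1],
   T x = 2x on (0, 1/4), and T affine from (1/4, 1/2) onto (1/2, 1/2 + d) for
   a suitable irrational d; every mixing coefficient of P = 2 m|_[1/2, 1] is
   then 0. When P is equivalent to m all cylinders are charged. *)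
Definition charged_cylinders (P : probability (measurableTypeR R) R)
    T alpha (n : nat) : set (set R) :=
  [set a | cylinders T alpha n a /\ (0 < P a)%E].

(* inf {m(T^n a) : n >= 1, a in cyl_n} *)
Definition inf_image T (cyl : nat -> set (set R)) : \bar R :=
  ereal_inf [set z : \bar R | exists (n : nat) (a : set R),
    [/\ (0 < n)%N, cyl n a & z = m (iter n T @` a)]].

(* v_a : T a -> a, extended by 0 *)
Definition inv_branch T a : R -> R :=
  fun y => xget 0 [set x | a x /\ T x = y].

(* T is differentiable a.e. on each a; the infimum is over the points where
   the derivative exists. *)
Definition condU T alpha : Prop :=
  (1 < ereal_inf [set `|derive1 T x|%:E | x in
         [set x | (\bigcup_(a in alpha) a) x /\ derivable T x 1]])%E.

Definition condR T alpha : Prop :=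
  (\esum_(a in alpha)
     BVnorm (fun y => \1_(T @` a) y * derive1 (inv_branch T a) y)%R < +oo)%E.

Definition condF T alpha : Prop := finite_set [set T @` a | a in alpha].

Definition condA T alpha : Prop :=
  (ereal_sup [set (`|derive1 (derive1 T) x| / (derive1 T x) ^+ 2)%:E | x in
                \bigcup_(a in alpha) a] < +oo)%E.

Definition C2 (f : R -> R) : Prop :=
  [/\ forall x, derivable f x 1, forall x, derivable (derive1 f) x 1
    & continuous (derive1 (derive1 f))].

(* T|_a extends to a C^2 diffeomorphism from the closure of a onto that of
   T a, a function being C^2 on a compact interval when it is the restriction
   of a C^2 function on the line. *)
Definition extends_to_C2_diffeo T a : Prop :=
  exists S G : R -> R,
    [/\ C2 S, C2 G, S @` closure a = closure (T @` a),
        {in closure a, cancel S G} & {in a, S =1 T}].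

Definition ru_map T alpha : Prop :=
  [/\ pm_map T alpha, condU T alpha & condR T alpha].

Definition afu_map T alpha : Prop :=
  [/\ pm_map T alpha, forall a, alpha a -> extends_to_C2_diffeo T a,
      condU T alpha, condF T alpha & condA T alpha].

Definition ergodic T : Prop :=
  forall A : set R, borelX A -> m (preX T 1 A `+` A) = 0%E ->
    m A = 0%E \/ m (X `\` A) = 0%E.

(* Wandering sets are null. *)
Definition conservative T : Prop :=
  forall W : set R, borelX W -> trivIset setT (fun n => preX T n W) ->
    m W = 0%E.

Definition ac_invariant T (P : probability (measurableTypeR R) R) : Prop :=
  P `<< m /\ forall A : set R, borelX A -> P (preX T 1 A) = P A.

Definition density (P : probability (measurableTypeR R) R) (h : R -> R) : Prop :=
  [/\ measurable_fun (X : set (measurableTypeR R)) h,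
      forall x, X x -> 0 <= h x &
      forall A : set R, borelX A -> P A = (\int[m]_(x in A) (h x)%:E)%E].

Definition weakly_mixing T (P : probability (measurableTypeR R) R) : Prop :=
  forall A B : set R, borelX A -> borelX B ->
    (n.+1%:R^-1 * \sum_(k < n.+1)
       `|fine (P (A `&` preX T k B)) - fine (P A) * fine (P B)|) @[n --> \oo]
      --> (0 : R).

Definition spectral_gap T (h : R -> R) (C r : R) : Prop :=
  forall (f : R -> R) (n : nat), BV f -> (0 < n)%N ->
    (BVnorm (fun x => iter n (transfer T) f x
                      - (\int[m]_(y in X) f y) * h x)%R
     <= (C * r ^+ n)%:E * BVnorm f)%E.

(* Infimum of h over [h > 0], modulo m-null sets since h is a density. *)
Definition inf_pos (h : R -> R) : \bar R :=
  ereal_sup [set y : \bar R | \forall x \ae m, 0 < h x -> (y <= (h x)%:E)%E].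

(* {T^{-n} a : n >= 0, a in alpha} *)
Definition pullbacks T alpha : set (set R) :=
  [set A | exists n : nat, exists2 a, alpha a & A = preX T n a].

(* Equality with B(X) is modulo m-null sets, as is the covering of X by alpha. *)
Definition generating T alpha : Prop :=
  forall B : set R, borelX B ->
    exists2 A : set R, <<s X, pullbacks T alpha >> A & m (A `+` B) = 0%E.

End PiecewiseMonotonic.

Section MixingCoefficients.
Context {R : realType}.
Variable P : probability (measurableTypeR R) R.
Implicit Types (FA FD : set (set R)) (T : R -> R) (alpha : set (set R)).

Let p (A : set R) : R := fine (P A).

Definition psi_coef FA FD : \bar R :=
  ereal_sup [set z | exists A D, [/\ FA A, FD D, 0 < p A, 0 < p D &
    z = `|(p (A `&` D) - p A * p D) / (p A * p D)|%:E]].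

Definition phi_coef FA FD : \bar R :=
  ereal_sup [set z | exists A D, [/\ FA A, FD D, 0 < p A, 0 < p D &
    z = `|p (A `&` D) / p A - p D|%:E]].

Definition phi_plus_coef FA FD : \bar R := phi_coef FA FD.
Definition phi_minus_coef FA FD : \bar R := phi_coef FD FA.

Definition mixing_coef (xi : set (set R) -> set (set R) -> \bar R)
    T alpha (n : nat) : \bar R :=
  ereal_sup [set xi <<s X, cylinders T alpha k >>
                    [set preX T (n + k) B | B in borelX]
            | k in [set k | (0 < k)%N]].

End MixingCoefficients.

(* Main.v *)
(* For a finite union A of cylinders of order k let F_A = \hat T^k (1_A h), the
   sum over these cylinders b of F_b = \hat T^k (1_b h). Then
     P(A `&` T^-(n+k) B) - P(A) P(B)
       = \int_B (\hat T^n F_A - (\int F_A) h) dm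
   is at most C r^n ||F_A||_BV m(B), so everything reduces to bounds for
   ||F_A||_BV.
   (a) The sum of the variations of the F_b over distinct words b of length k is
   bounded uniformly in k: one more branch multiplies it by th = 1 / inf |T'| < 1
   and adds at most sup h times the sum of the variations of the v_a'. The sum
   of the F_b itself is at most h, and m(B) is at most P(B) / inf h.
   (b) By bounded distortion \hat T^k 1_b is at most a constant times
   m(b) / m(T^k b) and has variation of the same order, so that ||F_A||_BV is at
   most a constant times m(A). It remains to bound h from below. Call a set good
   if inf h > 0 on it; the image under T of a good subset of an element of alpha
   is good, and as h has bounded variation some cylinder is good. By ergodicity
   almost every point lies in a good interval T^k b, and these are open of length
   at least delta, so the points of X in none of them are finitely many. If
   inf h = 0 on every one-sided neighbourhood of such a point x, then, as
   {T a : a in alpha} is finite, a one-sided neighbourhood of x of size eta pulls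
   back under each branch into a one-sided neighbourhood of size th * eta of a
   point of the same kind. By invariance the union of these neighbourhoods has
   P-measure bounded by that for th^k * eta, hence 0, although h > 0 a.e.
   (c) If a is a charged cylinder of order k and T^k a is a very short interval,
   then B = T^n (T^k a) has small measure, as alpha is finite, while
   P(a `&` T^-(n+k) B) = P(a). *)
Require Import Defs.
From HB Require Import structures.
From mathcomp Require Import all_boot all_order all_algebra.
From mathcomp Require Import all_classical all_reals all_analysis.
From mathcomp Require Import ess_sup_inf measurable_realfun.
From mathcomp Require Import ring lra.

Set Implicit Arguments.
Unset Strict Implicit.
Unset Printing Implicit Defensive.

Import Order.TTheory GRing.Theory Num.Theory.
Import numFieldNormedType.Exports.

Local Open Scope classical_set_scope.
Local Open Scope ring_scope.

(** The obstacle is that h, the branch weights and the transfer operator are given only up to null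
    sets, while variation is a pointwise notion. Pointwise estimates are therefore made on one
    conull set [G] that avoids countably many null sets and is stable under the inverse branches at
    points of nonzero weight. Variation is measured along finite increasing lists of points of [G];
    a Jordan decomposition then turns such a bound into one for [BVnorm]. That h is bounded and of
    bounded variation is not assumed: by the spectral gap for n = 1 and f = 1 the function \hat T 1
    - h is in BV, and \hat T 1 is the sum of the branch weights. The factor th per letter in (a),
    with no factor for the number of branches, comes from the disjointness of the elements of alpha:
    the lists pulled back along different branches lie in disjoint intervals and merge into one
    increasing list. As alpha may be infinite, a set of sigma(alpha_k) is reached as an increasing
    limit of finite unions of cylinders, modulo null sets, with bounds uniform in the union. *)

(** * Lebesgue measure on the unit interval *)

Section UnitIntervalMeasure.
Context {R : realType}.
Implicit Types (A B : set R) (a b c d : R).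

Lemma mE A : m A = lebesgue_measure (A `&` X).
Proof. by []. Qed.

Lemma XE (x : R) : X x = (0 <= x <= 1) :> Prop.
Proof. by rewrite /X /= in_itv. Qed.

Lemma mX : measurable (X : set (measurableTypeR R)).
Proof. exact: measurable_itv. Qed.

Lemma ccP (c d x : R) : `[c, d]%classic x = (c <= x <= d) :> Prop.
Proof. by rewrite /= in_itv. Qed.

Lemma ooP (c d x : R) : `]c, d[%classic x = (c < x < d) :> Prop.
Proof. by rewrite /= in_itv. Qed.

Lemma cc_subX c d : 0 <= c -> d <= 1 -> `[c, d]%classic `<=` (X : set R).
Proof.
move=> c0 d1 x; rewrite ccP XE => /andP[cx xd].
by rewrite (le_trans c0 cx) (le_trans xd d1).
Qed.

Lemma oo_cc c d : (`]c, d[%classic : set R) `<=` `[c, d]%classic.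
Proof. by move=> x; rewrite ccP ooP => /andP[/ltW -> /ltW ->]. Qed.

Lemma m_cc c d : 0 <= c -> c <= d -> d <= 1 -> m `[c, d]%classic = (d - c)%:E.
Proof.
move=> c0 cd d1; rewrite mE setIidl; last exact: cc_subX.
rewrite lebesgue_measure_itv /= lte_fin EFinB.
by move: cd; rewrite le_eqVlt => /orP[/eqP ->|->//]; rewrite ltxx subee.
Qed.

Lemma m_X : m (X : set R) = 1%E.
Proof. by rewrite /X m_cc ?lexx// subr0. Qed.

Lemma m_setT : m (setT : set R) = 1%E.
Proof. by rewrite mE setTI -[X in lebesgue_measure X]setIid -mE m_X. Qed.

Lemma m_setIX A : m (A `&` X) = m A.
Proof. by rewrite !mE -setIA setIid. Qed.

Lemma m_XC : m (~` (X : set R)) = 0%E.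
Proof. by rewrite mE setICl measure0. Qed.


Lemma ge0_integral_mX (D : set R) (f : R -> \bar R) :
  measurable (D : set (measurableTypeR R)) -> D `<=` X ->
  (\int[m]_(x in D) f x = \int[lebesgue_measure]_(x in D) f x)%E.
Proof.
move=> mD DX; apply: eq_measure_integral => // A mA AD.
by rewrite mE setIidl//; exact: subset_trans DX.
Qed.

(** [m] lives on the whole line and gives no mass to the complement of X, so this complement can be
    added to an exceptional set at no cost. From here on null sets are mostly those of Lebesgue
    measure. *)
Lemma ae_mP (Q : R -> Prop) :
  (\forall x \ae m, Q x) <-> (\forall x \ae lebesgue_measure, X x -> Q x).
Proof.
split.
  move=> [A [mA A0 QA]]; exists (A `&` X); split.
  - exact: (measurableI _ _ mA mX).
  - exact: A0.
  move=> x /= /not_implyP[Xx nQ]; split=> //; exact: QA.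
move=> [A [mA A0 QA]]; exists (A `|` ~` X); split.
- exact: measurableU mA (measurableC mX).
- apply/eqP; rewrite eq_le measure_ge0 andbT.
  rewrite (le_trans (measureU2 _ mA (measurableC mX)))//.
  rewrite [X in (_ + X <= _)%E]m_XC adde0 -A0.
  apply: (@le_measure _ _ _ lebesgue_measure) => //; rewrite ?inE//.
  exact: (measurableI _ _ mA mX).
- move=> x /= nQ; have [Xx|nX] := pselect (X x); [left|by right].
  by apply: QA => /= /(_ Xx).
Qed.

End UnitIntervalMeasure.

(** * Densities of measures and of their images under T *)

Section DensityMeasure.
Local Open Scope ereal_scope.
Context d (T : measurableType d) (R : realType).
Variables (mu : {sigma_finite_measure set T -> \bar R}) (g : T -> \bar R).
Hypotheses (ig : mu.-integrable setT g) (g0 : forall x, 0 <= g x).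

(* The hypotheses are arguments so that the measure structure can be inferred. *)
Definition density_measure of mu.-integrable setT g & (forall x, 0 <= g x) :=
  fun A : set T => \int[mu]_(x in A) g x.

Local Notation nu := (density_measure ig g0).

Let nu_set0 : nu set0 = 0. Proof. exact: integral_set0. Qed.

Let nu_ge0 A : 0 <= nu A. Proof. exact: integral_ge0. Qed.

Let nu_sigma_additive : semi_sigma_additive nu.
Proof.
have mg : measurable_fun setT g := measurable_int _ ig.
move=> F mF tF mUF; rewrite /density_measure ge0_integral_bigcup//; last first.
  exact: measurable_funTS.
by apply: is_cvg_ereal_nneg_natsum => n _; exact: integral_ge0.
Qed.

HB.instance Definition _ :=
  isMeasure.Build _ _ _ nu nu_set0 nu_ge0 nu_sigma_additive.

Let nu_fin : fin_num_fun nu.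
Proof.
move=> A mA; rewrite ge0_fin_numE//.
move/integrableP : (ig) => [mg]; apply: le_lt_trans.
under [leRHS]eq_integral do rewrite gee0_abs//.
exact: ge0_subset_integral.
Qed.

HB.instance Definition _ := Measure_isFinite.Build _ _ _ nu nu_fin.

(** The Radon-Nikodym derivative of [nu] has the same integrals as [g] over measurable sets, hence
    equals it a.e., and the change of variables known for the derivative carries over to [g]. *)
Lemma ge0_integral_density (u : T -> \bar R) : measurable_fun setT u ->
  (forall x, 0 <= u x) -> \int[nu]_x u x = \int[mu]_x (g x * u x).
Proof.
move=> mfu u0.
have mg : measurable_fun setT g := measurable_int _ ig.
have numu : nu `<< mu.
  apply/null_content_dominatesP => A mA A0.
  rewrite /= /density_measure; apply: null_set_integral => //.
  exact: measurable_funTS.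
rewrite -(Radon_Nikodym_SigmaFinite.change_of_variables numu)//.
have Hg : ae_eq mu setT (Radon_Nikodym_SigmaFinite.f nu mu) g.
  apply: integral_ae_eq => //.
  - exact: Radon_Nikodym_SigmaFinite.f_integrable.
  - by move=> A _ mA; rewrite -Radon_Nikodym_SigmaFinite.f_integral.
apply: ae_eq_integral => //.
- apply: emeasurable_funM => //.
  exact: measurable_int (Radon_Nikodym_SigmaFinite.f_integrable _).
- exact: emeasurable_funM.
- by apply: filterS Hg => x /(_ I) -> _; exact: muleC.
Qed.

End DensityMeasure.

Section PushDensity.
Local Open Scope ereal_scope.
Context d d' (T : measurableType d) (T' : measurableType d') (R : realType).
Variables (mu : {sigma_finite_measure set T -> \bar R}) (g : T -> \bar R).
Variable phi : T -> T'.
Hypotheses (ig : mu.-integrable setT g) (g0 : forall x, 0 <= g x).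
Hypothesis mphi : measurable_fun setT phi.

(** This is the push-forward of [density_measure] by [phi]. It has a name of its own, with the
    hypotheses as arguments, so that the finite measure structure can be attached to it. *)
Definition push_density of mu.-integrable setT g & (forall x, 0 <= g x) &
  measurable_fun setT phi := fun A : set T' => \int[mu]_(x in phi @^-1` A) g x.

Local Notation nu := (push_density ig g0 mphi).

Let nuE : nu = pushforward (density_measure ig g0) phi. Proof. by []. Qed.

Let nu_set0 : nu set0 = 0. Proof. by rewrite nuE measure0. Qed.

Let nu_ge0 A : 0 <= nu A. Proof. exact: integral_ge0. Qed.

Let nu_sigma_additive : semi_sigma_additive nu.
Proof. by rewrite nuE; exact: measure_semi_sigma_additive. Qed.

HB.instance Definition _ :=
  isMeasure.Build _ _ _ nu nu_set0 nu_ge0 nu_sigma_additive.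

Let nu_fin : fin_num_fun nu.
Proof.
move=> A mA; apply: (fin_num_measure (density_measure ig g0)).
by have := mphi measurableT mA; rewrite setTI.
Qed.

HB.instance Definition _ := Measure_isFinite.Build _ _ _ nu nu_fin.

Lemma ge0_integral_push_density (u : T' -> \bar R) : measurable_fun setT u ->
  (forall x, 0 <= u x) -> \int[nu]_x u x = \int[mu]_x (g x * u (phi x)).
Proof.
move=> mfu u0.
have mup : measurable_fun setT (u \o phi) by exact: measurableT_comp.
rewrite -(@ge0_integral_density _ _ _ _ _ ig g0 (u \o phi)) //=.
rewrite -[RHS](@ge0_integral_pushforward _ _ _ _ _ phi mphi _ setT u)//.
Qed.

End PushDensity.

Section TransferDensity.
Context {R : realType} (T : R -> R) (alpha : set (set R)).
Hypothesis pm : pm_map T alpha.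
Local Notation MR := (measurableTypeR R).
Local Notation mu := (@lebesgue_measure R).

Lemma pm_self_iter n x : X x -> X (iter n T x).
Proof. by move=> Xx; elim: n => //= n; exact: (pm_self pm). Qed.

(** [T] is known to be measurable on X only; cut off at X it is measurable on the line. *)
Let TX := T \_ X.

Lemma measurable_patchX (f : R -> R) :
  measurable_fun (X : set MR) f -> measurable_fun [set: MR] (f \_ X).
Proof. by move=> mf; apply/(measurable_restrictT _ _).1 => //; exact: mX. Qed.

Let mTX : measurable_fun [set: MR] TX.
Proof. exact: measurable_patchX (pm_measurable pm). Qed.

Lemma measurable_preX n (B : set R) : measurable (B : set MR) ->
  measurable (preX T n B : set MR).
Proof.
move=> mB; elim: n B mB => [|n IH] B mB.
  by apply: measurableI => //; exact: mX.
have -> : preX T n.+1 B = preX T n (X `&` T @^-1` B).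
  apply/seteqP; split=> x [Xx] /=; first by move=> ?; repeat split => //; exact: pm_self_iter.
  by move=> [_ ?]; split.
by apply: IH; apply: (pm_measurable pm) => //; exact: mX.
Qed.

(** The image under T of the measure with density [g] is absolutely continuous because T is
    non-singular; [w] is its Radon-Nikodym derivative, set to 0 off X. *)
Lemma transfer_density (g : R -> R) :
  mu.-integrable [set: MR] (EFin \o g) -> (forall x, 0 <= g x) ->
  (forall x, ~ X x -> g x = 0) ->
  exists w : R -> R, [/\ mu.-integrable [set: MR] (EFin \o w),
    forall x, 0 <= w x, forall x, ~ X x -> w x = 0 &
    forall u : R -> \bar R, measurable_fun [set: MR] u -> (forall x, 0 <= u x)%E ->
      (\int[mu]_x ((w x)%:E * u x) = \int[mu]_x ((g x)%:E * u (T x)))%E].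
Proof.
move=> ig g0 gX.
have eg0 x : (0 <= (EFin \o g) x)%E by rewrite lee_fin.
pose nu : {finite_measure set MR -> \bar R} :=
  @push_density _ _ MR MR R mu (EFin \o g) TX ig eg0 mTX.
have nT : nu `<< mu.
  apply/null_content_dominatesP => A mA A0; rewrite /nu /= /push_density.
  have mTA : measurable (TX @^-1` A : set MR) by have := mTX measurableT mA; rewrite setTI.
  have mTAX : measurable (preX T 1 (A `&` X) : set MR).
    by apply: measurable_preX; exact: (measurableI _ _ mA mX).
  have E0 : mu (preX T 1 (A `&` X)) = 0%E.
    have AX0 : m (A `&` X) = 0%E.
      rewrite m_setIX mE; apply/eqP; rewrite eq_le measure_ge0 andbT -A0.
      by apply: le_measure; rewrite ?inE//; exact: (measurableI _ _ mA mX).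
    have := pm_nonsingular pm (conj (measurableI _ _ mA mX) (@subIsetr _ A X)) AX0.
    by rewrite mE setIidl// => x [].
  have -> : (\int[mu]_(x in TX @^-1` A) (g x)%:E =
             \int[mu]_(x in preX T 1 (A `&` X)) (g x)%:E)%E.
    rewrite [LHS]integral_mkcond [RHS]integral_mkcond; apply: eq_integral => x _.
    rewrite !patchE; have [Xx|nX] := pselect (X x); last first.
      by rewrite gX//; case: ifP; case: ifP.
    suff -> : (x \in TX @^-1` A) = (x \in preX T 1 (A `&` X)) by [].
    apply/idP/idP; rewrite !inE /= /TX patchE (mem_set Xx).
      by split => //; split => //; exact: (pm_self pm).
    by move=> [_ []].
  by apply: null_set_integral => //; exact: measurable_funTS (measurable_int _ ig).
have f0 := Radon_Nikodym_SigmaFinite.f_ge0 nT.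
have ffin := Radon_Nikodym_SigmaFinite.f_fin_num nT.
have fint := Radon_Nikodym_SigmaFinite.f_integrable nT.
have cov := Radon_Nikodym_SigmaFinite.change_of_variables nT.
set f := Radon_Nikodym_SigmaFinite.f _ _ in f0 ffin fint cov *.
have mf : measurable_fun [set: MR] f := measurable_int _ fint.
have wE x : (((fine \o f) \_ X) x)%:E = (f \_ X) x.
  by rewrite !patchE; case: ifP => //= _; rewrite fineK.
exists ((fine \o f) \_ X); split.
- rewrite (_ : EFin \o _ = f \_ X); last by apply/funext => x /=; rewrite wE.
  apply/(integrable_mkcond _ mX).
  exact: (integrableS measurableT mX (@subsetT _ _) fint).
- by move=> x; rewrite patchE; case: ifP => // _ /=; rewrite fine_ge0.
- by move=> x nX; rewrite patchE memNset.
move=> u mfu u0.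
have muX : measurable_fun [set: MR] (u \_ X).
  apply/(measurable_restrictT _ _).1; first exact: mX.
  exact: measurable_funTS.
transitivity (\int[mu]_(x in X) (u x * f x))%E.
  rewrite [RHS]integral_mkcond; apply: eq_integral => x _.
  by rewrite wE !patchE; case: ifP => //; rewrite ?mul0e// muleC.
rewrite cov//; [|exact: mX|exact: measurable_funTS].
rewrite integral_mkcond ge0_integral_push_density//; last first.
  by move=> x; rewrite patchE; case: ifP.
apply: eq_integral => x _; have [Xx|nX] := pselect (X x); last first.
  by rewrite /= gX// !mul0e.
rewrite [in X in (_ * X)%E]patchE /TX patchE (mem_set Xx) mem_set//.
exact: (pm_self pm).
Qed.

End TransferDensity.

(** * Intervals and monotone branches *)

Section Intervals.
Context {R : realType}.
Implicit Types (E F : set R) (f : R -> R).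

Definition open_interval E := exists e f : R, e < f /\ E = `]e, f[%classic.

Lemma open_intervalI E F x : open_interval E -> open_interval F ->
  E x -> F x -> open_interval (E `&` F).
Proof.
move=> [e [f [ef ->]]] [e' [f' [ef' ->]]]; rewrite !ooP => /andP[ex xf] /andP[ex' xf'].
exists (Num.max e e'), (Num.min f f'); split.
  by rewrite lt_min !gt_max; rewrite (lt_trans ex xf) (lt_trans ex' xf) (lt_trans ex xf') (lt_trans ex' xf').
apply/seteqP; split=> y /=; rewrite !in_itv /= gt_max lt_min.
  by move=> [/andP[-> ->] /andP[-> ->]].
by move=> /andP[/andP[-> ->] /andP[-> ->]].
Qed.

Lemma open_interval_convex E : open_interval E -> is_interval E.
Proof. by move=> [e [f [_ ->]]]; exact: interval_is_interval. Qed.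

Lemma open_interval_measurable E : open_interval E ->
  measurable (E : set (measurableTypeR R)).
Proof. by move=> [e [f [_ ->]]]; exact: measurable_itv. Qed.

Lemma open_interval_open E : open_interval E -> open E.
Proof. by move=> [e [f [_ ->]]]; exact: interval_open. Qed.

(** As no point of [E] is extremal, the infimum and the supremum are not attained, and [E] is the
    open interval between them. *)
Lemma open_intervalPn E : E !=set0 -> E `<=` X -> is_interval E ->
  (forall x, E x -> exists y z, [/\ E y, E z & y < x < z]) -> open_interval E.
Proof.
move=> E0 EX iE noext.
have hE : has_ubound E by exists 1 => x /EX; rewrite XE => /andP[].
have lE : has_lbound E by exists 0 => x /EX; rewrite XE => /andP[].
have sub x : E x -> inf E < x < sup E.
  move=> /noext[y [z [Ey Ez /andP[yx xz]]]].
  by rewrite (le_lt_trans (ge_inf lE Ey) yx) (lt_le_trans xz (ub_le_sup hE Ez)).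
exists (inf E), (sup E); split.
  by have [x Ex] := E0; have /andP[] := sub _ Ex; exact: lt_trans.
apply/seteqP; split=> x; rewrite ooP; first exact: sub.
move=> /andP[/(inf_lt E0)[y Ey yx] /(sup_gt E0)[z Ez xz]].
by apply: (iE y z) => //; rewrite (ltW yx) (ltW xz).
Qed.

(** The sign [s] lets increasing and decreasing branches be treated by one computation. *)
Definition oriented (s : R) E (f : R -> R) :=
  (s = 1 \/ s = -1) /\ forall x y, E x -> E y -> x < y -> 0 < s * (f y - f x).

Lemma oriented_ex E f : strictly_monotonic_on E f -> exists s, oriented s E f.
Proof.
case=> H; [exists 1|exists (-1)]; split; do 1?[by left|by right] => x y Ex Ey xy.
  by rewrite mul1r subr_gt0 H.
by rewrite mulN1r opprB subr_gt0 H.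
Qed.

Lemma oriented_sq s E f : oriented s E f -> s * s = 1.
Proof. by move=> [[->|->] _]; rewrite ?mulr1 ?mulrNN ?mulr1. Qed.

Lemma oriented_norm s E f x : oriented s E f -> `|s * x| = `|x|.
Proof. by move=> [[->|->] _]; rewrite ?mul1r ?mulN1r ?normrN. Qed.

Lemma oriented_lt s E f x y : oriented s E f -> E x -> E y ->
  (0 < s * (f y - f x)) = (x < y).
Proof.
move=> [s1 H] Ex Ey; case: (ltgtP x y) => [xy|yx|->].
- exact: H.
- have := H _ _ Ey Ex yx; rewrite -opprB mulrN oppr_gt0 => h.
  by apply/negbTE; rewrite -leNgt ltW.
- by rewrite subrr mulr0 ltxx.
Qed.

Lemma oriented_inj s E f x y : oriented s E f -> E x -> E y -> f x = f y -> x = y.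
Proof.
move=> o Ex Ey fxy; apply/eqP; rewrite eq_le !leNgt.
by rewrite -(oriented_lt o Ex Ey) -(oriented_lt o Ey Ex) fxy subrr mulr0 ltxx.
Qed.

Lemma oriented_sub s E F f : F `<=` E -> oriented s E f -> oriented s F f.
Proof. by move=> FE [s1 H]; split=> // x y /FE Ex /FE Ey; exact: H. Qed.

Lemma abs_cont_continuous E f : open E -> is_interval E -> abs_cont_on E f ->
  forall x, E x -> {for x, continuous f}.
Proof.
move=> oE iE ac x Ex; apply/cvgrPdist_lt => e e0.
have [d d0 H] := ac e e0.
have near_E : \forall t \near x, E t by exact: open_nbhs_nbhs.
near=> t.
have Et : E t by near: t.
have td : `|x - t| < d by near: t; exact: (nbhsx_ballx x d d0).
have step u v : E u -> E v -> u <= v -> v - u < d -> `|f v - f u| < e.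
  move=> Eu Ev uv vud.
  have := H 1%N (fun=> u) (fun=> v); rewrite !big_ord1; apply => //.
    by move=> _; split => // z /=; rewrite in_itv /=; exact: iE.
  by move=> i j _ _ _; rewrite (ord1 i) (ord1 j).
have [tx|/ltW xt] := leP t x.
  by apply: step => //; rewrite -(ger0_norm (_ : 0 <= x - t)) // subr_ge0.
rewrite distrC; apply: step => //.
by rewrite -(ger0_norm (_ : 0 <= t - x)) ?subr_ge0// distrC.
Unshelve. all: by end_near. Qed.

Lemma continuous_is_interval E f : is_interval E ->
  (forall x, E x -> {for x, continuous f}) -> is_interval (f @` E).
Proof.
move=> iE cf _ _ [p Ep <-] [q Eq <-] z /andP[pz zq].
wlog pq : / exists p' q', [/\ E p', E q', p' <= q' & Num.min (f p') (f q') <= z <= Num.max (f p') (f q')].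
  apply; have [pq|/ltW qp] := leP p q; [exists p, q|exists q, p]; split => //.
    by rewrite ge_min le_max pz zq orbT.
  by rewrite ge_min le_max pz zq orbT.
have {pz zq}[p' [q' [Ep' Eq' pq' zpq]]] := pq.
have sub t : p' <= t <= q' -> E t by exact: iE.
have [] := IVT pq' _ zpq.
  apply: continuous_in_subspaceT => t; rewrite inE /= in_itv /= => /sub.
  exact: cf.
by move=> c; rewrite in_itv /= => /sub Ec <-; exists c.
Qed.

Lemma image_open_interval s E f : open_interval E -> oriented s E f ->
  (forall x, E x -> {for x, continuous f}) -> f @` E `<=` X ->
  open_interval (f @` E).
Proof.
move=> oE of_ cf fX; apply: open_intervalPn => //.
- have [e [g [eg ->]]] := oE; exists (f ((e + g) / 2)), ((e + g) / 2) => //=.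
  by rewrite in_itv /= midf_lt//= midf_lt.
- by apply: continuous_is_interval => //; exact: open_interval_convex.
move=> _ [x Ex <-].
have [p [q [Ep Eq /andP[px xq]]]] : exists p q, [/\ E p, E q & p < x < q].
  have [e [g [eg EE]]] := oE; move: Ex; rewrite EE ooP => /andP[ex xg].
  exists ((e + x) / 2), ((x + g) / 2); rewrite !ooP.
  have := midf_lt ex; have := midf_lt xg => -[h1 h2] [h3 h4].
  split; rewrite ?h1 ?h2 ?h3 ?h4 ?(lt_trans h3 (lt_trans h4 xg))//.
    by rewrite (lt_trans h4 xg).
  by rewrite (lt_trans ex h1).
have := of_.2 _ _ Ep Ex px; have := of_.2 _ _ Ex Eq xq.
case: of_.1 => ->; rewrite ?mul1r ?mulN1r ?oppr_gt0 ?subr_gt0 ?subr_lt0 => h1 h2.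
  by exists (f p), (f q); split; [exists p|exists q|rewrite h1 h2].
by exists (f q), (f p); split; [exists q|exists p|rewrite h1 h2].
Qed.

End Intervals.

Section Branch.
Context {R : realType} (T : R -> R) (alpha : set (set R)).
Hypothesis pm : pm_map T alpha.
Local Notation MR := (measurableTypeR R).
Local Notation mu := (@lebesgue_measure R).
Variable a : set R.
Hypothesis aa : alpha a.
Local Notation v := (inv_branch T a).

Lemma branch_oi : open_interval a.
Proof. by have [c [d [_ cd _ ->]]] := pm_interval pm aa; exists c, d. Qed.

Lemma branch_subX : a `<=` X.
Proof.
have [c [d [c0 _ d1 ->]]] := pm_interval pm aa.
exact: subset_trans (@oo_cc _ c d) (cc_subX c0 d1).
Qed.

Lemma branch_image_subX : T @` a `<=` X.
Proof. by move=> _ [x /branch_subX Xx <-]; exact: (pm_self pm). Qed.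

Lemma branch_continuous x : a x -> {for x, continuous T}.
Proof.
exact: (abs_cont_continuous (open_interval_open branch_oi)
  (open_interval_convex branch_oi) (pm_abs_cont pm aa)).
Qed.

Lemma branch_oriented_ex : exists s, oriented s a T.
Proof. exact: oriented_ex (pm_monotonic pm aa). Qed.

Lemma branch_inj x y : a x -> a y -> T x = T y -> x = y.
Proof. by have [s] := branch_oriented_ex; exact: oriented_inj. Qed.

Lemma branchP y : (T @` a) y -> a (v y) /\ T (v y) = y.
Proof. by move=> [x ax xy]; apply: (@xgetPex _ 0 [set x | a x /\ T x = y]); exists x. Qed.

Lemma branchK x : a x -> v (T x) = x.
Proof.
move=> ax; have [av Tv] := @branchP (T x) (imageP _ ax).
exact: branch_inj.
Qed.

Lemma branch_out y : ~ (T @` a) y -> v y = 0.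
Proof. by move=> ny; apply: xgetPN => x [ax xy]; apply: ny; exists x. Qed.

Lemma branch_X y : X (v y).
Proof.
have [/branchP[/branch_subX]//|/branch_out ->] := pselect ((T @` a) y).
by rewrite XE lexx ler01.
Qed.

Lemma inv_branch_oriented s : oriented s a T -> oriented s (T @` a) v.
Proof.
move=> o; split; first by case: o.
move=> _ _ [x ax <-] [y ay <-]; rewrite !branchK//.
move: (o) => [s1 _]; have xy := oriented_lt o ax ay; have yx := oriented_lt o ay ax.
move: xy yx; case: s1 => ->; rewrite ?mul1r ?mulN1r ?opprB !subr_gt0.
  by move=> <-.
by move=> _ ->.
Qed.

Lemma branch_image_oi E : E `<=` a -> open_interval E -> open_interval (T @` E).
Proof.
move=> Ea oE; have [s os] := branch_oriented_ex.
apply: (image_open_interval oE (oriented_sub Ea os)).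
  by move=> x /Ea; exact: branch_continuous.
by move=> _ [x /Ea ax <-]; apply: branch_image_subX; exists x.
Qed.

(** [T] maps open subintervals of [a] to open intervals, so the image of a small interval around x
    is a neighbourhood of [T x]. *)
Lemma inv_branch_continuous y : (T @` a) y -> {for y, continuous v}.
Proof.
move=> [x ax <-]; apply/cvgrPdist_lt => e e0; rewrite branchK//.
have oB : open_interval `]x - e, x + e[%classic.
  by exists (x - e), (x + e); split => //; lra.
have xB : `]x - e, x + e[%classic x by rewrite ooP; apply/andP; split; lra.
have oE := open_intervalI branch_oi oB ax xB.
have oTE : open_interval (T @` (a `&` `]x - e, x + e[)).
  by apply: branch_image_oi => // ? [].
have : nbhs (T x) (T @` (a `&` `]x - e, x + e[)).
  by apply: open_nbhs_nbhs; split; [exact: open_interval_open|exists x].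
apply: filterS => _ [z [az] + <-]; rewrite ooP branchK// => /andP[z1 z2].
by rewrite ltr_distl; apply/andP; split; lra.
Qed.

Lemma measurable_inv_branch : measurable_fun [set: MR] v.
Proof.
have oi := branch_image_oi (@subset_refl _ a) branch_oi.
have -> : v = v \_ (T @` a).
  apply/funext => y; rewrite patchE; case: ifPn => //; rewrite notin_setE.
  exact: branch_out.
apply/(measurable_restrictT _ _).1; first exact: open_interval_measurable.
apply: open_continuous_measurable_fun; first exact: open_interval_open.
by move=> y; rewrite inE; exact: inv_branch_continuous.
Qed.

Lemma branch_preimage_oo s y z : oriented s a T -> (T @` a) y -> (T @` a) z ->
  y < z -> mu (a `&` T @^-1` `]y, z[) = (s * (v z - v y))%:E.
Proof.
move=> os Ty Tz yz; have ov := inv_branch_oriented os.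
have [av Tv] := branchP Ty; have [az' Tz'] := branchP Tz.
have s_lt : 0 < s * (v z - v y) by rewrite (oriented_lt ov).
have Eq x : a x -> `]y, z[%classic (T x) =
    (0 < s * (x - v y)) && (0 < s * (v z - x)) :> Prop.
  move=> ax; have Tx : (T @` a) (T x) by exists x.
  by rewrite ooP -(oriented_lt ov Ty Tx) -(oriented_lt ov Tx Tz) branchK.
have ia := open_interval_convex branch_oi.
case: os.1 => s1; rewrite s1 ?mul1r ?mulN1r ?opprB in s_lt Eq *.
  have -> : a `&` T @^-1` `]y, z[ = `]v y, v z[%classic.
    apply/seteqP; split=> x /=.
      by move=> [ax /= h]; move: (h : `]y, z[%classic (T x)); rewrite Eq// in_itv /= !mul1r !subr_gt0.
    rewrite in_itv /= => /andP[x1 x2].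
    have ax : a x by apply: (ia (v y) (v z)) => //; rewrite !ltW.
    split=> //; rewrite -/(`]y, z[%classic (T x)) Eq// !mul1r !subr_gt0.
    by rewrite x1 x2.
  by rewrite lebesgue_measure_itv /= lte_fin -subr_gt0 s_lt EFinB.
have -> : a `&` T @^-1` `]y, z[ = `]v z, v y[%classic.
  apply/seteqP; split=> x /=.
    by move=> [ax /= h]; move: (h : `]y, z[%classic (T x)); rewrite Eq// in_itv /= !mulN1r !opprB !subr_gt0 andbC.
  rewrite in_itv /= => /andP[x1 x2].
  have ax : a x by apply: (ia (v z) (v y)) => //; rewrite !ltW.
  split=> //; rewrite -/(`]y, z[%classic (T x)) Eq// !mulN1r !opprB !subr_gt0.
  by rewrite x1 x2.
by rewrite lebesgue_measure_itv /= lte_fin -subr_gt0 s_lt EFinB.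
Qed.

End Branch.

(** * Branch weights as derivatives of the inverse branches *)

Section BranchDensity.
Context {R : realType} (T : R -> R) (alpha : set (set R)).
Hypothesis pm : pm_map T alpha.
Local Notation MR := (measurableTypeR R).
Local Notation mu := (@lebesgue_measure R).
Variable a : set R.
Hypothesis aa : alpha a.
Local Notation v := (inv_branch T a).

(* [w] is the density of the push-forward by T of Lebesgue measure on a,
   that is [w = \hat T 1_a]. *)
Definition branch_density (w : R -> R) : Prop :=
  [/\ mu.-integrable [set: MR] (EFin \o w), forall x, 0 <= w x,
      forall x, ~ (T @` a) x -> w x = 0 &
      forall u : R -> \bar R, measurable_fun [set: MR] u ->
        (forall x, 0 <= u x)%E ->
        (\int[mu]_x ((w x)%:E * u x) = \int[mu]_(x in a) u (T x))%E].

Let oTa := branch_image_oi pm aa (@subset_refl _ a) (branch_oi pm aa).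
Let ma := open_interval_measurable (branch_oi pm aa).
Let mTa := open_interval_measurable oTa.

Lemma branch_density_ex : exists w, branch_density w.
Proof.
have aX := branch_subX pm aa.
have ig : mu.-integrable [set: MR] (EFin \o (\1_a : R -> R)).
  by have [c [d [_ cd _ ->]]] := pm_interval pm aa; exact: integrable_indic_itv.
have g0 x : 0 <= (\1_a x : R) by [].
have gX x : ~ X x -> (\1_a x : R) = 0.
  by move=> nX; rewrite indicE memNset// => /aX.
have [w0 [iw w00 w0X cov]] := transfer_density pm ig g0 gX.
exists (w0 \_ (T @` a)); split.
- have -> : EFin \o w0 \_ (T @` a) = (EFin \o w0) \_ (T @` a).
    by apply/funext => x /=; rewrite !patchE; case: ifP.
  apply/(integrable_mkcond _ mTa).
  exact: (integrableS measurableT mTa (@subsetT _ _) iw).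
- by move=> x; rewrite patchE; case: ifP.
- by move=> x nTa; rewrite patchE memNset.
move=> u mfu u0.
transitivity (\int[mu]_x ((w0 x)%:E * (u \_ (T @` a)) x))%E.
  by apply: eq_integral => x _; rewrite !patchE; case: ifP; rewrite ?mul0e ?mule0.
rewrite cov; last 2 first.
- apply/(measurable_restrictT _ _).1 => //; exact: measurable_funTS.
- by move=> x; rewrite patchE; case: ifP.
rewrite [RHS]integral_mkcond; apply: eq_integral => x _.
rewrite indicE [in RHS]patchE; case: ifPn => [ax|_]; rewrite ?mul0e// mul1e patchE mem_set//.
by exists x => //; rewrite inE in ax.
Qed.

Variable w : R -> R.
Hypothesis bw : branch_density w.

Lemma branch_density_sub s y z : oriented s a T -> (T @` a) y -> (T @` a) z ->
  y < z -> (s * (v z - v y))%:E = (\int[mu]_(t in `]y, z[) (w t)%:E)%E.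
Proof.
move=> os Ty Tz yz; rewrite -(branch_preimage_oo pm aa os Ty Tz yz).
have [iw w0 _ cov] := bw.
have mI : measurable (`]y, z[%classic : set MR) := measurable_itv _.
have -> : (\int[mu]_(x in `]y, z[) (w x)%:E =
           \int[mu]_x ((w x)%:E * (\1_(`]y, z[%classic) x)%:E))%E.
  rewrite [LHS]integral_mkcond; apply: eq_integral => x _.
  by rewrite indicE patchE; case: ifP; rewrite ?mule1 ?mule0.
rewrite cov; last 2 first.
- by apply/measurable_EFinP; exact: measurable_indic.
- by move=> x; rewrite lee_fin.
transitivity (\int[mu]_(x in a) (\1_(a `&` T @^-1` `]y, z[) x)%:E)%E; last first.
  apply: eq_integral => x; rewrite inE => ax.
  by rewrite !indicE in_setI (mem_set ax).
apply/esym; rewrite integral_indic//; last first.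
  have -> : a `&` T @^-1` `]y, z[ = a `&` (X `&` T @^-1` `]y, z[).
    by rewrite setIA (setIidl (branch_subX pm aa)).
  by apply: measurableI => //; apply: (pm_measurable pm) => //; exact: mX.
by rewrite setIAC setIid.
Qed.

(** On [T a] the inverse branch differs by a constant from [s] times a primitive of [w], and
    Lebesgue differentiation recovers [w] from this primitive a.e. *)
Lemma branch_density_derive : exists2 s, oriented s a T &
  \forall y \ae mu, (T @` a) y -> derivable v y 1 /\ derive1 v y = s * w y.
Proof.
have [s os] := branch_oriented_ex pm aa; exists s => //.
have [iw w0 _ _] := bw.
have mw : measurable_fun [set: MR] w by apply/measurable_EFinP; exact: measurable_int iw.
have iwS (A : set R) : measurable (A : set MR) -> mu.-integrable (A : set MR) (EFin \o w).
  by move=> mA; apply: (integrableS measurableT mA (@subsetT _ _)).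
have lw : locally_integrable [set: R] w := open_integrable_locally openT iw.
have := FTC1Ny (fun y => iwS _ (measurable_itv _)) lw.
set F := fun y => _; apply: filterS; first exact: (ae_filter_ringOfSetsType mu).
move=> y [dF F'] Ty.
have subF x z : (T @` a) x -> (T @` a) z -> x < z -> F z - F x = s * (v z - v x).
  move=> Tx Tz xz; rewrite /F.
  rewrite (@Rintegral_itvB _ _ -oo%O (BRight z) x)//; last 2 first.
    exact: iwS.
    by rewrite bnd_simp ltW.
  apply: EFin_inj; rewrite (branch_density_sub os Tx Tz xz) /Rintegral fineK.
    apply: integral_itv_bndoo; apply/measurable_EFinP; exact: measurable_funTS mw.
  by apply: integrable_fin_num => //; exact: iwS.
have vF x z : (T @` a) x -> (T @` a) z -> v z = v x + s * (F z - F x).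
  move=> Tx Tz; have ss := oriented_sq os.
  case: (ltgtP x z) => [xz|zx|->]; last by rewrite subrr mulr0 addr0.
    by rewrite subF// mulrA ss mul1r addrC subrK.
  by rewrite -opprB (subF z x)// mulrN mulrA ss mul1r opprB addrC subrK.
have dv : is_derive y 1 v (s * w y).
  apply: (@near_eq_is_derive _ _ _ (fun z => v y + s * (F z - F y))).
    have : nbhs y (T @` a) by apply: open_nbhs_nbhs; split => //; exact: open_interval_open.
    by apply: filterS => z Tz /=; rewrite -vF.
  have dF1 : is_derive y 1 F (w y) by apply: DeriveDef => //; rewrite -derive1E.
  have := is_deriveD (is_derive_cst (v y) y 1)
    (is_deriveZ s (is_deriveB dF1 (is_derive_cst (F y) y 1))).
  by rewrite add0r subr0.
split; first exact: ex_derive.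
by rewrite derive1E derive_val.
Qed.

End BranchDensity.

Section AlmostEverywhere.
Context {R : realType}.
Local Notation mu := (@lebesgue_measure R).
Implicit Types P Q : R -> Prop.

Lemma aeS P Q : (forall x, P x -> Q x) ->
  (\forall x \ae mu, P x) -> \forall x \ae mu, Q x.
Proof. by move=> PQ; apply: filterS => //; exact: (ae_filter_ringOfSetsType mu). Qed.

Lemma aeI P Q : (\forall x \ae mu, P x) -> (\forall x \ae mu, Q x) ->
  \forall x \ae mu, P x /\ Q x.
Proof. by apply: filterI; exact: (ae_filter_ringOfSetsType mu). Qed.

Lemma ae_all (P : nat -> R -> Prop) : (forall n, \forall x \ae mu, P n x) ->
  \forall x \ae mu, forall n, P n x.
Proof.
move=> H; have : mu.-negligible (\bigcup_n ~` [set x | P n x]).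
  by apply: negligible_bigcup => n; exact: H.
by apply: negligibleS => x /= /existsNP[n Pn]; exists n.
Qed.

Lemma ae_all_count (I : countType) (P : I -> R -> Prop) :
  (forall i, \forall x \ae mu, P i x) -> \forall x \ae mu, forall i, P i x.
Proof.
move=> H; have : \forall x \ae mu, forall n, if unpickle n is Some i then P i x else True.
  by apply: ae_all => n; case: unpickle => [i|]; [exact: H|exact: aeW].
by apply: aeS => x Hx i; have := Hx (pickle i); rewrite pickleK.
Qed.

End AlmostEverywhere.

Section Expansion.
Context {R : realType} (T : R -> R) (alpha : set (set R)).
Hypothesis pm : pm_map T alpha.
Local Notation MR := (measurableTypeR R).
Local Notation mu := (@lebesgue_measure R).

Lemma condU_ex : condU T alpha -> exists2 beta : R, 1 < beta &
  forall x, (\bigcup_(a in alpha) a) x -> derivable T x 1 ->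
    beta <= `|derive1 T x|.
Proof.
rewrite /condU; set E := [set _ | _ in _].
have lb x : (\bigcup_(a in alpha) a) x -> derivable T x 1 ->
    (ereal_inf E <= `|derive1 T x|%:E)%E.
  by move=> ax dx; apply: ereal_inf_lbound; exists x.
case: (ereal_inf E) lb => [b| |] // lb b1.
  by exists b => // x ax dx; have := lb x ax dx; rewrite lee_fin.
(* The infimum is +oo only when there is no point of differentiability; any constant above 1 then
   serves. *)
by exists 2 => [|x ax dx]; [rewrite ltr1n|have := lb x ax dx; rewrite leye_eq].
Qed.

Variable a : set R.
Hypothesis aa : alpha a.
Local Notation v := (inv_branch T a).
Variable w : R -> R.
Hypothesis bw : branch_density T a w.

Lemma branch_density_le beta : 1 < beta ->
  (forall x, (\bigcup_(a in alpha) a) x -> derivable T x 1 ->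
    beta <= `|derive1 T x|) ->
  \forall y \ae mu, w y <= beta^-1.
Proof.
move=> b1 Hb; have b0 : 0 < beta by rewrite (lt_trans ltr01).
have [s os] := branch_density_derive pm aa bw; have [_ w0 wout _] := bw.
apply: filterS; first exact: (ae_filter_ringOfSetsType mu).
move=> y dvy; have [Ty|/wout ->] := pselect ((T @` a) y); last by rewrite invr_ge0 ltW.
have [dv dvE] := dvy Ty; have [->|wy0] := eqVneq (w y) 0; first by rewrite invr_ge0 ltW.
have oTa := branch_image_oi pm aa (@subset_refl _ a) (branch_oi pm aa).
have nT : nbhs y (T @` a) by apply: open_nbhs_nbhs; split => //; exact: open_interval_open.
have [av Tv] := branchP Ty.
have swy : s * w y != 0 by rewrite -normr_eq0 (oriented_norm _ os) normr_eq0.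
have dT : is_derive (v y) 1 T (s * w y)^-1.
  apply: is_derive_inverse => //.
  - by apply: filterS nT => z /branchP[].
  - by apply: filterS nT => z /(inv_branch_continuous pm aa).
  - by rewrite -dvE derive1E; apply: DeriveDef.
have aav : (\bigcup_(c in alpha) c) (v y) by exists a.
have := Hb (v y) aav (@ex_derive _ _ _ _ _ _ _ dT).
rewrite derive1E derive_val normfV (oriented_norm _ os) ger0_norm//.
move=> H; have wy : 0 < w y by rewrite lt0r wy0 w0.
by rewrite -(invrK (w y)) lef_pV2 // posrE ?invr_gt0.
Qed.

Lemma branch_lipschitz th : 0 <= th -> (\forall y \ae mu, w y <= th) ->
  forall y z, (T @` a) y -> (T @` a) z -> `|v z - v y| <= th * `|z - y|.
Proof.
move=> th0 wth; have [s os] := branch_oriented_ex pm aa; have [iw w0 _ _] := bw.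
have mw : measurable_fun [set: MR] (EFin \o w) := measurable_int _ iw.
have H y z : (T @` a) y -> (T @` a) z -> y < z -> `|v z - v y| <= th * `|z - y|.
  move=> Ty Tz yz; rewrite -(oriented_norm _ os) ger0_norm; last first.
    by rewrite ltW// (oriented_lt (inv_branch_oriented pm aa os)).
  rewrite -lee_fin (branch_density_sub pm aa bw os Ty Tz yz).
  rewrite [leRHS](_ : _ = (\int[mu]_(t in `]y, z[) th%:E)%E).
    apply: ae_ge0_le_integral => //.
    - by move=> t _; rewrite lee_fin.
    - exact: measurable_funTS.
    - by apply: (aeS _ wth) => t + _; rewrite lee_fin.
  rewrite integral_cst//= lebesgue_measure_itv /= lte_fin yz.
  by rewrite -EFinB -EFinM ger0_norm// subr_ge0 ltW.
move=> y z Ty Tz; case: (ltgtP y z) => [|zy|->]; first exact: H.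
  by rewrite distrC [`|z - y|]distrC; exact: H.
by rewrite !subrr normr0 mulr0.
Qed.

End Expansion.

(** * Enumerated branches, words and cylinders *)

Section Enumeration.
Context {R : realType} (T : R -> R) (alpha : set (set R)).
Hypothesis pm : pm_map T alpha.

(** Elements of alpha are indexed by a code, and the indices that code no element get the empty set;
    finite and infinite alpha are thus treated alike. *)
Lemma alpha_enum : exists a : nat -> set R,
  [/\ forall i, a i = set0 \/ alpha (a i),
      forall c, alpha c -> exists i, a i = c &
      forall i j x, a i x -> a j x -> i = j].
Proof.
have /countable_injP[f injf] := pm_countable pm.
pose e i := \bigcup_(c in [set c | alpha c /\ f c = i]) c.
have eE c : alpha c -> e (f c) = c.
  move=> ac; apply/seteqP; split=> x; last by exists c.
  by move=> [c' [ac' /injf]]; rewrite !inE => /(_ ac' ac) ->.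
exists e; split.
- move=> i; have [[c [ac <-]]|H] := pselect (exists c, alpha c /\ f c = i).
    by right; rewrite eE.
  by left; apply/seteqP; split=> x // [c [ac fc] _]; apply: H; exists c.
- by move=> c ac; exists (f c); exact: eE.
- move=> i j x [c [ac <-] cx] [c' [ac' <-] cx']; congr f.
  by apply: (pm_disjoint pm) => //; exists x.
Qed.

End Enumeration.

(** This fixes one version [w i] of each branch weight; all later pointwise statements and the
    choice of [G] refer to these versions. *)
Record branch_system {R : realType} (T : R -> R) (alpha : set (set R))
    (a : nat -> set R) (w : nat -> R -> R) : Prop := BranchSystem {
  bs_pm : pm_map T alpha;
  bs_mem : forall i, a i = set0 \/ alpha (a i);
  bs_ex : forall c, alpha c -> exists i, a i = c;
  bs_disj : forall i j x, a i x -> a j x -> i = j;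
  bs_density : forall i, branch_density T (a i) (w i) }.

Section Words.
Context {R : realType}.
Local Notation MR := (measurableTypeR R).
Local Notation mu := (@lebesgue_measure R).
Variables (T : R -> R) (alpha : set (set R)) (a : nat -> set R) (w : nat -> R -> R).

Local Notation v i := (inv_branch T (a i)).

(* A word lists its letters backwards: [i :: b] is followed by the branch i
   after the branches of b. *)
Fixpoint cylinder (b : seq nat) : set R :=
  if b is i :: b' then cylinder b' `&` preX T (size b') (a i) else X.

(* [word_transfer h b = \hat T^k (1_{cylinder b} h)] for k = size b *)
Fixpoint word_transfer (h : R -> R) (b : seq nat) : R -> R :=
  if b is i :: b' then fun y => w i y * word_transfer h b' (v i y) else h.

Lemma branch_system_ex : pm_map T alpha ->
  exists a w, branch_system T alpha a w.
Proof.
move=> pm; have [e [e0 eex edisj]] := alpha_enum pm.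
have H i : exists w, branch_density T (e i) w.
  have [->|ei] := e0 i; last exact: (branch_density_ex pm ei).
  exists (fun=> 0); split => //.
  - exact: integrable0.
  - by move=> u _ _; rewrite integral_set0 integral0_eq// => x _; rewrite mul0e.
by exists e, (fun i => sval (cid (H i))); split => // i; case: cid.
Qed.

Hypothesis bs : branch_system T alpha a w.
Let pm := bs_pm bs.

Lemma sys_subX i : a i `<=` X.
Proof. by have [->|/(branch_subX pm)] := bs_mem bs i; first exact: sub0set. Qed.

Lemma sys_interval i : is_interval (a i).
Proof.
have [->|/(branch_oi pm) oi] := bs_mem bs i; first by [].
exact: open_interval_convex.
Qed.

Lemma sys_measurable i : measurable (a i : set MR).
Proof.
have [->|/(branch_oi pm) oi] := bs_mem bs i; first exact: measurable0.
exact: open_interval_measurable.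
Qed.

Lemma sys_image_interval i : is_interval (T @` a i).
Proof.
have [->|ai] := bs_mem bs i; first by rewrite image_set0.
apply: open_interval_convex; apply: (branch_image_oi pm ai) => //.
exact: (branch_oi pm ai).
Qed.

Lemma sys_branchP i y : (T @` a i) y -> a i (v i y) /\ T (v i y) = y.
Proof. by move=> Ty; exact: branchP Ty. Qed.

Lemma sys_branchK i x : a i x -> v i (T x) = x.
Proof.
by have [->//|ai] := bs_mem bs i; exact: (branchK pm ai).
Qed.

Lemma sys_X i y : X (v i y).
Proof.
have [E|ai] := bs_mem bs i; last exact: (branch_X pm ai).
rewrite branch_out ?E ?image_set0//.
by rewrite XE lexx ler01.
Qed.

Lemma sys_measurable_inv i : measurable_fun [set: MR] (v i).
Proof.
have [E|ai] := bs_mem bs i; last exact: (measurable_inv_branch pm ai).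
rewrite (_ : v i = cst 0)//; apply/funext => y.
by rewrite branch_out ?E ?image_set0.
Qed.

Lemma sys_oriented i : exists s, oriented s (T @` a i) (v i).
Proof.
have [->|ai] := bs_mem bs i.
  by exists 1; split; [left|move=> x y; rewrite image_set0].
have [s os] := branch_oriented_ex pm ai; exists s.
exact: (inv_branch_oriented pm ai os).
Qed.

Lemma sys_w_ge0 i y : 0 <= w i y. Proof. by have [] := bs_density bs i. Qed.

Lemma sys_w_out i y : w i y != 0 -> (T @` a i) y.
Proof.
by have [_ _ out _] := bs_density bs i; apply: contra_neqP => /out.
Qed.

Lemma sys_measurable_w i : measurable_fun [set: MR] (w i).
Proof.
have [iw _ _ _] := bs_density bs i.
by apply/measurable_EFinP; exact: measurable_int iw.
Qed.

Lemma sys_bigcup : \bigcup_(c in alpha) c = \bigcup_i a i.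
Proof.
apply/seteqP; split=> x [c].
  by move=> /(bs_ex bs)[i <-] ai; exists i.
by move=> _ ax; have [E|ac] := bs_mem bs c; [rewrite E in ax|exists (a c)].
Qed.

Lemma sys_cover : \forall x \ae mu, X x -> exists i, a i x.
Proof.
exists (X `\` \bigcup_i a i); split.
- apply: measurableD; first exact: mX.
  by apply: bigcup_measurable => i _; exact: sys_measurable.
- by have := pm_cover pm; rewrite sys_bigcup mE setIidl// => x [].
- move=> x /= /not_implyP[Xx H]; split => // -[i _ aix]; apply: H.
  by exists i.
Qed.

Lemma measurable_cylinder b : measurable (cylinder b : set MR).
Proof.
elim: b => [|i b IH] /=; first exact: mX.
by apply: measurableI => //; apply: (measurable_preX pm); exact: sys_measurable.
Qed.

Lemma cylinder_subX b : cylinder b `<=` X.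
Proof. by elim: b => //= i b IH x [/IH]. Qed.

Variable h : R -> R.
Hypotheses (mh : measurable_fun [set: MR] h) (h0 : forall x, 0 <= h x).
Hypothesis hX : forall x, ~ X x -> h x = 0.
Local Notation F := (word_transfer h).

Lemma word_transfer_ge0 b y : 0 <= F b y.
Proof. by elim: b y => //= i b IH y; rewrite mulr_ge0// sys_w_ge0. Qed.

Lemma measurable_word_transfer b : measurable_fun [set: MR] (F b).
Proof.
elim: b => //= i b IH; apply: measurable_funM; first exact: sys_measurable_w.
exact: measurableT_comp (sys_measurable_inv i).
Qed.

(** The outermost letter is removed by the change of variables for [w i]: at T x with x in [a i] the
    inverse branch returns x, and [u] turns into [u \o T] cut off at [a i]. *)
Lemma integral_word_transfer b (u : R -> \bar R) :
  measurable_fun [set: MR] u -> (forall x, 0 <= u x)%E ->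
  (\int[mu]_x ((F b x)%:E * u x) =
   \int[mu]_(x in cylinder b) ((h x)%:E * u (iter (size b) T x)))%E.
Proof.
elim: b u => [|i b IH] u mfu u0 /=.
  rewrite [RHS]integral_mkcond; apply: eq_integral => x _; rewrite patchE.
  by case: ifPn => //; rewrite notin_setE => /hX ->; rewrite mul0e.
have [iw w0 out cov] := bs_density bs i.
have mg : measurable_fun [set: MR] (fun y => (F b (v i y))%:E * u y)%E.
  apply: emeasurable_funM => //; apply/measurable_EFinP.
  exact: measurableT_comp (measurable_word_transfer b) (sys_measurable_inv i).
under eq_integral do rewrite EFinM -muleA.
rewrite cov//; last by move=> y; rewrite mule_ge0// lee_fin word_transfer_ge0.
have muT : measurable_fun [set: MR] ((u \o T) \_ (a i)).
  apply/(measurable_restrictT _ _).1; first exact: sys_measurable.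
  apply: (measurable_comp measurableT) => //.
  exact: measurable_funS mX (@sys_subX i) (pm_measurable pm).
transitivity (\int[mu]_x ((F b x)%:E * ((u \o T) \_ (a i)) x))%E.
  rewrite [LHS]integral_mkcond; apply: eq_integral => x _; rewrite !patchE.
  case: ifPn => //; last by rewrite mule0.
  by rewrite inE => ax; rewrite sys_branchK.
rewrite IH//; last by move=> x; rewrite patchE; case: ifP => //= _.
rewrite [LHS]integral_mkcond [RHS]integral_mkcond; apply: eq_integral => x _.
rewrite !patchE in_setI; case: ifPn => //= xb.
have Xx : X x by apply: (@cylinder_subX b); rewrite inE in xb.
rewrite (_ : (x \in preX T (size b) (a i)) = (iter (size b) T x \in a i)).
  by case: ifP => //; rewrite mule0.
by apply/idP/idP; rewrite !inE; [case|split].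
Qed.

End Words.

(** * Variation along finite increasing lists *)

Section ListVariation.
Context {R : realType}.
Implicit Types (d : R -> R -> R) (t s : seq R) (f p : R -> R).

(** [d] is any function of two points, not only |f y - f x|, so that sums over words and
    restrictions to certain pairs can be accumulated in the same way. *)
Fixpoint lvar d t : R :=
  if t is x :: t' then (if t' is y :: _ then d x y else 0) + lvar d t' else 0.

Definition absd f : R -> R -> R := fun x y => `|f y - f x|.

Lemma lvar_le d d' t : sorted <%O t ->
  (forall x y, x \in t -> y \in t -> x < y -> d x y <= d' x y) ->
  lvar d t <= lvar d' t.
Proof.
elim: t => //= x [|y t] IH; first by rewrite !addr0.
move=> /= /andP[xy st] H; apply: lerD; first by apply: H; rewrite ?inE ?eqxx ?orbT.
by apply: IH => // u z ut zt; apply: H; rewrite in_cons (ut, zt) orbT.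
Qed.

Lemma eq_lvar d d' t : (forall x y, d x y = d' x y) -> lvar d t = lvar d' t.
Proof. by move=> H; elim: t => //= x [|y t] -> //; rewrite H. Qed.

Lemma lvar_ge0 d t : (forall x y, 0 <= d x y) -> 0 <= lvar d t.
Proof.
move=> d0; elim: t => //= x [|y t] IH; first by rewrite addr0.
exact: addr_ge0.
Qed.

Lemma lvarD d d' t : lvar (fun x y => d x y + d' x y) t = lvar d t + lvar d' t.
Proof. by elim: t => /= [|x t ->]; rewrite ?addr0// addrACA; case: t => //; rewrite addr0. Qed.

Lemma lvarZ c d t : lvar (fun x y => c * d x y) t = c * lvar d t.
Proof. by elim: t => /= [|x t ->]; rewrite ?mulr0// mulrDr; case: t => //; rewrite mulr0. Qed.

Lemma lvar_sum (I : Type) (L : seq I) (d : I -> R -> R -> R) t :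
  lvar (fun x y => \sum_(b <- L) d b x y) t = \sum_(b <- L) lvar (d b) t.
Proof.
elim: L => [|b L IH].
  rewrite big_nil -[RHS](mul0r (lvar (fun _ _ => 0) t)) -lvarZ.
  by apply: eq_lvar => x y; rewrite big_nil mul0r.
rewrite big_cons -IH -lvarD; apply: eq_lvar => x y; by rewrite big_cons.
Qed.

Lemma lvar_map d f t : lvar d (map f t) = lvar (fun x y => d (f x) (f y)) t.
Proof. by elim: t => //= x [|y t] -> //=. Qed.

Lemma lvar_rcons d t x y : lvar d (rcons (rcons t x) y) = lvar d (rcons t x) + d x y.
Proof.
elim: t => [|z t IH] /=; first by rewrite !addr0 add0r.
rewrite IH addrA; congr (_ + _ + _).
by case: t {IH} => //=.
Qed.

Lemma lvar_rev d t : (forall x y, d x y = d y x) -> lvar d (rev t) = lvar d t.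
Proof.
move=> sd; elim: t => // x [|y t] IH //.
by rewrite rev_cons; move: IH; rewrite rev_cons lvar_rcons => ->; rewrite addrC sd.
Qed.

Definition restrd (P : pred R) d : R -> R -> R :=
  fun x y => if P x && P y then d x y else 0.

Lemma lvar_cons_ge d x t : (forall x y, 0 <= d x y) -> lvar d t <= lvar d (x :: t).
Proof. by move=> d0 /=; case: t => [|y t] /=; rewrite ?addr0// lerDr. Qed.

(** Deleting points keeps every adjacent pair satisfying [P] and may create further ones, whose
    contribution is nonnegative. *)
Lemma lvar_filter_ge (P : pred R) d t : (forall x y, 0 <= d x y) ->
  lvar (restrd P d) t <= lvar d (seq.filter P t).
Proof.
move=> d0; elim: t => // x t IH; rewrite [leLHS]/= [in leRHS]/=.
have [Px|nPx] := boolP (P x); last first.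
  by rewrite (le_trans _ IH)//; case: (t) => [|y t']; rewrite /restrd ?(negbTE nPx) add0r.
case: t IH => [|y t] IH; first by rewrite /= !addr0.
rewrite {1}/restrd Px /=; move: IH => /=; case: ifPn => Py IH; first by rewrite lerD2l.
by rewrite add0r (le_trans IH)//; exact: (lvar_cons_ge x).
Qed.

(** A convex [P] selects a contiguous block of a sorted list, so filtering creates no new adjacent
    pair. *)
Lemma lvar_filter_le (P : pred R) d t : (forall x y, 0 <= d x y) -> sorted <%O t ->
  (forall x y z, P x -> P z -> x < y < z -> P y) ->
  lvar d (seq.filter P t) <= lvar (restrd P d) t.
Proof.
move=> d0 + cP; elim: t => // x t IH st; have {}IH := IH (path_sorted st).
have r0 u z : 0 <= restrd P d u z by rewrite /restrd; case: ifP.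
rewrite [in leLHS]/= [leRHS]/=; have [Px|nPx] := boolP (P x); last first.
  by rewrite (le_trans IH)// lerDr; case: (t) => // y t'.
case: t st IH => [|y t] st IH; first by rewrite /= !addr0.
rewrite {1}/restrd Px /=; move: IH => /=; case: ifPn => Py IH; first by rewrite lerD2l.
rewrite (_ : [seq x <- t | P x] = [::]) /= ?addr0.
  by rewrite add0r; exact: (lvar_ge0 (y :: t) r0).
apply/eqP; rewrite -(negbK (_ == _)) -has_filter; apply/hasPn => z zt.
apply: contra Py => Pz; apply: (cP x y z) => //.
move: st => /= /andP[-> /= st]; have := order_path_min lt_trans st.
by move/allP => /(_ z zt).
Qed.

Lemma lvar_monotone d f x t : path <%O x t ->
  (forall y z, y \in x :: t -> z \in x :: t -> y < z -> d y z <= f z - f y) ->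
  lvar d (x :: t) <= f (last x t) - f x.
Proof.
elim: t x => [|y t IH] x; first by rewrite /= addr0 subrr.
move=> /andP[xy st] H; have {}IH := IH _ st.
rewrite (_ : lvar _ _ = d x y + lvar d (y :: t))//.
have -> : f (last x (y :: t)) - f x = (f y - f x) + (f (last y t) - f y).
  by rewrite /=; ring.
apply: lerD; first by apply: H; rewrite ?inE ?eqxx ?orbT.
by apply: IH => u z ut zt; apply: H; rewrite in_cons (ut, zt) orbT.
Qed.

Lemma sum_exclusive_le (I : eqType) (L : seq I) (Q : pred I) (c : R) : uniq L ->
  0 <= c -> (forall i j, i \in L -> j \in L -> Q i -> Q j -> i = j) ->
  \sum_(i <- L) (if Q i then c else 0) <= c.
Proof.
move=> + c0; elim: L => [|i L IH] /=; first by rewrite big_nil.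
move=> /andP[iL uL] H; rewrite big_cons; case: ifPn => Qi; last first.
  rewrite add0r IH// => j k jL kL.
  by apply: H; rewrite inE (jL, kL) orbT.
rewrite big1_seq ?addr0// => j /andP[_ jL]; case: ifP => // Qj.
have ij : i = j by apply: H; rewrite ?inE ?eqxx ?jL ?orbT.
by rewrite ij jL in iL.
Qed.

(** All points are sorted into one list [s]. By convexity and disjointness each [t i] is a
    contiguous block of [s], and an adjacent pair of [s] belongs to at most one block. *)
Lemma lvar_merge (I : eqType) (L : seq I) (P : I -> pred R) (t : I -> seq R) d :
  (forall x y, 0 <= d x y) -> uniq L ->
  (forall i x y z, P i x -> P i z -> x < y < z -> P i y) ->
  (forall i j x, i \in L -> j \in L -> P i x -> P j x -> i = j) ->
  (forall i, i \in L -> sorted <%O (t i)) ->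
  (forall i, i \in L -> {in t i, forall x, P i x}) ->
  exists s, [/\ sorted <%O s, forall x, x \in s -> exists2 i, i \in L & x \in t i &
    \sum_(i <- L) lvar d (t i) <= lvar d s].
Proof.
move=> d0 uL cP dP st tP.
pose s := sort <=%O (undup (flatten [seq t i | i <- L])).
have ss : sorted <%O s by rewrite sort_lt_sorted undup_uniq.
have memS x : (x \in s) = (x \in flatten [seq t i | i <- L]).
  by rewrite mem_sort mem_undup.
exists s; split => //.
  by move=> x; rewrite memS => /flattenP[_ /mapP[i iL ->] xt]; exists i.
have tE i : i \in L -> t i = seq.filter (P i) s.
  move=> iL; apply: (irr_sorted_eq lt_trans ltxx); first exact: st.
    exact: sorted_filter lt_trans _ _ ss.
  move=> x; rewrite mem_filter memS; apply/idP/andP.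
    move=> xt; split; first exact: tP xt.
    by apply/flattenP; exists (t i) => //; apply/mapP; exists i.
  move=> [Px /flattenP[_ /mapP[j jL ->] xt]].
  by rewrite (dP i j x)//; exact: tP xt.
apply: (@le_trans _ _ (\sum_(i <- L) lvar (restrd (P i) d) s)).
  rewrite big_seq [leRHS]big_seq; apply: ler_sum => i iL.
  by rewrite {1}tE//; apply: lvar_filter_le => //; exact: cP.
rewrite -lvar_sum; apply: lvar_le => // x y xs ys xy.
apply: sum_exclusive_le => // i j iL jL /andP[Pix _] /andP[Pjx _].
exact: dP Pix Pjx.
Qed.

Lemma sum_sub_le (I : eqType) (L L2 : seq I) (g : I -> R) : uniq L -> uniq L2 ->
  {subset L <= L2} -> (forall i, 0 <= g i) ->
  \sum_(i <- L) g i <= \sum_(i <- L2) g i.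
Proof.
move=> uL uL2 sub g0; rewrite [leRHS](bigID (mem L)) /=.
have pE : perm_eq [seq i <- L2 | i \in L] L.
  apply: uniq_perm => //; first exact: filter_uniq.
  move=> i; rewrite mem_filter; apply/andP/idP => [[]//|iL]; split => //.
  exact: sub.
by rewrite -[X in _ <= X + _]big_filter (perm_big _ pE) lerDl sumr_ge0.
Qed.

(** The product rule for differences applies when [p] is nonzero at both points. If [p] vanishes at
    one of them, the jump of [p] alone pays for the difference, so the term with [th] needs only the
    pairs kept by [restrd]. *)
Lemma transfer_pair_le (I : Type) (L : seq I) (F : I -> R -> R) (p f : R -> R)
    (th M x y : R) : 0 <= M ->
  0 <= p x <= th -> 0 <= p y <= th -> (forall b z, 0 <= F b z) ->
  (p x != 0 -> \sum_(b <- L) F b (f x) <= M) ->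
  (p y != 0 -> \sum_(b <- L) F b (f y) <= M) ->
  \sum_(b <- L) `|p y * F b (f y) - p x * F b (f x)| <=
  th * restrd (fun z => p z != 0)
         (fun u z => \sum_(b <- L) `|F b (f z) - F b (f u)|) x y
  + M * `|p y - p x|.
Proof.
move=> M0 /andP[px0 pxth] /andP[py0 pyth] F0 Mx My; rewrite /restrd.
have [px|px] /= := eqVneq (p x) 0.
  rewrite mulr0 add0r px subr0 ger0_norm//; have [py|py] := eqVneq (p y) 0.
    by rewrite py mulr0 big1// => b _; rewrite !mul0r subrr normr0.
  apply: (@le_trans _ _ (\sum_(b <- L) p y * F b (f y))).
    by apply: ler_sum => b _; rewrite mul0r subr0 ger0_norm// mulr_ge0.
  by rewrite -mulr_sumr mulrC ler_wpM2r// My.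
have [py|py] /= := eqVneq (p y) 0.
  rewrite mulr0 add0r py sub0r normrN ger0_norm//.
  apply: (@le_trans _ _ (\sum_(b <- L) p x * F b (f x))).
    by apply: ler_sum => b _; rewrite mul0r sub0r normrN ger0_norm// mulr_ge0.
  by rewrite -mulr_sumr mulrC ler_wpM2r// Mx.
apply: (@le_trans _ _ (\sum_(b <- L) (p x * `|F b (f y) - F b (f x)| +
   F b (f y) * `|p y - p x|))).
  apply: ler_sum => b _.
  have -> : p y * F b (f y) - p x * F b (f x) =
     p x * (F b (f y) - F b (f x)) + F b (f y) * (p y - p x) by ring.
  by rewrite (le_trans (ler_normD _ _))// !normrM (ger0_norm px0) (ger0_norm (F0 _ _)).
rewrite big_split /= -mulr_sumr -mulr_suml lerD//.
  by rewrite ler_wpM2r// sumr_ge0.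
by rewrite ler_wpM2r// My.
Qed.

End ListVariation.

(** * A conull set stable under the inverse branches *)

Section GoodSet.
Context {R : realType}.
Local Notation MR := (measurableTypeR R).
Local Notation mu := (@lebesgue_measure R).
Variables (T : R -> R) (alpha : set (set R)) (a : nat -> set R) (w : nat -> R -> R).
Hypothesis bs : branch_system T alpha a w.
Local Notation v i := (inv_branch T (a i)).

(** For a null set [N] the change of variables gives that the integral of [w i] over the points sent
    into [N] by the inverse branch is the measure of [N] within [a i], namely 0; so [w i] vanishes
    a.e. at these points. *)
Lemma ae_inv_branch (Q : R -> Prop) i : (\forall x \ae mu, X x -> Q x) ->
  \forall y \ae mu, w i y != 0 -> Q (v i y).
Proof.
move=> [N [mN N0 QN]]; have [iw w0 wout cov] := bs_density bs i.
pose u (x : R) : \bar R := (\1_N (v i x))%:E.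
have mu_ : measurable_fun [set: MR] u.
  have mN1 : measurable_fun [set: MR] (\1_N : R -> R) by exact: measurable_indic.
  by apply/measurable_EFinP; exact: (measurableT_comp mN1 (sys_measurable_inv bs i)).
have u0 x : (0 <= u x)%E by rewrite lee_fin.
have I0 : (\int[mu]_x `|(w i x)%:E * u x| = 0)%E.
  under eq_integral do rewrite gee0_abs ?mule_ge0 ?lee_fin//.
  rewrite cov//; transitivity (\int[mu]_(x in a i) (\1_N x)%:E)%E.
    by apply: eq_integral => x; rewrite inE => ax; rewrite /u (sys_branchK bs).
  rewrite integral_indic//; last exact: (sys_measurable bs).
  apply/eqP; rewrite eq_le measure_ge0 andbT -N0.
  apply: le_measure; rewrite ?inE//; apply: measurableI => //.
  exact: (sys_measurable bs).
have mwu : measurable_fun [set: MR] (fun x => (w i x)%:E * u x)%E.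
  by apply: emeasurable_funM => //; apply/measurable_EFinP; exact: (sys_measurable_w bs).
have := (ae_eq_integral_abs mu measurableT mwu).1 I0.
apply: aeS => y /(_ I) /= wu0 wy; apply: contrapT => nQ.
have Nv : N (v i y).
  by apply: QN => /= /(_ (sys_X bs _ _)).
move: wu0; rewrite /u indicE mem_set// mule1 => -[] /eqP.
by rewrite (negbTE wy).
Qed.

(** [Qs n] asks for [Q] at all preimages reached by at most n inverse branches with nonzero weights.
    Each [Qs n] holds a.e., there being countably many branches, and the intersection over n is
    stable. *)
Lemma good_set_ex (Q : R -> Prop) : (\forall x \ae mu, X x -> Q x) ->
  exists G : set R, [/\ G `<=` X, G `<=` Q,
    \forall x \ae mu, X x -> G x &
    forall i y, G y -> w i y != 0 -> G (v i y)].
Proof.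
move=> aeQ.
pose Qs := fix Qs n y := if n is n'.+1 then
  Qs n' y /\ forall i, w i y != 0 -> Qs n' (v i y) else Q y.
exists [set y | X y /\ forall n, Qs n y]; split.
- by move=> y [].
- by move=> y [_ /(_ 0%N)].
- have : \forall x \ae mu, forall n, X x -> Qs n x.
    apply: ae_all => n; elim: n => // n IH /=.
    have : \forall x \ae mu, forall i, w i x != 0 -> Qs n (v i x).
      by apply: ae_all => i; exact: ae_inv_branch.
    by move=> H; have := aeI IH H; apply: aeS => x [H1 H2] Xx; split; [exact: H1|].
  by apply: aeS => x H Xx; split => // n; exact: H.
- move=> i y [Xy H] wy; split; first exact: (sys_X bs _ _).
  by move=> n; have [_] := H n.+1; exact.
Qed.

End GoodSet.

(** * Uniform bound for the variations over words of equal length *)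

Section UniformVariation.
Context {R : realType}.
Variables (T : R -> R) (alpha : set (set R)) (a : nat -> set R) (w : nat -> R -> R).
Hypothesis bs : branch_system T alpha a w.
Local Notation v i := (inv_branch T (a i)).
Variables (G : set R) (h : R -> R).
Local Notation F := (word_transfer T a w h).
Hypothesis Gv : forall i y, G y -> w i y != 0 -> G (v i y).
Hypothesis h0 : forall x, 0 <= h x.
Variables (th M V RR : R) (r : nat -> R).
Hypotheses (M0 : 0 <= M) (th1 : th < 1).
Hypothesis w_le : forall i y, G y -> w i y <= th.
Hypothesis F_le : forall k (L : seq (seq nat)) y, uniq L ->
  {in L, forall b, size b = k} -> G y -> \sum_(b <- L) F b y <= M.
Definition list_in (A : set R) (t : seq R) := forall x, x \in t -> A x.
Hypothesis w_var : forall i t, sorted <%O t -> list_in G t ->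
  lvar (absd (w i)) t <= r i.
Hypothesis r_sum : forall I, uniq I -> \sum_(i <- I) r i <= RR.
Hypothesis h_var : forall t, sorted <%O t -> list_in G t -> lvar (absd h) t <= V.

(** The second term is the fixed point of K -> th * K + M * RR, and [V] serves for the empty
    word. *)
Let K := Num.max V (M * RR / (1 - th)).

Let V0 : 0 <= V. Proof. by have := h_var (t := [::]) isT; apply. Qed.
Let th0 : G !=set0 -> 0 <= th.
Proof. by move=> [y Gy]; exact: le_trans (sys_w_ge0 bs 0%N y) (w_le _ Gy). Qed.

(** The list is carried to [a i] by the inverse branch, and reversed if the branch is decreasing; a
    symmetric [d] does not see the reversal. *)
Lemma pull_list i t : sorted <%O t -> list_in G t ->
  exists t', [/\ sorted <%O t', list_in (G `&` a i) t' &
    forall d : R -> R -> R, (forall x y, d x y = d y x) ->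
      lvar d t' = lvar d (map (v i) [seq x <- t | w i x != 0])].
Proof.
move=> st tG; have [s [s1 os]] := sys_oriented bs i.
set t0 := [seq x <- t | w i x != 0].
have st0 : sorted <%O t0 by exact: sorted_filter lt_trans _ _ st.
have t0T x : x \in t0 -> (T @` a i) x.
  by rewrite mem_filter => /andP[/(sys_w_out bs)].
have t0G x : x \in t0 -> (G `&` a i) (v i x).
  move=> xt; split; last by have [] := sys_branchP (t0T _ xt).
  by move: xt; rewrite mem_filter => /andP[wx /tG Gx]; exact: Gv.
have path_or (e : rel R) : (forall x y, x \in t0 -> y \in t0 -> x < y -> e (v i x) (v i y)) ->
    sorted e (map (v i) t0).
  move=> H; elim: (t0) H st0 => //= x l IH H.
  rewrite !path_map /=; case: l IH H => //= y l IH H /andP[xy yl].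
  apply/andP; split; first by apply: H; rewrite ?inE ?eqxx ?orbT.
  have := IH _ yl; rewrite !path_map; apply => u z ut zt.
  by apply: H; rewrite inE (ut, zt) orbT.
case: s1 => s1; rewrite s1 in os.
- exists (map (v i) t0); split => //.
    apply: path_or => x y xt yt xy.
    by have := os _ _ (t0T _ xt) (t0T _ yt) xy; rewrite mul1r subr_gt0.
  by move=> _ /mapP[x xt ->]; exact: t0G.
- exists (rev (map (v i) t0)); split.
  + rewrite rev_sorted; apply: path_or => x y xt yt xy.
    by have := os _ _ (t0T _ xt) (t0T _ yt) xy; rewrite mulN1r opprB subr_gt0.
  + by move=> x; rewrite mem_rev => /mapP[z zt ->]; exact: t0G.
  + by move=> d ds; rewrite lvar_rev.
Qed.

(** Induction on the length. For a fixed outer letter the product rule costs [th] times the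
    variation along the pulled-back list plus [M * r i]. The pulled-back lists for different letters
    lie in disjoint intervals, so they merge into one list and the induction hypothesis is used once
    for all letters. *)
Lemma uniform_variation k (L : seq (seq nat)) t : uniq L ->
  {in L, forall b, size b = k} -> sorted <%O t -> list_in G t ->
  \sum_(b <- L) lvar (absd (F b)) t <= K.
Proof.
(* Only a point of [G] shows that [th] is nonnegative, so the empty list is treated apart. *)
case: t => [|y0 t] uL sL; first by rewrite /= big1 // le_max V0.
move: (y0 :: t) (mem_head y0 t) => {}t y0t st tG.
have th_0 : 0 <= th by apply: th0; exists y0; exact: tG.
have th1' : 0 < 1 - th by rewrite subr_gt0.
have KE : th * K + M * RR <= K.
  rewrite -lerBrDl -{1}(mul1r K) -mulrBl -ler_pdivrMl// mulrC.
  by rewrite /K le_max lexx orbT.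
elim: k L t uL sL st tG {y0t} => [|k IH] L t uL sL st tG.
  apply: (@le_trans _ _ (\sum_(b <- [:: [::]]) lvar (absd (F b)) t)).
    apply: sum_sub_le => //; first by move=> b /sL /size0nil ->; rewrite mem_head.
    by move=> b; apply: lvar_ge0 => x y; exact: normr_ge0.
  by rewrite big_seq1 /K le_max h_var.
pose I := undup (map (head 0%N) L); pose L' := undup (map behead L).
have uI : uniq I := undup_uniq _.
have uL' : uniq L' := undup_uniq _.
have sL' : {in L', forall b, size b = k}.
  by move=> b; rewrite mem_undup => /mapP[c /sL sc ->]; rewrite size_behead sc.
(* [L] is enlarged to a product set, which only adds nonnegative terms and makes the sum over the
   outer letter independent of the sum over the remaining word. *)
apply: (@le_trans _ _ (\sum_(b <- [seq i :: b | i <- I, b <- L']) lvar (absd (F b)) t)).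
  apply: sum_sub_le => //.
  - by apply: allpairs_uniq => // -[i b] [j c] _ _ [-> ->].
  - move=> b bL; have := sL _ bL; case: b bL => // i b bL _.
    apply/allpairsP; exists (i, b); split => //; rewrite mem_undup.
      by apply/mapP; exists (i :: b).
    by apply/mapP; exists (i :: b).
  - by move=> b; apply: lvar_ge0 => x y; exact: normr_ge0.
rewrite big_allpairs_dep /=.
pose d x y := \sum_(b <- L') absd (F b) x y.
have d0 x y : 0 <= d x y by apply: sumr_ge0 => b _; exact: normr_ge0.
have ds x y : d x y = d y x by apply: eq_bigr => b _; rewrite /absd distrC.
have [ti Hti] := choice (fun i => pull_list i st tG).
have step i : \sum_(b <- L') lvar (absd (F (i :: b))) t <= th * lvar d (ti i) + M * r i.
  rewrite -lvar_sum.
  apply: (@le_trans _ _ (lvar (fun x y =>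
     th * restrd (fun z => w i z != 0) (fun u z => d (v i u) (v i z)) x y
     + M * absd (w i) x y) t)).
    apply: lvar_le => // x y xt yt _.
    have [Gx Gy] := (tG _ xt, tG _ yt).
    have wth z : G z -> 0 <= w i z <= th by move=> Gz; rewrite (sys_w_ge0 bs) w_le.
    apply: (transfer_pair_le M0 (wth _ Gx) (wth _ Gy)).
    - by move=> b z; exact: (word_transfer_ge0 bs h0).
    - by move=> wx; apply: (F_le uL' sL'); exact: Gv.
    - by move=> wy; apply: (F_le uL' sL'); exact: Gv.
  rewrite lvarD !lvarZ; apply: lerD; last by rewrite ler_wpM2l// w_var.
  rewrite ler_wpM2l//; have [_ _ ->//] := Hti i.
  by rewrite lvar_map; apply: lvar_filter_ge.
have [s [ss sG sle]] : exists s, [/\ sorted <%O s, list_in G s &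
    \sum_(i <- I) lvar d (ti i) <= lvar d s].
  have [||||||s [ss sI sle]] := @lvar_merge _ _ I (fun i x => x \in a i) ti d => //.
  - move=> i x y z; rewrite !inE => ax az /andP[xy yz].
    by apply: (sys_interval bs ax az); rewrite !ltW.
  - by move=> i j x _ _; rewrite !inE; exact: (bs_disj bs).
  - by move=> i _; have [] := Hti i.
  - by move=> i _ x xt; have [_ /(_ x xt)[_ ax] _] := Hti i; rewrite inE.
  exists s; split => // x /sI[i _ xt].
  by have [_ /(_ x xt)[]] := Hti i.
apply: (@le_trans _ _ (\sum_(i <- I) (th * lvar d (ti i) + M * r i))).
  by apply: ler_sum => i _; exact: step.
rewrite big_split /= -!mulr_sumr; apply: le_trans KE; apply: lerD.
  by rewrite ler_wpM2l// (le_trans sle)// /d lvar_sum; exact: IH.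
by rewrite ler_wpM2l// r_sum.
Qed.

End UniformVariation.

(** * From variation on a conull set to the BV norm, and back *)

Section BVExtension.
Context {R : realType}.
Local Notation mu := (@lebesgue_measure R).

(** The increments of the total variation on [0, y], as a function of y, dominate those of [g], and
    they telescope along the list. *)
Lemma lvar_total_variation (g : R -> R) t : (total_variation 0 1 g < +oo)%E ->
  sorted <%O t -> list_in X t ->
  lvar (absd g) t <= fine (total_variation 0 1 g).
Proof.
move=> gfin; case: t => [|x t] st tX.
  by rewrite /= fine_ge0// total_variation_ge0.
have TVfin y : X y -> total_variation 0 y g \is a fin_num.
  rewrite XE => /andP[y0 y1]; rewrite ge0_fin_numE ?total_variation_ge0//.
  apply: le_lt_trans gfin; rewrite (total_variationD g y0 y1) leeDl//.
  exact: total_variation_ge0.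
have Xx : X x by apply: tX; rewrite mem_head.
apply: (@le_trans _ _ (fine (total_variation 0 (last x t) g) - fine (total_variation 0 x g))).
  apply: (@lvar_monotone _ _ (fun y => fine (total_variation 0 y g))) => // y z yt zt yz.
  have [Xy Xz] := (tX _ yt, tX _ zt).
  move: (Xy); rewrite XE => /andP[y0 y1].
  rewrite lerBrDr -lee_fin EFinD !fineK ?TVfin// addeC.
  rewrite (total_variationD g y0 (ltW yz)) leeD2l//.
  exact: total_variation_ge (ltW yz).
have Xl : X (last x t) by apply: tX; exact: mem_last.
move: (Xl); rewrite XE => /andP[l0 l1].
apply: (@le_trans _ _ (fine (total_variation 0 (last x t) g))).
  rewrite lerBlDr lerDl fine_ge0// total_variation_ge0//.
  by move: Xx; rewrite XE => /andP[].
apply: fine_le; [exact: TVfin|by rewrite ge0_fin_numE ?total_variation_ge0|].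
by rewrite (total_variationD g l0 l1) leeDl// total_variation_ge0.
Qed.

Variables (G : set R) (f : R -> R) (M V : R).
Hypothesis GE : \forall x \ae mu, X x -> G x.
Hypothesis f_le : forall x, G x -> `|f x| <= M.
Hypothesis f_var : forall t, sorted <%O t -> list_in G t -> lvar (absd f) t <= V.

(** [phi x], the supremum of [vals x], is the variation of [f] over the points of [G] up to x. It is
    monotone on the whole line although [f] is controlled on [G] only. *)
Let vals (x : R) : set R := [set z | exists t, [/\ sorted <%O t, list_in G t,
  (forall y, y \in t -> y <= x) & z = lvar (absd f) t]].
Let phi x := sup (vals x).

Let vals0 x : vals x !=set0.
Proof. by exists 0, [::]. Qed.

Let valsV x : has_ubound (vals x).
Proof. by exists V => z [t [st tG _ ->]]; exact: f_var. Qed.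

Let phi_ge0 x : 0 <= phi x.
Proof. by apply: ub_le_sup; [exact: valsV|exists [::]]. Qed.

Let phi_le x : phi x <= V.
Proof. by apply: ge_sup => [|z [t [st tG _ ->]]]; [exact: vals0|exact: f_var]. Qed.

Let phi_nd x y : x <= y -> phi x <= phi y.
Proof.
move=> xy; apply: ge_sup => [|z [t [st tG tx ->]]]; first exact: vals0.
apply: ub_le_sup; first exact: valsV.
by exists t; split => // u /tx ux; exact: le_trans ux xy.
Qed.

Let sorted_rcons (t : seq R) x y : sorted <%O (rcons t x) -> x < y ->
  sorted <%O (rcons (rcons t x) y).
Proof. by case: t => [|z t] /=; rewrite ?andbT// !rcons_path last_rcons => -> ->. Qed.

Let list_in_rcons A (t : seq R) x : list_in A t -> A x -> list_in A (rcons t x).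
Proof. by move=> tA Ax y; rewrite mem_rcons inE => /orP[/eqP->//|/tA]. Qed.

Let phi_step x y : G x -> G y -> x < y -> phi x + `|f y - f x| <= phi y.
Proof.
move=> Gx Gy xy; rewrite -lerBrDr; apply: ge_sup => [|z [t [st tG tx ->]]]; first exact: vals0.
rewrite lerBrDr.
have key s : sorted <%O (rcons s x) -> list_in G s -> (forall u, u \in s -> u <= x) ->
    lvar (absd f) (rcons s x) + `|f y - f x| <= phi y.
  move=> ss sG sx; rewrite -[`|f y - f x|]/(absd f x y) -lvar_rcons.
  apply: ub_le_sup; first exact: valsV.
  exists (rcons (rcons s x) y); split => //.
  - exact: sorted_rcons.
  - by apply: list_in_rcons => //; exact: list_in_rcons.
  - move=> u; rewrite mem_rcons inE => /predU1P[->//|].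
    rewrite mem_rcons inE => /predU1P[->|/sx ux]; first exact: ltW.
    exact: le_trans ux (ltW xy).
case: (lastP t) st tG tx => [|s z'] st tG tx.
  rewrite add0r; have := key [::] isT; rewrite /= !addr0 add0r; exact.
have : z' <= x by apply: tx; rewrite mem_rcons mem_head.
rewrite le_eqVlt => /orP[/eqP z'x|z'x].
  rewrite -z'x in key *; apply: key => //.
    by move=> u us; apply: tG; rewrite mem_rcons inE us orbT.
  by move=> u us; rewrite z'x; apply: tx; rewrite mem_rcons inE us orbT.
apply: le_trans (key (rcons s z') _ _ _) => //; last exact: sorted_rcons.
by rewrite lerD2r lvar_rcons lerDl normr_ge0.
Qed.

(** Its supremum [psi] extends phi + f monotonically from [G] to the line; the value - M keeps the
    set nonempty at points with nothing of [G] to their left. *)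
Let top (x : R) : set R := [set z | z = - M \/ exists y, [/\ G y, y <= x & z = phi y + f y]].
Let psi x := sup (top x).

Let M_G y : G y -> - M <= f y <= M.
Proof. by move=> /f_le; rewrite ler_norml. Qed.

Let top0 x : top x !=set0. Proof. by exists (- M); left. Qed.

Let topV x : G !=set0 -> ubound (top x) (V + M).
Proof.
move=> [g Gg] z [->|[y [Gy _ ->]]].
  have /andP[m1 m2] := M_G Gg; have := le_trans (phi_ge0 0) (phi_le 0); lra.
by have /andP[_ m2] := M_G Gy; apply: lerD.
Qed.

Let psi_nd x y : G !=set0 -> x <= y -> psi x <= psi y.
Proof.
move=> G0 xy; apply: ge_sup => [|z zx]; first exact: top0.
apply: ub_le_sup; first by exists (V + M); exact: topV.
by case: zx => [->|[u [Gu ux ->]]]; [left|right; exists u; split => //; exact: le_trans xy].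
Qed.

Let psiE x : G x -> psi x = phi x + f x.
Proof.
move=> Gx; have G0 : G !=set0 by exists x.
apply/eqP; rewrite eq_le; apply/andP; split.
  apply: ge_sup => [|z]; first exact: top0.
  move=> [->|[y [Gy yx ->]]].
    by have /andP[m1 m2] := M_G Gx; have := phi_ge0 x; lra.
  have /predU1P[->//|{}yx] : (y == x) || (y < x) by rewrite -le_eqVlt.
  have := phi_step Gy Gx yx.
  have := ler_norm (f y - f x); rewrite distrC; lra.
apply: ub_le_sup; first by exists (V + M); exact: topV.
by right; exists x.
Qed.

(** Jordan decomposition: psi - phi is a version of [f]. The increase of [psi] over [0, 1] is at
    most V + M - (- M), that of [phi] at most V. *)
Lemma essTV_le : G !=set0 -> (essTV f <= (2 * V + 2 * M)%:E)%E.
Proof.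
move=> G0; apply: (@le_trans _ _ (total_variation 0 1 (psi \- phi))).
  apply: ereal_inf_lbound; exists (psi \- phi) => //=.
  apply/ae_mP; apply: aeS GE => x H /H Gx.
  by rewrite psiE// addrC addrA addNr add0r.
apply: le_trans (total_variation_le psi (\- phi) ler01) _.
rewrite total_variationN !nondecreasing_total_variation//; last 2 first.
- by move=> x y _ _; exact: phi_nd.
- by move=> x y _ _; exact: psi_nd.
rewrite -EFinD lee_fin.
have h1 : psi 1 <= V + M by apply: ge_sup; [exact: top0|exact: topV].
have h2 : - M <= psi 0.
  by apply: ub_le_sup; [exists (V + M); exact: topV|left].
by have := phi_le 1; have := phi_ge0 0; lra.
Qed.

Lemma BVnorm_le : G !=set0 -> (BVnorm f <= (2 * V + 3 * M)%:E)%E.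
Proof.
move=> G0; rewrite /BVnorm (_ : 2 * V + 3 * M = M + (2 * V + 2 * M)); last by ring.
rewrite EFinD leeD ?essTV_le//.
apply/ess_supP; apply/ae_mP; apply: aeS GE => x H /H Gx.
by rewrite lee_fin f_le.
Qed.

End BVExtension.

Section BVVersion.
Context {R : realType}.
Local Notation mu := (@lebesgue_measure R).

Lemma essTV_ge0 (f : R -> R) : (0 <= essTV f)%E.
Proof. by apply: le_ereal_inf_tmp => _ [g _ <-]; exact: total_variation_ge0. Qed.

Lemma ess_sup_norm_ge0 (f : R -> R) : (0 <= ess_sup m (fun x => `|f x|%:E))%E.
Proof.
have := @ess_sup_ger _ _ R m (fun x => `|f x|) 0%E; apply => //.
by rewrite m_setT.
Qed.

(** The infimum over versions need not be attained, whence the slack [e]. *)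
Lemma essTV_version (f : R -> R) (e : R) : 0 < e -> (essTV f < +oo)%E ->
  exists g : R -> R, (\forall x \ae mu, X x -> g x = f x) /\
    forall t, sorted <%O t -> list_in X t ->
      lvar (absd g) t <= fine (essTV f) + e.
Proof.
move=> e0 ffin.
have fnum : essTV f \is a fin_num by rewrite ge0_fin_numE// essTV_ge0.
have [_ [g gf <-] gle] := lb_ereal_inf_adherent e0 fnum.
exists g; split; first exact/ae_mP.
move=> t st tX; have gfin : (total_variation 0 1 g < +oo)%E.
  apply: lt_trans gle _; rewrite -[X in (X + _)%E](fineK fnum) -EFinD ltry //.
apply: le_trans (lvar_total_variation gfin st tX) _.
rewrite -lee_fin EFinD !fineK//; first exact: ltW.
by rewrite ge0_fin_numE ?total_variation_ge0.
Qed.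

End BVVersion.

(** * The transfer operator *)

Section TransferOperator.
Context {R : realType} (T : R -> R) (alpha : set (set R)).
Hypothesis pm : pm_map T alpha.
Local Notation MR := (measurableTypeR R).
Local Notation mu := (@lebesgue_measure R).

Lemma m_integrableP (f : R -> R) :
  m.-integrable (X : set MR) (EFin \o f) <->
  mu.-integrable [set: MR] (EFin \o (f \_ X)).
Proof.
have -> : EFin \o (f \_ X) = (EFin \o f) \_ X.
  by apply/funext => x /=; rewrite !patchE; case: ifP.
apply: iff_trans (integrable_mkcond _ mX).
split=> /integrableP[mf fi]; apply/integrableP; split => //.
  by rewrite -ge0_integral_mX//; exact: mX.
by rewrite ge0_integral_mX//; exact: mX.
Qed.

Lemma integral_mX (D : set R) (f : R -> \bar R) :
  measurable (D : set MR) -> D `<=` X ->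
  (\int[m]_(x in D) f x = \int[mu]_x (f \_ D) x)%E.
Proof. by move=> mD DX; rewrite ge0_integral_mX// integral_mkcond. Qed.

Definition pos_part (f : R -> R) x := Num.max (f x) 0.

Lemma pos_part_ge0 f x : 0 <= pos_part f x.
Proof. by rewrite /pos_part le_max lexx orbT. Qed.

Lemma pos_part_sub f x : f x = pos_part f x - pos_part (\- f) x.
Proof. by rewrite /pos_part /=; case: (ltP 0 (f x)); case: (ltP 0 (- f x)); lra. Qed.

Lemma pos_part_le f x : pos_part f x <= `|f x|.
Proof. by rewrite /pos_part ge_max ler_norm normr_ge0. Qed.

Lemma measurable_pos_part (D : set R) f : measurable_fun (D : set MR) f ->
  measurable_fun (D : set MR) (pos_part f).
Proof. by move=> mf; exact: measurable_maxr. Qed.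

Lemma measurable_comp_T (f : R -> R) : measurable_fun [set: MR] f ->
  measurable_fun (X : set MR) (f \o T).
Proof.
move=> mf; apply: (measurable_comp measurableT) => //.
exact: pm_measurable pm.
Qed.

(* [w] is the image of [g] under the transfer operator. *)
Definition pushes (g w : R -> R) : Prop :=
  [/\ mu.-integrable [set: MR] (EFin \o g), mu.-integrable [set: MR] (EFin \o w),
      forall x, ~ X x -> g x = 0, forall x, ~ X x -> w x = 0 &
  forall u : R -> R, measurable_fun [set: MR] u ->
    (exists B, \forall x \ae mu, `|u x| <= B) ->
    [/\ mu.-integrable [set: MR] (fun x => (w x * u x)%:E),
        mu.-integrable [set: MR] (fun x => (g x * u (T x))%:E) &
        (\int[mu]_x (w x * u x)%:E = \int[mu]_x (g x * u (T x))%:E)%E]].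

(** Test functions of both signs are split into positive and negative parts; the a.e. bound makes
    both integrals finite, so that they may be subtracted. *)
Lemma pushes_ge0 (g : R -> R) :
  mu.-integrable [set: MR] (EFin \o g) -> (forall x, 0 <= g x) ->
  (forall x, ~ X x -> g x = 0) -> exists w, pushes g w.
Proof.
move=> ig g0 gX; have [w [iw w0 wX cov]] := transfer_density pm ig g0 gX.
exists w; split => //.
have mg : measurable_fun [set: MR] g by apply/measurable_EFinP; exact: measurable_int ig.
have mw : measurable_fun [set: MR] w by apply/measurable_EFinP; exact: measurable_int iw.
have mgu (u : R -> R) : measurable_fun [set: MR] u ->
    measurable_fun [set: MR] (fun x => g x * u (T x)).
  move=> mfu; have -> : (fun x => g x * u (T x)) = (fun x => g x * ((u \o T) \_ X) x).
    apply/funext => x; rewrite patchE; case: ifPn => //.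
    by rewrite notin_setE => /gX ->; rewrite !mul0r.
  by apply: measurable_funM => //; apply: measurable_patchX; exact: measurable_comp_T.
have pos (u : R -> R) B : measurable_fun [set: MR] u -> (forall x, 0 <= u x) ->
    (\forall x \ae mu, u x <= B) ->
    [/\ mu.-integrable [set: MR] (fun x => (w x * u x)%:E),
        mu.-integrable [set: MR] (fun x => (g x * u (T x))%:E) &
        (\int[mu]_x (w x * u x)%:E = \int[mu]_x (g x * u (T x))%:E)%E].
  move=> mfu u0 uB.
  have E : (\int[mu]_x (w x * u x)%:E = \int[mu]_x (g x * u (T x))%:E)%E.
    under eq_integral do rewrite EFinM.
    under [RHS]eq_integral do rewrite EFinM.
    by rewrite cov//; exact/measurable_EFinP.
  have mwu : measurable_fun [set: MR] (fun x => w x * u x) by exact: measurable_funM.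
  have fin : (\int[mu]_x (w x * u x)%:E < +oo)%E.
    apply: (@le_lt_trans _ _ (\int[mu]_x (`|B|%:E * (w x)%:E)))%E.
      apply: ae_ge0_le_integral => //.
      - by move=> x _; rewrite lee_fin mulr_ge0.
      - exact/measurable_EFinP.
      - by move=> x _; rewrite lee_fin mulr_ge0.
      - apply: emeasurable_funM => //; exact/measurable_EFinP.
      - apply: aeS uB => x uB _; rewrite lee_fin mulrC ler_wpM2r//.
        exact: le_trans uB (ler_norm _).
    have -> : (\int[mu]_x (`|B|%:E * (w x)%:E) = `|B|%:E * \int[mu]_x (w x)%:E)%E.
      apply: ge0_integralZl => //; do 1?exact/measurable_EFinP.
      by move=> x _; rewrite lee_fin.
    apply: lte_mul_pinfty => //; move/integrableP: iw => [_].
    by under eq_integral do rewrite gee0_abs ?lee_fin//.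
  split => //; apply/integrableP; split.
  - exact/measurable_EFinP.
  - by under eq_integral do rewrite gee0_abs ?lee_fin ?mulr_ge0//.
  - by apply/measurable_EFinP; exact: mgu.
  by under eq_integral do rewrite gee0_abs ?lee_fin ?mulr_ge0//; rewrite -E.
move=> u mfu [B uB].
have [|||w1 g1 E1] := pos (pos_part u) B.
- exact: measurable_pos_part.
- exact: pos_part_ge0.
- by apply: aeS uB => x; apply: le_trans; exact: pos_part_le.
have [|||w2 g2 E2] := pos (pos_part (\- u)) B.
- by apply: measurable_pos_part; exact: measurableT_comp.
- exact: pos_part_ge0.
- apply: aeS uB => x; apply: le_trans; apply: le_trans (pos_part_le _ _) _.
  by rewrite normrN.
have eqw : (fun x => (w x * u x)%:E) =
    (fun x => (w x * pos_part u x)%:E - (w x * pos_part (\- u) x)%:E)%E.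
  by apply/funext => x; rewrite (pos_part_sub u x) mulrBr EFinB.
have eqg : (fun x => (g x * u (T x))%:E) =
    (fun x => (g x * pos_part u (T x))%:E - (g x * pos_part (\- u) (T x))%:E)%E.
  by apply/funext => x; rewrite (pos_part_sub u (T x)) mulrBr EFinB.
rewrite eqw eqg; split; [exact: integrableB|exact: integrableB|].
by rewrite !integralB// E1 E2.
Qed.

Lemma pushes_ex (g : R -> R) : mu.-integrable [set: MR] (EFin \o g) ->
  (forall x, ~ X x -> g x = 0) -> exists w, pushes g w.
Proof.
move=> ig gX.
have mg : measurable_fun [set: MR] g by apply/measurable_EFinP; exact: measurable_int ig.
have ipos (f : R -> R) : mu.-integrable [set: MR] (EFin \o f) ->
    mu.-integrable [set: MR] (EFin \o pos_part f).
  move=> if_; have mf : measurable_fun [set: MR] f.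
    by apply/measurable_EFinP; exact: measurable_int if_.
  apply: le_integrable if_ => //.
    by apply/measurable_EFinP; exact: measurable_pos_part.
  move=> x _ /=; rewrite lee_fin ger0_norm ?pos_part_ge0//.
  exact: pos_part_le.
have [|||w1 [i1 j1 X1 Y1 E1]] := @pushes_ge0 (pos_part g); first exact: ipos.
- exact: pos_part_ge0.
- by move=> x nX; rewrite /pos_part gX// maxxx.
have [|||w2 [i2 j2 X2 Y2 E2]] := @pushes_ge0 (pos_part (\- g)).
- by apply: ipos; exact: integrableN ig.
- exact: pos_part_ge0.
- by move=> x nX; rewrite /pos_part /= gX// oppr0 maxxx.
exists (w1 \- w2); split => //.
- rewrite (_ : EFin \o _ = fun x => ((w1 x)%:E - (w2 x)%:E)%E); last by apply/funext.
  exact: integrableB.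
- by move=> x nX /=; rewrite Y1// Y2// subrr.
move=> u mfu uB; have [a1 b1 c1] := E1 u mfu uB; have [a2 b2 c2] := E2 u mfu uB.
have eqw : (fun x => ((w1 \- w2) x * u x)%:E) =
    (fun x => (w1 x * u x)%:E - (w2 x * u x)%:E)%E.
  by apply/funext => x; rewrite /= mulrBl EFinB.
have eqg : (fun x => (g x * u (T x))%:E) =
    (fun x => (pos_part g x * u (T x))%:E - (pos_part (\- g) x * u (T x))%:E)%E.
  by apply/funext => x; rewrite (pos_part_sub g x) mulrBl EFinB.
rewrite eqw eqg; split; [exact: integrableB|exact: integrableB|].
by rewrite !integralB// c1 c2.
Qed.

(** [transfer] is a choice with a default value, so it suffices to exhibit one image of [f]; the
    image of [f] cut off at X is one. *)
Lemma transferP (f : R -> R) : m.-integrable (X : set MR) (EFin \o f) ->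
  is_transfer T f (transfer T f).
Proof.
move=> /m_integrableP fi; apply: (@xgetPex _ (fun=> 0) [set g' | is_transfer T f g']).
have fX x : ~ X x -> (f \_ X) x = 0 by move=> nX; rewrite patchE memNset.
have [w [_ iw _ wX H]] := pushes_ex fi fX.
have wE : w \_ X = w.
  by apply/funext => x; rewrite patchE; case: ifPn => //; rewrite notin_setE => /wX.
exists w; split; first by apply/m_integrableP; rewrite wE.
move=> u mfu ufin.
have [B uB] : exists B, \forall x \ae mu, `|(u \_ X) x| <= B.
  have := ess_sup_norm_ge0 u; have := ess_sup_ge m (fun x => `|u x|%:E).
  case: (ess_sup m _) ufin => [B| |] //= _ /ae_mP H' B0.
  exists B; apply: aeS H' => x H'; rewrite patchE; case: ifPn => [xX|_].
    by rewrite inE in xX; have := H' xX; rewrite lee_fin.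
  by rewrite normr0 -lee_fin.
have [_ _ E] := H (u \_ X) (measurable_patchX mfu) (ex_intro _ B uB).
rewrite !integral_mX//; try exact: mX.
transitivity (\int[mu]_x (w x * (u \_ X) x)%:E)%E.
  apply: eq_integral => x _; rewrite !patchE; case: ifP => //.
  by rewrite mulr0.
rewrite E; apply: eq_integral => x _; rewrite !patchE.
case: ifPn => [|_]; last by rewrite mul0r.
by rewrite inE => Xx; rewrite mem_set//; exact: pm_self pm _ _.
Qed.

End TransferOperator.

(** * The basic mixing estimate *)

Section MixingEstimate.
Context {R : realType} (T : R -> R) (alpha : set (set R)).
Hypothesis pm : pm_map T alpha.
Local Notation MR := (measurableTypeR R).
Local Notation mu := (@lebesgue_measure R).

Lemma preXS n (B : set R) : preX T n.+1 B = preX T n (preX T 1 B).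
Proof.
apply/seteqP; split=> x [Xx] /=; last by move=> [_ ?]; split.
by move=> ?; repeat split => //; exact: (pm_self_iter pm).
Qed.

Lemma preXD n k (B : set R) : preX T (n + k) B = preX T k (preX T n B).
Proof.
apply/seteqP; split=> x [Xx] /=.
  move=> Bx; split=> //; split; first exact: (pm_self_iter pm).
  by rewrite /= -iterD.
by move=> [_ Bx]; split => //=; rewrite iterD.
Qed.

Lemma borel_preX n (B : set R) : borelX B -> borelX (preX T n B).
Proof. by move=> [mB BX]; split; [exact: measurable_preX pm _ _ _|move=> x []]. Qed.

Lemma integrable_mS (f : R -> R) (B : set R) : m.-integrable (X : set MR) (EFin \o f) ->
  borelX B -> m.-integrable (B : set MR) (EFin \o f).
Proof. by move=> fi [mB BX]; exact: (integrableS mX mB BX fi). Qed.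

Lemma transfer_iter (f : R -> R) n : m.-integrable (X : set MR) (EFin \o f) ->
  m.-integrable (X : set MR) (EFin \o iter n (transfer T) f) /\
  forall B, borelX B -> (\int[m]_(x in B) (iter n (transfer T) f x)%:E =
                         \int[m]_(x in preX T n B) (f x)%:E)%E.
Proof.
move=> fi; elim: n => [|n [IHi IH]] /=.
  split => // B [mB BX]; congr integral.
  by apply/seteqP; split=> x => [Bx|[]//]; split => //; exact: BX.
have [ti tE] := transferP pm IHi; split => // B bB; have [mB BX] := bB.
rewrite preXS -IH; last exact: borel_preX.
have H := tE (\1_B) (measurable_indic mB).
have fin : (ess_sup m (fun x => `|\1_B x : R|%:E) < +oo)%E.
  apply: (@le_lt_trans _ _ 1%E); last exact: ltry.
  apply/ess_supP; apply: aeW => x /=; rewrite lee_fin indicE.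
  by case: (x \in B); rewrite ?normr1 ?normr0 ?ler01.
move: (H fin); rewrite !integral_mX//; try exact: mX; last 2 first.
  by have [] := borel_preX 1 bB.
  by move=> x [].
move=> E; transitivity (\int[mu]_x ((fun x => (transfer T (iter n (transfer T) f) x * \1_B x)%:E) \_ X) x)%E.
  apply: eq_integral => x _; rewrite !patchE indicE; case: ifPn => [|nB].
    by rewrite inE => /BX Xx; rewrite mem_set// mulr1.
  by rewrite mulr0; case: ifP.
rewrite E; apply: eq_integral => x _; rewrite !patchE indicE.
have [Xx|nX] := pselect (X x); last first.
  by rewrite memNset// memNset// => -[].
rewrite mem_set//; have [TB|nTB] := pselect (B (T x)).
  by rewrite mem_set// mem_set// mulr1.
by rewrite memNset// memNset ?mulr0// => -[].
Qed.

Variables (P : probability MR R) (h : R -> R) (C r : R).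
Hypotheses (acP : ac_invariant T P) (dP : density P h).
Hypotheses (C0 : 0 < C) (r0 : 0 < r) (sg : spectral_gap T h C r).

Lemma P_XC : P (~` (X : set R)) = 0%E.
Proof.
have [/null_content_dominatesP dom _] := acP.
apply: dom; first exact: measurableC mX.
exact: m_XC.
Qed.

Lemma density_integrable : m.-integrable (X : set MR) (EFin \o h).
Proof.
have [mh h0 hE] := dP; apply/integrableP; split; first exact/measurable_EFinP.
under eq_integral => x xX.
  rewrite gee0_abs ?lee_fin; last by apply: h0; rewrite inE in xX.
  over.
rewrite -hE; last by split; [exact: mX|].
exact: le_lt_trans (probability_le1 _ mX) (ltry _).
Qed.

Lemma P_preX k (B : set R) : borelX B -> P (preX T k B) = P B.
Proof.
move=> bB; elim: k B bB => [|k IH] B bB.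
  have [_ BX] := bB; congr (P _).
  by apply/seteqP; split=> x => [[]//|Bx]; split => //; exact: BX.
by rewrite preXS IH; [have [_ ->] := acP|exact: borel_preX].
Qed.

Lemma mixing_estimate (A B : set R) (F : R -> R) (K : R) k n : borelX A -> borelX B ->
  measurable_fun (X : set MR) F -> m.-integrable (X : set MR) (EFin \o F) ->
  (BVnorm F <= K%:E)%E ->
  (forall B', borelX B' -> P (A `&` preX T k B') = (\int[m]_(x in B') (F x)%:E)%E) ->
  (0 < n)%N ->
  `|fine (P (A `&` preX T (n + k) B)) - fine (P A) * fine (P B)|
    <= C * r ^+ n * K * fine (m B).
Proof.
move=> bA bB mF iF FK FE n0; have [mB BX] := bB; have [mA AX] := bA.
have bvF : BV F by split => //; exact: le_lt_trans FK (ltry _).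
have [iTF TFE] := transfer_iter n iF.
have [mh h0 hE] := dP.
pose c := \int[m]_(y in X) F y.
pose g x := iter n (transfer T) F x - c * h x.
have cE : fine (P A) = c.
  rewrite /c /Rintegral -FE; last by split; [exact: mX|].
  congr (fine (P _)); apply/seteqP; split=> x => [Ax|[]//]; split => //.
  by split; [exact: AX|exact: (pm_self_iter pm) (AX _ Ax)].
have ich : m.-integrable (X : set MR) (fun x => (c * h x)%:E).
  rewrite (_ : (fun _ => _) = fun x => (c%:E * (h x)%:E)%E); last by apply/funext => x; rewrite EFinM.
  exact: (integrableZl mX c density_integrable).
have gE : (\int[m]_(x in B) (g x)%:E)%E =
    (P (A `&` preX T (n + k) B) - (c%:E * P B))%E.
  rewrite /g; under eq_integral do rewrite EFinB.
  rewrite integralB//; last 2 first.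
  - exact: integrable_mS.
  - exact: integrable_mS.
  rewrite TFE// preXD FE; last exact: borel_preX.
  congr (_ - _)%E; under eq_integral do rewrite EFinM.
  by rewrite integralZl// ?hE//; exact: integrable_mS density_integrable _.
(* Of the spectral gap only the essential supremum is kept; integration over [B] then brings in
   m(B). *)
have g_le : \forall x \ae m, (`|g x|%:E <= (C * r ^+ n * K)%:E)%E.
  apply/ess_supP; apply: (@le_trans _ _ (BVnorm g)).
    by rewrite /BVnorm leeDl// essTV_ge0.
  apply: le_trans (sg bvF n0) _.
  by rewrite [leRHS]EFinM lee_wpmul2l// lee_fin mulr_ge0 ?exprn_ge0// ltW.
have CrK : 0 <= C * r ^+ n * K.
  rewrite mulr_ge0//; first by rewrite mulr_ge0 ?exprn_ge0// ltW.
  rewrite -lee_fin; apply: le_trans FK.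
  by apply: adde_ge0; [exact: ess_sup_norm_ge0|exact: essTV_ge0].
have mg : measurable_fun (B : set MR) (fun x => (g x)%:E).
  apply/measurable_EFinP; apply: (measurable_funS mX BX).
  apply: measurable_funB; apply/measurable_EFinP.
    exact: measurable_int iTF.
  exact: measurable_int ich.
have fP A' : measurable (A' : set MR) -> P A' \is a fin_num by move=> ?; exact: fin_num_measure.
have mAB : measurable (A `&` preX T (n + k) B : set MR).
  by apply: measurableI => //; have [] := borel_preX (n + k) bB.
rewrite cE -lee_fin -abse_EFin EFinB EFinM (fineK (fP _ mAB)) (fineK (fP _ mB)) -gE.
apply: (le_trans (le_abse_integral m mB mg)).
have mBfin : m B \is a fin_num.
  rewrite ge0_fin_numE//; apply: (@le_lt_trans _ _ (m (X : set R))).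
    by apply: le_measure; rewrite ?inE//; exact: mX.
  by rewrite m_X ltry.
rewrite EFinM fineK//.
have := @integral_le_bound _ _ R m B (fun x => (g x)%:E) (C * r ^+ n * K)%:E mB mg.
apply => //; apply/ae_mP; move/ae_mP : g_le; apply: aeS => x H Xx Bx.
exact: H.
Qed.

End MixingEstimate.

(** * Cylinders and the sigma-algebras they generate *)

Section Cylinders.
Context {R : realType}.
Local Notation MR := (measurableTypeR R).
Local Notation mu := (@lebesgue_measure R).
Variables (T : R -> R) (alpha : set (set R)) (a : nat -> set R) (w : nat -> R -> R).
Hypothesis bs : branch_system T alpha a w.
Let pm := bs_pm bs.
Local Notation cyl := (cylinder T a).

Lemma ae_T (Q : R -> Prop) : (\forall x \ae mu, X x -> Q x) ->
  \forall x \ae mu, X x -> Q (T x).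
Proof.
move=> [N [mN N0 QN]].
have bN : borelX (N `&` X) by split; [exact: (measurableI _ _ mN mX)|move=> x []].
have mN0 : m (N `&` X) = 0%E.
  rewrite m_setIX mE; apply/eqP; rewrite eq_le measure_ge0 andbT -N0.
  by apply: le_measure; rewrite ?inE//; exact: (measurableI _ _ mN mX).
have := pm_nonsingular pm bN mN0; rewrite mE setIidl => [N1|x []//].
exists (preX T 1 (N `&` X)); split => //.
  by apply: (measurable_preX pm); have [] := bN.
move=> x /= /not_implyP[Xx nQ]; split => //=; have XT := pm_self pm Xx.
by split => //; apply: QN => /= /(_ XT).
Qed.

Lemma ae_iterT n (Q : R -> Prop) : (\forall x \ae mu, X x -> Q x) ->
  \forall x \ae mu, X x -> Q (iter n T x).
Proof.
move=> H; elim: n => [|n IH]; first exact: H.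
have := ae_T IH; apply: aeS => x; rewrite -iterSr /=; exact.
Qed.

Lemma cylinder_cover k : \forall x \ae mu, X x -> exists2 b, size b = k & cyl b x.
Proof.
elim: k => [|k IH]; first by apply: aeW => x Xx; exists [::].
have H := ae_iterT k (sys_cover bs); have := aeI IH H.
apply: aeS => x [H1 H2] Xx; have [b bk bx] := H1 Xx; have [i ai] := H2 Xx.
by exists (i :: b); rewrite /= ?bk//; split => //; split.
Qed.

Lemma cylinder_disj b b' x : size b = size b' -> cyl b x -> cyl b' x -> b = b'.
Proof.
elim: b b' => [|i b IH] [|j b'] //= [sb] [bx [_ ai]] [b'x [_ aj]].
by rewrite (IH b' sb bx b'x) // (bs_disj bs ai _ : i = j)// sb.
Qed.

Lemma cylinder_word k c : (0 < k)%N -> cylinders T alpha k c ->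
  exists2 b, size b = k & cyl b = c.
Proof.
move=> k0 [_ [s sa ->]].
have H j : (j <= k)%N -> exists2 b, size b = j &
    cyl b = X `&` \bigcap_(l in `I_j) preX T l (s l).
  elim: j => [|j IH] jk.
    exists [::] => //=; rewrite (_ : \bigcap_(l in _) _ = setT) ?setIT//.
    by apply/seteqP; split=> // x _ l.
  have [b sb bE] := IH (ltnW jk); have [i ai] := bs_ex bs (sa j jk).
  exists (i :: b); rewrite /= ?sb// bE ai -setIA; congr (_ `&` _).
  apply/seteqP; split=> x /=.
    move=> [H Hj] l /=; rewrite ltnS leq_eqVlt => /predU1P[->//|lj].
    exact: H.
  by move=> H; split=> [l /= lj|]; apply: H => /=; rewrite ltnS ?(ltnW lj).
(* The factor X is absorbed by the letter of index 0, which exists as k > 0; with no letter the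
   intersection would be the whole line instead of X. *)
have [b sb bE] := H k (leqnn k); exists b => //; rewrite bE setIidr// => x.
by case: k k0 {H sa sb bE} => // k _ /(_ 0%N isT)[].
Qed.

Lemma word_cylinder b : (0 < size b)%N -> cyl b !=set0 ->
  cylinders T alpha (size b) (cyl b).
Proof.
move=> b0 [x bx]; split; first by exists x.
(* Words are written backwards, so the letter visited at time j is the entry of index size b - (j +
   1). *)
exists (fun j => a (nth 0%N b (size b - j.+1))).
  move=> k kb; elim: b {b0} bx k kb => // i b IH /= [bx [_ ai]] k.
  rewrite ltnS leq_eqVlt => /predU1P[->|kb].
    by rewrite subnn /=; have [E|//] := bs_mem bs i; rewrite E in ai.
  by rewrite subSS -subnSK//=; apply: IH.
apply/seteqP; split=> [y by_ k /= kb|].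
  elim: b {bx b0} by_ k kb => // i b IH /= [bx bi] k.
  rewrite ltnS leq_eqVlt => /predU1P[->|kb]; first by rewrite subnn.
  by rewrite subSS -subnSK//=; apply: IH.
move=> y H; have Xy : X y by have [] := H 0%N b0.
elim: b {b0 bx} H => // i b IH H /=; split; last by have /= := H (size b) (ltnSn _); rewrite subnn.
apply: IH => k /= kb; have /= := H k (leqW kb).
by rewrite subSS -subnSK.
Qed.

(** The Borel sets that contain or miss each cylinder of order k form a sigma-algebra, and by
    disjointness the cylinders themselves belong to it. *)
Lemma sigma_cylinders_split k A : (0 < k)%N -> <<s X, cylinders T alpha k >> A ->
  borelX A /\ forall b, size b = k -> cyl b `<=` A \/ cyl b `&` A = set0.
Proof.
move=> k0; apply: (smallest_sub (X := fun A => borelX A /\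
    forall b, size b = k -> cyl b `<=` A \/ cyl b `&` A = set0)); last first.
  move=> c ck; have [b sb <-] := cylinder_word k0 ck; split.
    by split; [exact: (measurable_cylinder bs)|exact: cylinder_subX].
  move=> b' sb'; have [->|bb'] := eqVneq b' b; [by left|right].
  apply/seteqP; split=> // x [b'x bx]; move/eqP : bb'; apply.
  by apply: (cylinder_disj _ b'x bx); rewrite sb sb'.
split.
- split; first by split; [exact: measurable0|].
  by move=> b _; right; rewrite setI0.
- move=> B [[mB BX] HB]; split.
    by split; [exact: (measurableD mX mB)|move=> x []].
  move=> b sb; have [bB|bB] := HB b sb; [right|left].
    by apply/seteqP; split=> // x [/bB Bx []].
  move=> x bx; split; first exact: cylinder_subX bx.
  by move=> Bx; have : (cyl b `&` B) x by []; rewrite bB.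
- move=> B HB; split.
    split; first by apply: bigcup_measurable => i _; have [[]] := HB i.
    by move=> x [i _]; have [[_ BX] _] := HB i; exact: BX.
  move=> b sb; have [[i bi]|H] := pselect (exists i, cyl b `<=` B i).
    by left; apply: subset_trans bi _ => x Bx; exists i.
  right; apply/seteqP; split=> // x [bx [i _ Bx]].
  have [_ /(_ b sb)[bB|E]] := HB i; first by apply: H; exists i.
  by have : (cyl b `&` B i) x by []; rewrite E.
Qed.

Definition words_union (L : seq (seq nat)) : set R := \bigcup_(b in [set` L]) cyl b.

Lemma measurable_words_union L : measurable (words_union L : set MR).
Proof.
apply: fin_bigcup_measurable => //= b _.
exact: (measurable_cylinder bs).
Qed.

(** [L n] lists the words with code below n whose cylinder lies in A. What these miss of A in the
    limit lies outside all cylinders of order k, hence in a null set. *)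
Lemma sigma_cylinders_approx k A : (0 < k)%N -> <<s X, cylinders T alpha k >> A ->
  exists L : nat -> seq (seq nat),
    [/\ forall n, uniq (L n) /\ {in L n, forall b, size b = k},
        forall n, words_union (L n) `<=` A,
        {homo (fun n => words_union (L n)) : n p / (n <= p)%N >-> n `<=` p} &
        \forall x \ae mu, A x -> exists n, words_union (L n) x].
Proof.
move=> k0 /(sigma_cylinders_split k0)[[mA AX] HA].
pose good b := `[< size b = k /\ cyl b `<=` A >].
pose L n := [seq b <- undup (pmap unpickle (iota 0 n)) | good b].
have memL n b : (b \in L n) = good b && (b \in pmap unpickle (iota 0 n)).
  by rewrite mem_filter mem_undup.
exists L; split.
- move=> n; split; first by rewrite filter_uniq// undup_uniq.
  by move=> b; rewrite memL => /andP[/asboolP[]].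
- by move=> n x [b /=]; rewrite memL => /andP[/asboolP[_ bA] _] /bA.
- move=> n p np x [b /=]; rewrite memL => /andP[gb bn] bx; exists b => //=.
  rewrite memL gb /=; move: bn; rewrite !mem_pmap => /mapP[i]; rewrite mem_iota /= add0n => ni ->.
  by apply/mapP; exists i => //; rewrite mem_iota /= add0n (leq_trans ni).
- have := cylinder_cover k; apply: aeS => x Hx Ax; have [b sb bx] := Hx (AX _ Ax).
  have bA : cyl b `<=` A.
    have [//|E] := HA b sb.
    by have : (cyl b `&` A) x by []; rewrite E.
  exists (pickle b).+1, b => //=; rewrite memL; apply/andP; split; first exact/asboolP.
  rewrite mem_pmap; apply/mapP; exists (pickle b); last by rewrite pickleK.
  by rewrite mem_iota add0n ltnS leqnn.
Qed.

End Cylinders.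

(** * Measures of unions of cylinders *)

Section WordMeasures.
Context {R : realType}.
Local Notation MR := (measurableTypeR R).
Local Notation mu := (@lebesgue_measure R).

(** The hypothesis is tested on the set where f > g. *)
Lemma ae_le_of_integral (f g : R -> R) :
  mu.-integrable (X : set MR) (EFin \o f) -> mu.-integrable (X : set MR) (EFin \o g) ->
  (forall B, borelX B -> (\int[mu]_(x in B) (f x)%:E <= \int[mu]_(x in B) (g x)%:E)%E) ->
  \forall x \ae mu, X x -> f x <= g x.
Proof.
move=> fi gi H.
have mf : measurable_fun (X : set MR) f by apply/measurable_EFinP; exact: measurable_int fi.
have mg : measurable_fun (X : set MR) g by apply/measurable_EFinP; exact: measurable_int gi.
pose B := X `&` (f \- g) @^-1` `]0, +oo[.
have mB : measurable (B : set MR).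
  by apply: (measurable_funB mf mg) => //; exact: mX.
have BX : B `<=` X by move=> x [].
have Bpos x : B x -> 0 < f x - g x by move=> [_]; rewrite /= in_itv /= andbT.
have iB (u : R -> R) : mu.-integrable (X : set MR) (EFin \o u) ->
    mu.-integrable (B : set MR) (EFin \o u) by exact: integrableS mX mB BX.
have I0 : (\int[mu]_(x in B) `|(f x - g x)%:E| = 0)%E.
  apply/eqP; rewrite eq_le integral_ge0 ?andbT//.
  rewrite (_ : (\int[mu]_(x in B) _ = \int[mu]_(x in B) ((f x)%:E - (g x)%:E))%E); last first.
    by apply: eq_integral => x; rewrite inE => /Bpos fg; rewrite gee0_abs ?lee_fin ?ltW.
  rewrite integralB//; [|exact: iB|exact: iB].
  rewrite sube_le0; exact: H.
have := (ae_eq_integral_abs mu mB _).1 I0.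
move=> /(_ (measurable_int _ _)).
have iBfg : mu.-integrable (B : set MR) (fun x => (f x - g x)%:E).
  rewrite (_ : (fun _ => _) = fun x => ((f x)%:E - (g x)%:E)%E); last by apply/funext => x.
  by apply: integrableB => //; exact: iB.
move=> Hae; have {}Hae := Hae _ iBfg.
apply: aeS Hae => x Hx Xx; rewrite leNgt; apply/negP => gf.
have Bx : B x by split => //=; rewrite in_itv /= andbT subr_gt0.
by have /= [] := Hx Bx; apply/eqP; rewrite gt_eqF// Bpos.
Qed.

Variables (T : R -> R) (alpha : set (set R)) (a : nat -> set R) (w : nat -> R -> R).
Hypothesis bs : branch_system T alpha a w.
Let pm := bs_pm bs.
Local Notation cyl := (cylinder T a).
Variables (P : probability MR R) (h : R -> R).
Hypotheses (acP : ac_invariant T P) (dP : density P h).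
Local Notation H := (h \_ X).
Local Notation F := (word_transfer T a w H).

Lemma patch_density_measurable : measurable_fun [set: MR] H.
Proof. by have [mh _ _] := dP; exact: measurable_patchX. Qed.

Lemma patch_density_ge0 x : 0 <= H x.
Proof.
by have [_ h0 _] := dP; rewrite patchE; case: ifPn => //; rewrite inE; exact: h0.
Qed.

Lemma patch_density_out x : ~ X x -> H x = 0.
Proof. by move=> nX; rewrite patchE memNset. Qed.

Lemma patch_density_in x : X x -> H x = h x.
Proof. by move=> Xx; rewrite patchE mem_set. Qed.

Let mH := patch_density_measurable.
Let H0 := patch_density_ge0.
Let HX := patch_density_out.
Let mF b : measurable_fun [set: MR] (F b) := measurable_word_transfer bs mH b.
Let F0 b x : 0 <= F b x := word_transfer_ge0 bs H0 b x.

Lemma word_measure b B : borelX B ->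
  P (cyl b `&` preX T (size b) B) = (\int[mu]_(x in B) (F b x)%:E)%E.
Proof.
move=> bB; have [mB BX] := bB; have [_ _ hE] := dP.
have [mpB _] := borel_preX pm (size b) bB.
have mcB : measurable (cyl b `&` preX T (size b) B : set MR).
  by apply: measurableI => //; exact: (measurable_cylinder bs).
rewrite hE; last by split => // x [_ []].
rewrite integral_mX//; last by move=> x [_ []].
have mu1 : measurable_fun [set: MR] (fun x : R => (\1_B x)%:E : \bar R).
  by apply/measurable_EFinP; exact: measurable_indic.
have u0 (x : R) : (0 <= (\1_B x)%:E :> \bar R)%E by rewrite lee_fin.
have := integral_word_transfer bs mH H0 HX b mu1 u0.
rewrite [RHS]integral_mkcond => E.
transitivity (\int[mu]_x ((F b x)%:E * (\1_B x)%:E))%E; last first.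
  rewrite [RHS]integral_mkcond; apply: eq_integral => x _.
  by rewrite patchE indicE; case: ifP; rewrite ?mule1 ?mule0.
rewrite E; apply: eq_integral => x _; rewrite [LHS]patchE [RHS]patchE indicE.
have [bx|nbx] := pselect (cyl b x); last by rewrite !memNset// => -[].
have Xx := cylinder_subX bx; rewrite (mem_set bx) patch_density_in//.
have [Bx|nBx] := pselect (B (iter (size b) T x)).
  by rewrite !mem_set ?mule1.
by rewrite !memNset ?mule0// => -[_ []].
Qed.

Lemma words_measure L k B : uniq L -> {in L, forall b, size b = k} -> borelX B ->
  P (words_union T a L `&` preX T k B) =
  (\int[mu]_(x in B) (\sum_(b <- L) F b x)%:E)%E.
Proof.
move=> + + bB; have [mB BX] := bB.
elim: L => [|b L IH] /=.
  move=> _ _; rewrite /words_union (_ : [set` [::]] = set0); last by apply/seteqP; split.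
  rewrite bigcup_set0 set0I measure0 integral0_eq// => x _.
  by rewrite big_nil.
move=> /andP[bL uL] sL.
have sb : size b = k by apply: sL; rewrite mem_head.
have sL' : {in L, forall b, size b = k} by move=> c cL; apply: sL; rewrite inE cL orbT.
have E : words_union T a (b :: L) = cyl b `|` words_union T a L.
  apply/seteqP; split=> x.
    by move=> [c /=]; rewrite inE => /predU1P[->|cL] cx; [left|right; exists c].
  move=> [bx|[c /= cL cx]]; first by exists b => //=; rewrite mem_head.
  by exists c => //=; rewrite inE cL orbT.
have [mpB _] := borel_preX pm k bB.
have -> : (P (words_union T a (b :: L) `&` preX T k B) =
    P (cyl b `&` preX T k B) + P (words_union T a L `&` preX T k B))%E.
  rewrite E setIUl; apply: measureU.
  - by apply: measurableI => //; exact: (measurable_cylinder bs).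
  - by apply: measurableI => //; exact: (measurable_words_union bs).
  - apply/seteqP; split=> // x [[bx _] [[c /= cL cx] _]].
    have bc : b = c by apply: (cylinder_disj bs _ bx cx); rewrite sb sL'.
    by rewrite bc cL in bL.
rewrite (IH uL sL') -{1}sb word_measure// -ge0_integralD//.
- by apply: eq_integral => x _; rewrite big_cons EFinD.
- by move=> x _; rewrite lee_fin.
- by apply/measurable_EFinP; exact: measurable_funTS.
- by move=> x _; rewrite lee_fin sumr_ge0.
- by apply/measurable_EFinP; apply: measurable_sum => c; exact: measurable_funTS.
Qed.

(** By invariance: the integral of the sum over B is the P-measure of a part of T^-k B, hence at
    most P(B), the integral of h over B. *)
Lemma words_le_density L k : uniq L -> {in L, forall b, size b = k} ->
  \forall x \ae mu, X x -> \sum_(b <- L) F b x <= h x.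
Proof.
move=> uL sL; have [mh h0 hE] := dP.
have ih : mu.-integrable (X : set MR) (EFin \o h).
  have := density_integrable dP => /m_integrableP ih.
  apply/(integrable_mkcond _ mX).
  by rewrite (_ : (EFin \o h) \_ X = EFin \o H)//; apply/funext => x /=; rewrite !patchE; case: ifP.
have le B : borelX B -> (\int[mu]_(x in B) (\sum_(b <- L) F b x)%:E <= \int[mu]_(x in B) (h x)%:E)%E.
  move=> bB; have [mB BX] := bB; have [mpB _] := borel_preX pm k bB.
  rewrite -(words_measure uL sL bB) -ge0_integral_mX// -hE// -(P_preX pm acP k bB).
  apply: le_measure; rewrite ?inE//.
  by apply: measurableI => //; exact: (measurable_words_union bs).
apply: ae_le_of_integral => //.
apply/integrableP; split.
  by apply/measurable_EFinP; apply: measurable_sum => c; exact: measurable_funTS.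
under eq_integral do rewrite gee0_abs ?lee_fin ?sumr_ge0//.
apply: le_lt_trans (le X _) _; first by split; [exact: mX|].
rewrite -ge0_integral_mX//; last exact: mX.
rewrite -hE; last by split; [exact: mX|].
exact: le_lt_trans (probability_le1 _ mX) (ltry _).
Qed.

End WordMeasures.

(** * Bounded variation of the invariant density *)

Section DensityBV.
Context {R : realType}.
Local Notation MR := (measurableTypeR R).
Local Notation mu := (@lebesgue_measure R).

Lemma BVnorm_cst1 : BV (fun=> 1 : R).
Proof.
split; first exact: measurable_cst.
have h1 : (ess_sup (@m R) (fun x => `|1%R : R|%:E) <= 1)%E.
  by apply/ess_supP; apply: aeW => x /=; rewrite normr1.
have h2 : (essTV (fun=> 1%R : R) <= 0)%E.
  apply: ereal_inf_lbound; exists (fun=> 1); first exact: aeW.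
  by rewrite nondecreasing_total_variation// subrr.
by apply: (le_lt_trans (leeD h1 h2)); rewrite adde0 ltry.
Qed.

Lemma lvar_limit (f_ : nat -> R -> R) (f : R -> R) t (c : R) :
  (forall x, x \in t -> f_ n x @[n --> \oo] --> f x) ->
  (forall n, lvar (absd (f_ n)) t <= c) -> lvar (absd f) t <= c.
Proof.
move=> ft fc.
have H : lvar (absd (f_ n)) t @[n --> \oo] --> lvar (absd f) t.
  elim: t ft {fc} => [|x t IH] ft; first exact: cvg_cst.
  apply: cvgD; last by apply: IH => y yt; apply: ft; rewrite inE yt orbT.
  case: t {IH} ft => [|y t] ft; first exact: cvg_cst.
  apply: cvg_norm; apply: cvgB; apply: ft; rewrite !inE eqxx ?orbT//.
rewrite -(cvg_lim _ H)//; apply: limr_le; first by apply/cvg_ex; exists (lvar (absd f) t).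
by apply: nearW.
Qed.

Lemma eq_in_lvar (f g : R -> R) t : {in t, f =1 g} -> lvar (absd f) t = lvar (absd g) t.
Proof.
elim: t => // x t IH fg; rewrite [LHS]/= [RHS]/= IH; last first.
  by move=> y yt; apply: fg; rewrite inE yt orbT.
by case: t fg {IH} => // y t fg; rewrite /absd !fg// !inE eqxx ?orbT.
Qed.

Lemma lvar_eq0 (f : R -> R) t : {in t, f =1 fun=> 0} -> lvar (absd f) t = 0.
Proof.
move=> /eq_in_lvar ->; rewrite (eq_lvar (d' := fun _ _ => 0 * 0)).
  by rewrite lvarZ mul0r.
by move=> x y; rewrite /absd subrr normr0 mul0r.
Qed.

Variables (T : R -> R) (alpha : set (set R)) (a : nat -> set R) (w : nat -> R -> R).
Hypothesis bs : branch_system T alpha a w.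
Let pm := bs_pm bs.
Variables (P : probability MR R) (h : R -> R) (C rho : R).
Hypotheses (acP : ac_invariant T P) (dP : density P h).
Hypothesis sg : spectral_gap T h C rho.
Variables (r : nat -> R) (RR : R).
Hypothesis r_ge0 : forall i, 0 <= r i.
Hypothesis r_sum : forall I, uniq I -> \sum_(i <- I) r i <= RR.
Hypothesis w_le : forall i, \forall x \ae mu, X x -> w i x <= r i.
Hypothesis w_var : forall i, exists Q : set R, (\forall x \ae mu, X x -> Q x) /\
  forall t, sorted <%O t -> list_in (X `&` Q) t -> lvar (absd (w i)) t <= r i.
Local Notation H := (h \_ X).
Local Notation F := (word_transfer T a w H).

Lemma integrable_one : m.-integrable (X : set MR) (EFin \o (fun=> 1 : R)).
Proof.
apply/m_integrableP.
rewrite (_ : EFin \o _ = fun x => (\1_(X : set R) x)%:E); last first.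
  by apply/funext => x; rewrite /= patchE indicE; case: ifP.
exact: integrable_indic_itv.
Qed.

(** The branches are disjoint and cover X up to a null set, so both sides have the same integral
    over every Borel set, the measure of its preimage. *)
Lemma transfer_one : \forall x \ae mu, X x ->
  (\sum_(i < n) w i x) @[n --> \oo] --> transfer T (fun=> 1) x.
Proof.
have [itf tE] := transfer_iter pm 1 integrable_one.
have mw i : measurable_fun [set: MR] (EFin \o w i).
  by apply/measurable_EFinP; exact: (sys_measurable_w bs).
have w0 i x : (0 <= (w i x)%:E)%E by rewrite lee_fin (sys_w_ge0 bs).
pose s x := (\sum_(i <oo) (w i x)%:E)%E.
have ms : measurable_fun (X : set MR) s.
  by apply: ge0_emeasurable_sum => // i _; exact: (measurable_funTS (mw i)).
have itm : mu.-integrable (X : set MR) (EFin \o transfer T (fun=> 1)).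
  move/m_integrableP : itf => ih; apply/(integrable_mkcond _ mX).
  rewrite (_ : _ \_ _ = EFin \o (transfer T (fun=> 1) \_ X))//.
  by apply/funext => x /=; rewrite !patchE; case: ifP.
have E : ae_eq mu X (EFin \o transfer T (fun=> 1)) s.
  apply: integral_ae_eq => //; first exact: mX.
  move=> B BX mB; have bB : borelX B by split.
  have := tE B bB; rewrite /= ge0_integral_mX// => ->; apply/esym.
  have [mpB pBX] := borel_preX pm 1 bB.
  rewrite integral_nneseries//; last by move=> i; exact: measurable_funTS (mw i).
  transitivity (\sum_(i <oo) mu (preX T 1 B `&` a i))%E; last first.
    rewrite ge0_integral_mX// integral_cst// mul1e.
    rewrite (@eq_eseriesl _ _ (fun i => i \in [set: nat])); last by move=> i; rewrite in_setT.
    rewrite -measure_bigcup//; last 2 first.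
    - by move=> i _; apply: measurableI => //; exact: (sys_measurable bs).
    - by move=> i j _ _ [x [[_ ai] [_ aj]]]; exact: (bs_disj bs ai aj).
    rewrite -setI_bigcupr; apply/eqP; rewrite eq_le; apply/andP; split.
      apply: le_measure; rewrite ?inE//.
      apply: measurableI => //.
      by apply: bigcup_measurable => i _; exact: (sys_measurable bs).
    have [N [mN N0 cN]] := sys_cover bs.
    rewrite -[leRHS]adde0 -N0; apply: (@le_trans _ _ (mu ((preX T 1 B `&` \bigcup_i a i) `|` N))).
      apply: le_measure; rewrite ?inE//.
        apply: measurableU => //; apply: measurableI => //.
        by apply: bigcup_measurable => i _; exact: (sys_measurable bs).
      move=> x px; have [Nx|nN] := pselect (N x); [by right|left; split => //].
      apply: contrapT => nx; apply: nN; apply: cN => /= /(_ (pBX _ px)) [i ai].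
      by apply: nx; exists i.
    apply: measureU2 => //; apply: measurableI => //.
    by apply: bigcup_measurable => i _; exact: (sys_measurable bs).
  apply: eq_eseriesr => i _.
  have [iw w00 wout cov] := bs_density bs i.
  have mu1 : measurable_fun [set: MR] (fun x : R => (\1_B x)%:E : \bar R).
    by apply/measurable_EFinP; exact: measurable_indic.
  have u0 (x : R) : (0 <= (\1_B x)%:E :> \bar R)%E by rewrite lee_fin.
  transitivity (\int[mu]_x ((w i x)%:E * (\1_B x)%:E))%E.
    rewrite [LHS]integral_mkcond; apply: eq_integral => x _.
    by rewrite patchE indicE; case: ifP; rewrite ?mule1 ?mule0.
  rewrite (cov _ mu1 u0) -integral_indic//; last exact: (sys_measurable bs).
  apply: eq_integral => x; rewrite inE => ax; rewrite !indicE.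
  congr (nat_of_bool _)%:R%:E; have Xx := sys_subX bs ax.
  by apply/idP/idP; rewrite !inE; [split|case].
apply: aeS E => x Hx Xx; have {}Hx := Hx Xx.
have cv : (\sum_(0 <= i < n) (w i x)%:E)%E @[n --> \oo] --> s x.
  by have := @is_cvg_nneseries R (fun i => (w i x)%:E) xpredT 0%N (fun i _ _ => w0 i x).
rewrite -Hx in cv.
rewrite (_ : (fun n => _) = fine \o (fun n => \sum_(0 <= i < n) (w i x)%:E)%E).
  exact: fine_cvg cv.
by apply/funext => n /=; rewrite -(big_mkord xpredT (fun i => w i x)) sumEFin.
Qed.

(** h is the difference of \hat T 1, the sum of the weights, whose size and variation are bounded by
    [RR], and of \hat T 1 - h, which the spectral gap puts in BV. The summand 1 in the bound for the
    variation is the slack of [essTV_version]. *)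
Lemma density_BV : exists (Q : R -> Prop) (M V : R),
  [/\ \forall x \ae mu, X x -> Q x, 0 <= M, forall x, Q x -> h x <= M &
      forall t, sorted <%O t -> list_in (X `&` Q) t -> lvar (absd h) t <= V].
Proof.
have [g Hg] := choice w_var.
pose c := \int[m]_(y in (X : set MR)) (1 : R).
have c1 : c = 1.
  by have := @integral_cst _ _ R m X mX 1%E; rewrite mul1e m_X /c /Rintegral /cst => ->.
pose e0 x := transfer T (fun=> 1) x - c * h x.
have BVe : (BVnorm e0 < +oo)%E.
  apply: le_lt_trans (sg BVnorm_cst1 (ltn0Sn 0)) _.
  have [_ b1] := BVnorm_cst1.
  have bfin : BVnorm (fun=> 1 : R) \is a fin_num.
    by rewrite ge0_fin_numE// adde_ge0 ?essTV_ge0 ?ess_sup_norm_ge0.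
  by rewrite -(fineK bfin) -EFinM ltry.
have efin : (essTV e0 < +oo)%E.
  by apply: le_lt_trans BVe; rewrite leeDr// ess_sup_norm_ge0.
have esup : (ess_sup m (fun x => `|e0 x|%:E) < +oo)%E.
  by apply: le_lt_trans BVe; rewrite leeDl// essTV_ge0.
have [e [eE eV]] := essTV_version ltr01 efin.
have [Me eM] : exists Me, \forall x \ae mu, X x -> `|e0 x| <= Me.
  have := ess_sup_norm_ge0 e0; have := ess_sup_ge m (fun x => `|e0 x|%:E).
  case: (ess_sup m _) esup => [B| |] //= _ /ae_mP H' _; exists B.
  by apply: aeS H' => x H' Xx; have := H' Xx; rewrite lee_fin.
pose Q x := [/\ forall i, g i x, forall i, w i x <= r i,
  (\sum_(i < n) w i x) @[n --> \oo] --> transfer T (fun=> 1) x,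
  e x = e0 x & `|e0 x| <= Me].
have S_le n x : Q x -> \sum_(i < n) w i x <= RR.
  move=> [_ wr _ _ _]; apply: le_trans (r_sum (iota_uniq 0 n)).
  rewrite -(big_mkord xpredT (fun i => w i x)) /index_iota subn0.
  exact: ler_sum.
exists Q, (RR + `|Me|), (RR + (fine (essTV e0) + 1)); split.
- have h1 : \forall x \ae mu, forall i, X x -> g i x.
    by apply: ae_all => i; have [] := Hg i.
  have h2 : \forall x \ae mu, forall i, X x -> w i x <= r i by exact: ae_all.
  have := aeI h1 (aeI h2 (aeI transfer_one (aeI eE eM))).
  apply: aeS => x [q1 [q2 [q3 [q4 q5]]]] Xx.
  by split; [move=> i; exact: q1|move=> i; exact: q2|exact: q3|exact: q4|exact: q5].
- by rewrite addr_ge0//; have := r_sum (I := [::]) isT; rewrite big_nil.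
- move=> x Qx; have [_ _ cv _ em] := Qx.
  have t1 : transfer T (fun=> 1) x <= RR.
    rewrite -(cvg_lim _ cv)//; apply: limr_le; first by apply/cvg_ex; eexists; exact: cv.
    by apply: nearW => n; exact: S_le.
  have := ler_norm (- e0 x); rewrite normrN.
  have := ler_norm Me; rewrite /e0 c1 mul1r in em *; lra.
- move=> t st tQ.
  have tX : list_in X t by move=> x /tQ[].
  have v1 : lvar (absd (transfer T (fun=> 1))) t <= RR.
    apply: (@lvar_limit (fun n x => \sum_(i < n) w i x)).
      by move=> x /tQ[_ []].
    move=> n; apply: (@le_trans _ _ (\sum_(i <- iota 0 n) lvar (absd (w i)) t)).
      rewrite -lvar_sum; apply: lvar_le => // x y _ _ _.
      rewrite /absd -!(big_mkord xpredT (fun i => w i _)) /index_iota subn0 -sumrB.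
      exact: ler_norm_sum.
    apply: le_trans (r_sum (iota_uniq 0 n)); apply: ler_sum => i _.
    have [_] := Hg i; apply => // x /tQ[Xx []] gx _ _ _ _.
    by split => //; exact: gx.
  have v2 := eV t st tX.
  apply: (@le_trans _ _ (lvar (fun x y => absd (transfer T (fun=> 1)) x y + absd e x y) t)).
    apply: lvar_le => // x y /tQ[_ [_ _ _ ex _]] /tQ[_ [_ _ _ ey _]] _.
    rewrite /absd ex ey /e0 c1 !mul1r.
    set u := transfer T _ x; set v := transfer T _ y.
    have -> : h y - h x = (v - u) - ((v - h y) - (u - h x)) by ring.
    exact: ler_normB.
  by rewrite lvarD lerD.
Qed.

(** Finite lists of words are countable in number, so the bounds by h for all of them can hold
    together on one conull stable set, along with those for the weights and for h. *)
Lemma good_system (Q0 : R -> Prop) : (\forall x \ae mu, X x -> Q0 x) ->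
  exists (G : set R) (M V : R),
  [/\ [/\ G `<=` X, G `<=` Q0, \forall x \ae mu, X x -> G x &
        forall i y, G y -> w i y != 0 -> G (inv_branch T (a i) y)],
      [/\ 0 <= M, forall x, G x -> h x <= M &
        forall t, sorted <%O t -> list_in G t -> lvar (absd h) t <= V],
      [/\ forall i x, G x -> w i x <= r i &
        forall i t, sorted <%O t -> list_in G t -> lvar (absd (w i)) t <= r i] &
      forall k L x, uniq L -> {in L, forall b, size b = k} -> G x ->
        \sum_(b <- L) F b x <= h x].
Proof.
move=> aeQ0; have [Q [M [V [aeQ M0 hM hV]]]] := density_BV.
have [g Hg] := choice w_var.
(* The common length is read off the first word, so that the family of conditions is indexed by [L]
   alone. *)
pose QL (L : seq (seq nat)) x := uniq L -> {in L, forall b, size b = size (head [::] L)} ->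
  X x -> \sum_(b <- L) F b x <= h x.
have aeL : \forall x \ae mu, forall L, QL L x.
  apply: ae_all_count => L.
  have [uL|nuL] := boolP (uniq L); last by apply: aeW => x; rewrite /QL (negbTE nuL).
  have [sL|nsL] := pselect {in L, forall b, size b = size (head [::] L)}; last first.
    by apply: aeW => x _ /nsL.
  by have := words_le_density bs acP dP uL sL; apply: aeS => x Hx _ _.
have aeg : \forall x \ae mu, forall i, X x -> g i x.
  by apply: ae_all => i; have [] := Hg i.
have aer : \forall x \ae mu, forall i, X x -> w i x <= r i by exact: ae_all.
have [|G [GX GQ aeG Gv]] := good_set_ex bs (Q := fun x => [/\ Q0 x, Q x, forall L, QL L x,
    forall i, g i x & forall i, w i x <= r i]).
  have := aeI aeQ0 (aeI aeQ (aeI aeL (aeI aeg aer))).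
  apply: aeS => x [q0 [q1 [q2 [q3 q4]]]] Xx.
  by split; [exact: q0|exact: q1|exact: q2|move=> i; exact: q3|move=> i; exact: q4].
exists G, M, V; split.
- by split => // x /GQ[].
- split => // [x /GQ[_ /hM]//|t st tG]; apply: hV => // x xt.
  by split; [exact: GX (tG _ xt)|have [] := GQ _ (tG _ xt)].
- split => [i x /GQ[]//|i t st tG].
  have [_] := Hg i; apply => // x /tG Gx; split; first exact: GX.
  by have [_ _ _ ] := GQ _ Gx.
- move=> k L x uL sL Gx; have [_ _ /(_ L) HL _ _] := GQ _ Gx.
  apply: HL => //; last exact: GX.
  move=> b bL; rewrite sL//; case: L bL sL {uL} => // c L _ sL /=.
  by rewrite sL ?mem_head.
Qed.

End DensityBV.

(** * Consequences of condition (R) *)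

Section RychlikBounds.
Context {R : realType}.
Local Notation mu := (@lebesgue_measure R).
Variables (T : R -> R) (alpha : set (set R)) (a : nat -> set R) (w : nat -> R -> R).
Hypothesis bs : branch_system T alpha a w.
Let pm := bs_pm bs.

Lemma condR_bounds : condR T alpha -> exists (r : nat -> R) (RR : R),
  [/\ forall i, 0 <= r i, forall I, uniq I -> \sum_(i <- I) r i <= RR,
    forall i, \forall x \ae mu, X x -> w i x <= r i &
    forall i, exists Q : set R, (\forall x \ae mu, X x -> Q x) /\
      forall t, sorted <%O t -> list_in (X `&` Q) t -> lvar (absd (w i)) t <= r i].
Proof.
rewrite /condR; set f := fun c : set R => _ => esumfin.
have f0 c : (0 <= f c)%E by rewrite adde_ge0 ?essTV_ge0 ?ess_sup_norm_ge0.
set S := (\esum_(c in alpha) f c)%E in esumfin.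
have S0 : (0 <= S)%E by exact: esum_ge0.
have Sfin : S \is a fin_num by rewrite ge0_fin_numE.
have sumS I : uniq I -> (forall i, i \in I -> alpha (a i)) ->
    (\sum_(i <- I) f (a i) <= S)%E.
  move=> uI aI.
  have injI : set_inj [set` I] a.
    move=> i j; rewrite !inE /= => iI _ aij.
    have [c [d [_ cd _ E]]] := pm_interval pm (aI i iI).
    have ax : a i ((c + d) / 2) by rewrite E ooP !midf_lt.
    by apply: (bs_disj bs ax); rewrite -aij.
  rewrite fsbig_seq// -(fsbig_image _ _ f injI).
  apply: ereal_sup_ubound; exists (a @` [set` I]) => //; split.
    exact: finite_image.
  by move=> _ [i iI <-]; exact: aI.
have ffin c : alpha c -> f c \is a fin_num.
  move=> ac; rewrite ge0_fin_numE//; apply: le_lt_trans esumfin.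
  have [i ai] := bs_ex bs ac; have := sumS [:: i] isT; rewrite big_seq1 ai; apply.
  by move=> j; rewrite inE => /eqP ->; rewrite ai.
(* The factor 2 pays for passing to a nearly optimal version: the slack on the branch i is the norm
   [f (a i)] itself, which keeps the bounds summable. If this norm is 0 there is no slack to spend,
   but then the weight vanishes a.e. *)
pose r i := if `[< alpha (a i) >] then 2 * fine (f (a i)) else 0.
exists r, (2 * fine S); split.
- by move=> i; rewrite /r; case: ifP => // _; rewrite mulr_ge0// fine_ge0.
- move=> I uI; rewrite /r -big_mkcond /= -mulr_sumr ler_pM2l//.
  rewrite -big_filter; set I' := [seq i <- I | _].
  have aI' i : i \in I' -> alpha (a i) by rewrite mem_filter => /andP[/asboolP].
  rewrite -lee_fin fineK//; apply: le_trans (sumS I' (filter_uniq _ uI) aI').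
  rewrite -sumEFin big_seq [leRHS]big_seq; apply: lee_sum => i /aI' ai.
  by rewrite fineK// ffin.
- move=> i; rewrite /r; case: asboolP => [ai|nai]; last first.
    have [E|//] := bs_mem bs i; have [_ _ wout _] := bs_density bs i.
    by apply: aeW => x _; rewrite wout// E image_set0.
  have [s os] := branch_density_derive pm ai (bs_density bs i).
  have : \forall x \ae mu, X x ->
      (`|\1_(T @` a i) x * derive1 (inv_branch T (a i)) x|%:E <= f (a i))%E.
    have := ess_sup_ge m (fun y => `|\1_(T @` a i) y * derive1 (inv_branch T (a i)) y|%:E).
    move/ae_mP; apply: aeS => x H Xx; apply: le_trans (H Xx) _.
    by rewrite leeDl// essTV_ge0.
  move=> h1 h2; have := aeI h1 h2; apply: aeS => x [H1 H2] Xx.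
  have fi0 : 0 <= fine (f (a i)) by rewrite fine_ge0.
  have [_ _ wout _] := bs_density bs i.
  have [Tx|/wout ->] := pselect ((T @` a i) x); last by rewrite mulr_ge0.
  have [_ dE] := H2 Tx; have := H1 Xx.
  rewrite -(fineK (ffin _ ai)) lee_fin indicE mem_set// mul1r dE (oriented_norm _ os).
  by rewrite ger0_norm ?(sys_w_ge0 bs)// => /le_trans; apply; lra.
- move=> i; suff [g [gE gV]] : exists g : R -> R, (\forall x \ae mu, X x -> g x = w i x) /\
      forall t, sorted <%O t -> list_in X t -> lvar (absd g) t <= r i.
    exists [set x | g x = w i x]; split => // t st tQ.
    rewrite -(@eq_in_lvar _ g); last by move=> x /tQ[].
    by apply: gV => // x /tQ[].
  rewrite /r; case: asboolP => [ai|nai]; last first.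
    have [E|//] := bs_mem bs i; have [_ _ wout _] := bs_density bs i.
    exists (fun=> 0); split; first by apply: aeW => x _; rewrite wout// E image_set0.
    by move=> t _ _; rewrite lvar_eq0.
  have [s os dE] := branch_density_derive pm ai (bs_density bs i).
  have [_ _ wout _] := bs_density bs i.
  have fi0 : 0 <= fine (f (a i)) by rewrite fine_ge0.
  have wE : \forall x \ae mu, X x ->
      `|\1_(T @` a i) x * derive1 (inv_branch T (a i)) x| = w i x.
    apply: aeS dE => x H _; have [Tx|nTx] := pselect ((T @` a i) x); last first.
      by rewrite indicE memNset// mul0r normr0 wout.
    have [_ ->] := H Tx; rewrite indicE mem_set// mul1r (oriented_norm _ os).
    by rewrite ger0_norm// (sys_w_ge0 bs).
  move: fi0; rewrite le_eqVlt => /predU1P[fi0|fi0].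
    exists (fun=> 0); split; last first.
      by move=> t _ _; rewrite -fi0 mulr0 lvar_eq0.
    have h1 : \forall x \ae mu, X x ->
        (`|\1_(T @` a i) x * derive1 (inv_branch T (a i)) x|%:E <= 0)%E.
      have := ess_sup_ge m (fun y => `|\1_(T @` a i) y * derive1 (inv_branch T (a i)) y|%:E).
      move/ae_mP; apply: aeS => x H Xx; apply: le_trans (H Xx) _.
      have -> : (0 = f (a i))%E by rewrite -(fineK (ffin _ ai)) -fi0.
      by rewrite leeDl// essTV_ge0.
    have := aeI h1 wE; apply: aeS => x [H1 H2] Xx; have := H1 Xx; rewrite H2//.
    by rewrite lee_fin => w0; apply/eqP; rewrite eq_le w0 (sys_w_ge0 bs).
  have efin : (essTV (fun y => \1_(T @` a i) y * derive1 (inv_branch T (a i)) y)%R < +oo)%E.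
    apply: (@le_lt_trans _ _ (f (a i))); first by rewrite leeDr// ess_sup_norm_ge0.
    by rewrite -ge0_fin_numE// ffin.
  have [g [gE gV]] := essTV_version fi0 efin.
  (* The weight is the absolute value of the derivative of the inverse branch, and taking absolute
     values does not increase variation. *)
  exists (fun x => `|g x|); split.
    by have := aeI gE wE; apply: aeS => x [H1 H2] Xx; rewrite H1// H2.
  move=> t st tX; apply: (@le_trans _ _ (lvar (absd g) t)).
    by apply: lvar_le => // x y _ _ _; exact: ler_dist_dist.
  apply: le_trans (gV t st tX) _; rewrite mulrDl mul1r lerD2r.
  apply: fine_le; [|exact: ffin|by rewrite leeDr// ess_sup_norm_ge0].
  by rewrite ge0_fin_numE// essTV_ge0.
Qed.

End RychlikBounds.

(** * From finite unions of cylinders to sigma(alpha_k) *)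

Section SigmaEstimate.
Context {R : realType}.
Local Notation MR := (measurableTypeR R).
Local Notation mu := (@lebesgue_measure R).
Variables (T : R -> R) (alpha : set (set R)) (a : nat -> set R) (w : nat -> R -> R).
Hypothesis bs : branch_system T alpha a w.
Let pm := bs_pm bs.
Variables (P : probability MR R) (h : R -> R) (C rho : R).
Hypotheses (acP : ac_invariant T P) (dP : density P h).
Hypotheses (C0 : 0 < C) (rho0 : 0 < rho) (sg : spectral_gap T h C rho).
Local Notation H := (h \_ X).
Local Notation F := (word_transfer T a w H).

Lemma P_null (N : set R) : measurable (N : set MR) -> mu (N `&` X) = 0%E -> P N = 0%E.
Proof.
have [/null_content_dominatesP dom _] := acP; move=> mN N0.
by apply: dom => //; rewrite mE.
Qed.

Lemma probabilityU2 (A B : set R) : measurable (A : set MR) -> measurable (B : set MR) ->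
  (P (A `|` B) <= P A + P B)%E.
Proof. by move=> mA mB; exact: measureU2. Qed.

Lemma P_ae_eq (A B : set R) : measurable (A : set MR) -> measurable (B : set MR) ->
  (\forall x \ae mu, X x -> A x -> B x) -> (P A <= P B)%E.
Proof.
move=> mA mB [N [mN N0 HN]].
have PN : P N = 0%E.
  apply: P_null => //; apply/eqP; rewrite eq_le measure_ge0 andbT -N0.
  by apply: le_measure; rewrite ?inE//; exact: (measurableI _ _ mN mX).
have PX : P (~` (X : set R)) = 0%E := P_XC acP.
have mXC : measurable (~` (X : set MR)) := measurableC mX.
apply: (@le_trans _ _ (P (B `|` (N `|` ~` X)))).
  apply: le_measure; rewrite ?inE//.
    by apply: measurableU => //; exact: measurableU.
  move=> x Ax; have [Bx|nB] := pselect (B x); [by left|right].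
  have [Xx|nX] := pselect (X x); [left|by right].
  by apply: HN => /= /(_ Xx Ax).
have mNX : measurable (N `|` ~` X : set MR) by exact: measurableU.
apply: (le_trans (probabilityU2 mB mNX)).
rewrite -[leRHS]adde0; apply: leeD => //.
by apply: (le_trans (probabilityU2 mN mXC)); rewrite PN PX adde0.
Qed.

(** The bound [c] is the same for all finite unions inside A, so it survives the monotone limit that
    exhausts A. *)
Lemma sigma_estimate k (A D : set R) (q c : R) : (0 < k)%N ->
  <<s X, cylinders T alpha k >> A -> measurable (D : set MR) ->
  (forall L, uniq L -> {in L, forall b, size b = k} -> words_union T a L `<=` A ->
     `|fine (P (words_union T a L `&` D)) - fine (P (words_union T a L)) * q| <= c) ->
  `|fine (P (A `&` D)) - fine (P A) * q| <= c.
Proof.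
move=> k0 sA mD HL.
have [[mA AX] _] := sigma_cylinders_split bs k0 sA.
have [L [uL LA ndL aeL]] := sigma_cylinders_approx bs k0 sA.
have mL n : measurable (words_union T a (L n) : set MR) := measurable_words_union bs _.
have lim (E : set R) : measurable (E : set MR) ->
    fine (P (words_union T a (L n) `&` E)) @[n --> \oo] --> fine (P (A `&` E)).
  move=> mE'; apply: fine_cvg; rewrite fineK; last first.
    by apply: fin_num_measure; exact: measurableI.
  have -> : P (A `&` E) = P (\bigcup_n (words_union T a (L n) `&` E)).
    apply/eqP; rewrite eq_le; apply/andP; split.
      apply: P_ae_eq; [exact: measurableI|by apply: bigcup_measurable => n _; exact: measurableI|].
      by apply: aeS aeL => x Hx Xx [/Hx[n Lx] Ex]; exists n.
    apply: le_measure; rewrite ?inE; [|exact: measurableI|].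
      by apply: bigcup_measurable => n _; exact: measurableI.
    by move=> x [n _ [/LA Ax Ex]].
  apply: nondecreasing_cvg_mu; first by move=> n; exact: measurableI.
    by apply: bigcup_measurable => n _; exact: measurableI.
  by move=> n p np; apply/subsetPset; apply: setSI; exact: ndL.
have H1 := lim D mD; have := lim setT measurableT.
under eq_fun do rewrite setIT.
rewrite setIT => H2.
have H3 : `|fine (P (words_union T a (L n) `&` D)) - fine (P (words_union T a (L n))) * q|
    @[n --> \oo] --> `|fine (P (A `&` D)) - fine (P A) * q|.
  by apply: cvg_norm; apply: cvgB => //; apply: cvgMl.
rewrite -(cvg_lim _ H3)//; apply: limr_le; first by apply/cvg_ex; eexists; exact: H3.
by apply: nearW => n; have [u1 u2] := uL n; exact: HL.
Qed.

Lemma words_estimate L k K B n : uniq L -> {in L, forall b, size b = k} ->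
  (BVnorm (fun x => \sum_(b <- L) F b x)%R <= K%:E)%E -> borelX B -> (0 < n)%N ->
  `|fine (P (words_union T a L `&` preX T (n + k) B)) -
    fine (P (words_union T a L)) * fine (P B)| <= C * rho ^+ n * K * fine (m B).
Proof.
move=> uL sL FK bB n0.
have mU : measurable (words_union T a L : set MR) := measurable_words_union bs _.
have UX : words_union T a L `<=` X by move=> x [b _]; exact: cylinder_subX.
have mF : measurable_fun (X : set MR) (fun x => \sum_(b <- L) F b x).
  apply: measurable_sum => b; apply: measurable_funTS.
  exact: (measurable_word_transfer bs (patch_density_measurable dP)).
have F0 x : 0 <= \sum_(b <- L) F b x.
  by apply: sumr_ge0 => b _; exact: (word_transfer_ge0 bs (patch_density_ge0 dP)).
have FE B' : borelX B' -> P (words_union T a L `&` preX T k B') =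
    (\int[m]_(x in B') (\sum_(b <- L) F b x)%:E)%E.
  by move=> bB'; have [mB' B'X] := bB'; rewrite (words_measure bs dP)// ge0_integral_mX.
apply: (mixing_estimate pm dP C0 rho0 sg (F := fun x => \sum_(b <- L) F b x)) => //.
apply/integrableP; split; first exact/measurable_EFinP.
under eq_integral do rewrite gee0_abs ?lee_fin//.
rewrite -FE; last by split; [exact: mX|].
apply: le_lt_trans (probability_le1 _ _) (ltry _).
by apply: measurableI => //; apply: (measurable_preX pm); exact: mX.
Qed.

End SigmaEstimate.

(** * Part (a) *)

Section PartA.
Context {R : realType}.
Local Notation MR := (measurableTypeR R).
Local Notation mu := (@lebesgue_measure R).

Lemma expansion_ex (T : R -> R) alpha a w : branch_system T alpha a w -> condU T alpha ->
  exists th : R, [/\ 0 < th, th < 1 & forall i, \forall x \ae mu, w i x <= th].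
Proof.
move=> bs cU; have [beta b1 Hb] := condU_ex cU; exists beta^-1.
have b0 : 0 < beta by rewrite (lt_trans ltr01).
split; first by rewrite invr_gt0.
  by rewrite invf_lt1.
move=> i; have [E|ai] := bs_mem bs i.
  have [_ _ wout _] := bs_density bs i.
  by apply: aeW => x; rewrite wout ?invr_ge0 ?ltW// E image_set0.
exact: (branch_density_le (bs_pm bs) ai (bs_density bs i) b1 Hb).
Qed.

Lemma inf_pos_ex (h : R -> R) : (0 < inf_pos h)%E ->
  exists2 d : R, 0 < d & \forall x \ae mu, X x -> 0 < h x -> d <= h x.
Proof.
move=> /ereal_sup_gt[y /ae_mP yE]; case: y yE => [d dE| yE|//].
  by rewrite lte_fin => d0; exists d => //; apply: aeS dE => x H Xx /(H Xx); rewrite lee_fin.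
by exists 1 => //; apply: aeS yE => x H Xx /(H Xx); rewrite leye_eq.
Qed.

Lemma conull_neq0 (G : set R) : (\forall x \ae mu, X x -> G x) -> G !=set0.
Proof.
move=> [N [mN N0 GN]]; apply: contrapT => nG.
have XN : (X : set R) `<=` N.
  by move=> x Xx; apply: GN => /= /(_ Xx) Gx; apply: nG; exists x.
have := m_X (R := R); rewrite mE setIid => X1.
have : (mu X <= mu N)%E by apply: le_measure; rewrite ?inE//; exact: mX.
by rewrite X1 N0 lee_fin ler10.
Qed.

(** In (a) h may vanish on a set of positive Lebesgue measure, so m(B) itself need not be bounded by
    P(B) / d. Removing the part of B where h < d costs no P-measure, since h = 0 a.e. there. *)
Lemma borelX_dom (T : R -> R) (P : probability MR R) h B d :
  density P h -> borelX B -> 0 < d ->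
  (\forall x \ae mu, X x -> 0 < h x -> d <= h x) ->
  exists B', [/\ borelX B', B' `<=` B, P (B `\` B') = 0%E & d * fine (m B') <= fine (P B')].
Proof.
move=> [mh h0 hE] [mB BX] d0 hd.
pose B' := B `&` h @^-1` `[d, +oo[.
have mB' : measurable (B' : set MR).
  by apply: (measurable_funS mX BX mh) => //.
have B'X : B' `<=` X by move=> x [/BX].
exists B'; split => //.
- by move=> x [].
- have mD : measurable (B `\` B' : set MR) by exact: measurableD.
  rewrite hE; last by split => // x [/BX].
  rewrite ge0_integral_mX//; last by move=> x [/BX].
  transitivity (\int[mu]_(x in B `\` B') (cst 0%E x))%E; last by rewrite integral_cst// mul0e.
  apply: ae_eq_integral => //.
    by apply/measurable_EFinP; apply: (measurable_funS mX _ mh) => x [/BX].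
  apply: aeS hd => x Hx [Bx nB']; have Xx := BX _ Bx.
  apply/eqP; rewrite /= eqe eq_le (h0 _ Xx) andbT leNgt; apply/negP => hx.
  apply: nB'; split => //=; rewrite in_itv /= andbT; exact: Hx.
- have mfin : m B' \is a fin_num.
    rewrite ge0_fin_numE//; apply: (@le_lt_trans _ _ (m (X : set R))).
      by apply: le_measure; rewrite ?inE//; exact: mX.
    by rewrite m_X ltry.
  rewrite -lee_fin EFinM !fineK//; last exact: fin_num_measure.
  rewrite hE; last by split.
  rewrite -integral_cst//; apply: ge0_le_integral => //.
  - by move=> x _; rewrite lee_fin ltW.
  - by apply/measurable_EFinP; exact: (measurable_funS mX B'X mh).
  - by move=> x [_] /=; rewrite in_itv /= andbT lee_fin.
Qed.

Lemma part_a (T : R -> R) (alpha : set (set R)) (P : probability MR R) (h : R -> R) (C r : R) :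
  ru_map T alpha -> ac_invariant T P -> density P h ->
  0 < C -> 0 < r -> spectral_gap T h C r -> (0 < inf_pos h)%E ->
  exists2 B : R, 0 < B & forall n : nat, (0 < n)%N ->
    (mixing_coef (phi_minus_coef P) T alpha n <= (B * r ^+ n)%:E)%E.
Proof.
move=> [pm cU cR] acP dP C0 r0 sg ip.
have [a [w bs]] := branch_system_ex pm.
have [rr [RR [rr0 rrS wle wvar]]] := condR_bounds bs cR.
have [th [th0 th1 wth]] := expansion_ex bs cU.
have [d d0 hd] := inf_pos_ex ip.
have aeth : \forall x \ae mu, X x -> forall i, w i x <= th.
  by have := ae_all wth; apply: aeS => x H _.
have [G [M [V [[GX Gth aeG Gv] [M0 hM hV] [_ wV] FL]]]] :=
  good_system bs acP dP sg rrS wle wvar aeth.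
have H0 := patch_density_ge0 dP.
have K0 := @uniform_variation _ T alpha a w bs G (h \_ X) Gv H0 th M V RR rr M0 th1
  (fun i y Gy => Gth y Gy i)
  (fun k L y uL sL Gy => le_trans (FL k L y uL sL Gy) (hM y Gy))
  wV rrS.
set K1 := Num.max V (M * RR / (1 - th)) in K0.
have {}K0 k L t : uniq L -> {in L, forall b, size b = k} -> sorted <%O t -> list_in G t ->
    \sum_(b <- L) lvar (absd (word_transfer T a w (h \_ X) b)) t <= K1.
  apply: K0 => t' st' tG'; rewrite (@eq_in_lvar _ _ h); first exact: hV.
  by move=> x /tG'/GX Xx; rewrite patchE mem_set.
pose K := 2 * K1 + 3 * M.
have G0 := conull_neq0 aeG.
have BVL k L : uniq L -> {in L, forall b, size b = k} ->
    (BVnorm (fun x => \sum_(b <- L) word_transfer T a w (h \_ X) b x)%R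
      <= K%:E)%E.
  move=> uL sL; apply: (BVnorm_le aeG) => //.
    move=> x Gx; rewrite ger0_norm; first exact: le_trans (FL k L x uL sL Gx) (hM x Gx).
    by apply: sumr_ge0 => b _; exact: (word_transfer_ge0 bs H0).
  move=> t st tG; apply: le_trans (K0 k L t uL sL st tG).
  rewrite -lvar_sum; apply: lvar_le => // x y _ _ _.
  by rewrite /absd -sumrB; exact: ler_norm_sum.
have K_ge0 : 0 <= K.
  rewrite -lee_fin; apply: le_trans (BVL 0%N [::] isT _) => //.
  by rewrite adde_ge0 ?essTV_ge0 ?ess_sup_norm_ge0.
(* [K] may be 0, and the constant has to be positive. For [phi_minus_coef] one divides by the
   measure of the future event, which the bound of m(B') by P(B') / d cancels. *)
exists (C * (K + 1) / d); first by rewrite divr_gt0// mulr_gt0// ltr_wpDl.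
move=> n n0; apply: ge_ereal_sup => _ [k k0 <-].
apply: ge_ereal_sup => _ [D [A [[B bB <-] sA pD pA ->]]].
rewrite lee_fin.
have [B' [bB' B'B PB0 dB']] := borelX_dom T dP bB d0 hd.
have [mB BX] := bB; have [mB' B'X] := bB'.
have [[mA AX] _] := sigma_cylinders_split bs k0 sA.
have [mpB _] := borel_preX pm (n + k) bB; have [mpB' _] := borel_preX pm (n + k) bB'.
have bDB : borelX (B `\` B') by split; [exact: measurableD|move=> x [/BX]].
have [mpDB _] := borel_preX pm (n + k) bDB.
have PBB : P B = P B'.
  apply/eqP; rewrite eq_le; apply/andP; split; last by apply: le_measure; rewrite ?inE.
  rewrite -[leRHS]adde0 -PB0; apply: (@le_trans _ _ (P (B' `|` (B `\` B')))).
    by rewrite setDUK.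
  apply: probabilityU2 => //; exact: measurableD.
have PAB : P (A `&` preX T (n + k) B) = P (A `&` preX T (n + k) B').
  apply/eqP; rewrite eq_le; apply/andP; split; last first.
    apply: le_measure; rewrite ?inE; [exact: measurableI|exact: measurableI|].
    by move=> x [Ax [Xx /B'B Bx]].
  rewrite -[leRHS]adde0 -PB0 -(P_preX pm acP (n + k) bDB).
  apply: (@le_trans _ _ (P ((A `&` preX T (n + k) B') `|` preX T (n + k) (B `\` B')))).
    apply: le_measure; rewrite ?inE; [exact: measurableI|by apply: measurableU => //; exact: measurableI|].
    move=> x [Ax [Xx Bx]]; have [B'x|nB'x] := pselect (B' (iter (n + k) T x)).
      by left; split => //; split.
    by right; split => //; split.
  by apply: probabilityU2 => //; exact: measurableI.
have est : `|fine (P (A `&` preX T (n + k) B')) - fine (P A) * fine (P B')| <=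
    C * r ^+ n * K * fine (m B').
  apply: (sigma_estimate bs acP k0 sA mpB') => L uL sL _.
  exact: (words_estimate bs dP C0 r0 sg uL sL (BVL k L uL sL) bB' n0).
have pB : fine (P (preX T (n + k) B)) = fine (P B') by rewrite (P_preX pm acP)// PBB.
rewrite setIC PAB pB in pD *.
have -> : fine (P (A `&` preX T (n + k) B')) / fine (P B') - fine (P A) =
    (fine (P (A `&` preX T (n + k) B')) - fine (P A) * fine (P B')) / fine (P B').
  by field; rewrite gt_eqF.
rewrite normrM normfV (gtr0_norm pD) ler_pdivrMr//; apply: le_trans est _.
have -> : C * (K + 1) / d * r ^+ n * fine (P B') = C * r ^+ n * (K + 1) * (fine (P B') / d).
  by field; rewrite gt_eqF.
have rn : 0 < C * r ^+ n by rewrite mulr_gt0 ?exprn_gt0.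
rewrite -!mulrA ler_pM2l// ler_pM2l ?exprn_gt0//.
apply: ler_pM => //.
- by rewrite lerDl.
- by rewrite ler_pdivlMr// mulrC.
Qed.

End PartA.

(** * Images of cylinders and part (c) *)

Section ImagesOfCylinders.
Context {R : realType}.
Variables (T : R -> R) (alpha : set (set R)) (a : nat -> set R) (w : nat -> R -> R).
Hypothesis bs : branch_system T alpha a w.
Let pm := bs_pm bs.
Local Notation cyl := (cylinder T a).

Definition cylinder_image (b : seq nat) : set R := iter (size b) T @` cyl b.

Lemma cylinder_image_cons i b :
  cylinder_image (i :: b) = T @` (cylinder_image b `&` a i).
Proof.
apply/seteqP; split=> y.
  move=> [x [bx [_ ai]] <-] /=; exists (iter (size b) T x) => //; split => //.
  by exists x.
move=> [_ [[x bx <-] ai] <-]; exists x => //; split => //; split => //.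
exact: cylinder_subX bx.
Qed.

Lemma cylinder_image_subX b : cylinder_image b `<=` X.
Proof. by move=> _ [x /cylinder_subX Xx <-]; exact: (pm_self_iter pm). Qed.

Lemma is_intervalI (E E' : set R) : is_interval E -> is_interval E' -> is_interval (E `&` E').
Proof.
move=> iE iE' x y [Ex E'x] [Ey E'y] z xyz.
by split; [exact: iE Ex Ey z xyz|exact: iE' E'x E'y z xyz].
Qed.

Lemma cylinder_image_interval b : is_interval (cylinder_image b).
Proof.
elim: b => [|i b IH].
  rewrite (_ : cylinder_image [::] = X); first exact: interval_is_interval.
  by apply/seteqP; split=> [_ [x Xx <-]//|x Xx]; exists x.
rewrite cylinder_image_cons; apply: continuous_is_interval.
  by apply: is_intervalI => //; exact: (sys_interval bs).
move=> x [_ ax]; have [E|ai] := bs_mem bs i; first by rewrite E in ax.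
exact: (branch_continuous pm ai).
Qed.

End ImagesOfCylinders.

Section PartC.
Context {R : realType}.
Local Notation MR := (measurableTypeR R).
Local Notation mu := (@lebesgue_measure R).

Lemma abs_cont_two_points (E : set R) (f : R -> R) e : is_interval E -> abs_cont_on E f -> 0 < e ->
  exists2 d, 0 < d & forall x y, E x -> E y -> `|y - x| < d -> `|f y - f x| < e.
Proof.
move=> iE ac e0; have [d d0 H] := ac e e0; exists d => //.
have step x y : E x -> E y -> x <= y -> y - x < d -> `|f y - f x| < e.
  move=> Ex Ey xy yx.
  have := H 1%N (fun=> x) (fun=> y); rewrite !big_ord1; apply => //.
    by move=> _; split => // z /=; rewrite in_itv /=; exact: iE.
  by move=> i j _ _ _; rewrite (ord1 i) (ord1 j).
move=> x y Ex Ey; have [xy|/ltW yx] := leP x y.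
  by rewrite (ger0_norm (_ : 0 <= y - x)) ?subr_ge0//; exact: step.
by rewrite distrC [`|f y - _|]distrC (ger0_norm (_ : 0 <= x - y)) ?subr_ge0//; exact: step.
Qed.

Lemma small_interval (p eta : R) : X p -> 0 < eta ->
  exists c d, [/\ 0 <= c, c <= d, d <= 1, d - c <= 2 * eta &
    forall x, X x -> `|x - p| <= eta -> c <= x <= d].
Proof.
rewrite XE => /andP[p0 p1] eta0; exists (Num.max 0 (p - eta)), (Num.min 1 (p + eta)).
split.
- by rewrite le_max lexx.
- by rewrite ge_max !le_min ler01; apply/andP; split; [|apply/andP; split]; lra.
- by rewrite ge_min lexx.
- have h1 : p - eta <= Num.max 0 (p - eta) by rewrite le_max lexx orbT.
  have h2 : Num.min 1 (p + eta) <= p + eta by rewrite ge_min lexx orbT.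
  lra.
- move=> x; rewrite XE => /andP[x0 x1]; rewrite ler_distl ge_max le_min x0 x1 /=.
  by move=> /andP[-> ->].
Qed.

(** Absolute continuity makes T uniformly continuous on each element of alpha, so the image of a
    short interval is covered, up to a null set, by one short interval for each of the finitely many
    elements; this is iterated n times. *)
Lemma small_image (T : R -> R) (alpha : set (set R)) n e : pm_map T alpha ->
  finite_set alpha -> 0 < e -> exists2 dlt, 0 < dlt &
  forall c d, 0 <= c -> c <= d -> d <= 1 -> d - c < dlt ->
  exists B, [/\ borelX B, (m B < e%:E)%E &
    \forall x \ae mu, X x -> c <= x <= d -> B (iter n T x)].
Proof.
move=> pm fa; have [a [w bs]] := branch_system_ex pm.
elim: n e => [|n IH] e e0.
  exists e => // c d c0 cd d1 dce; exists `[c, d]%classic; split.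
  - by split; [exact: measurable_itv|exact: cc_subX].
  - by rewrite m_cc// lte_fin.
  - by apply: aeW => x _ cxd; rewrite ccP.
have /finite_seqP[s sE] := fa.
(* The budget for one branch; the successor in the denominator makes it well defined and the total
   strictly less than [e]. *)
pose e' := e / (size s).+1%:R.
have e'0 : 0 < e' by rewrite divr_gt0.
have [dlt dlt0 Hd] := IH e' e'0.
(* Radius dlt / 3 around one image point gives an interval of length at most 2 * dlt / 3, short
   enough for [Hd]. *)
have dlt3 : 0 < dlt / 3 by rewrite divr_gt0.
have [de de0 Hde] : exists2 de, 0 < de & forall E, E \in s -> forall x y, E x -> E y ->
    `|y - x| < de -> `|T y - T x| < dlt / 3.
  have sub : {in s, forall E, alpha E} by move=> E Es; rewrite sE.
  elim: (s) sub => [|E l IHl] sub; first by exists 1.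
  have [|d1 d10 H1] := IHl; first by move=> E' E'l; apply: sub; rewrite inE E'l orbT.
  have aE : alpha E by apply: sub; rewrite mem_head.
  have [d2 d20 H2] := abs_cont_two_points (open_interval_convex (branch_oi pm aE))
    (pm_abs_cont pm aE) dlt3.
  exists (Num.min d1 d2); first by rewrite lt_min d10.
  move=> E'; rewrite inE => /predU1P[->|E'l] x y Ex Ey; rewrite lt_min => /andP[l1 l2].
    exact: H2.
  exact: (H1 E').
exists de => // c d c0 cd d1 dcd.
have [B [bB mB HB]] : exists B, [/\ borelX B, (m B <= ((size s)%:R * e')%:E)%E &
    \forall x \ae mu, X x -> forall E, E \in s -> E x -> c <= x <= d -> B (iter n.+1 T x)].
  have sub : {in s, forall E, alpha E} by move=> E Es; rewrite sE.
  elim: (s) sub Hde => [|E l IHl] sub Hl.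
    exists set0; split; first by split; [exact: measurable0|].
      by rewrite measure0 mul0r.
    by apply: aeW.
  have [||B [bB mB HB]] := IHl.
  - by move=> E' E'l; apply: sub; rewrite inE E'l orbT.
  - by move=> E' E'l; apply: Hl; rewrite inE E'l orbT.
  have aE : alpha E by apply: sub; rewrite mem_head.
  have [[p [Ep cpd]]|nE] := pselect (exists p, E p /\ c <= p <= d); last first.
    exists B; split => //.
      by apply: le_trans mB _; rewrite lee_fin ler_wpM2r ?(ltW e'0)// ler_nat.
    apply: aeS HB => x Hx Xx E'; rewrite inE => /predU1P[->|E'l] E'x cxd; last exact: (Hx Xx E').
    by case: nE; exists x.
  have Xp : X (T p) by apply: (pm_self pm); exact: (branch_subX pm aE).
  have [c' [d' [c'0 cd' d'1 dc' Hc']]] := small_interval Xp dlt3.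
  have [|B' [bB' mB' HB']] := Hd c' d' c'0 cd' d'1; first lra.
  have [[mB1 BX] [mB1' BX']] := (bB, bB').
  exists (B `|` B'); split.
  - by split; [exact: measurableU|move=> x [/BX|/BX']].
  - apply: (@le_trans _ _ (m B + m B')%E); first exact: measureU2.
    rewrite /= -natr1 mulrDl mul1r EFinD; apply: leeD => //; exact: ltW.
  - have := aeI HB (ae_T bs HB'); apply: aeS => x [H1 H2] Xx E'.
    rewrite inE => /predU1P[->|E'l] E'x cxd; last by left; exact: (H1 Xx E').
    right; rewrite iterSr; apply: H2 => //; apply: Hc'; first exact: (pm_self pm).
    apply/ltW/(Hl E); rewrite ?mem_head//.
    by move: cpd cxd dcd => /andP[? ?] /andP[? ?] ?; rewrite ltr_norml; apply/andP; split; lra.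
exists B; split => //.
  apply: le_lt_trans mB _; rewrite lte_fin /e' mulrCA -[ltRHS]mulr1 ltr_pM2l//.
  by rewrite ltr_pdivrMr// mul1r ltr_nat.
have := aeI HB (sys_cover bs); apply: aeS => x [H1 H2] Xx cxd.
have [i ai] := H2 Xx; apply: (H1 Xx (a i)) => //.
have [E|ai'] := bs_mem bs i; first by rewrite E in ai.
by move: ai'; rewrite sE.
Qed.

Lemma small_probability (P : probability MR R) e : P `<< @m R -> 0 < e ->
  exists2 dlt, 0 < dlt & forall B, borelX B -> (m B < dlt%:E)%E -> fine (P B) < e.
Proof.
move=> dom e0.
have [A [N pn]] := Hahn_decomposition (charge_of_finite_measure P).
have [r [r0 re]] := charge_variation_continuous pn dom e0.
exists r => // B [mB _] Br; rewrite -lte_fin fineK ?fin_num_measure//.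
apply: le_lt_trans (re B mB Br).
by rewrite -[leLHS]gee0_abs//; exact: abse_charge_variation.
Qed.

Lemma part_c (T : R -> R) (alpha : set (set R)) (P : probability MR R) :
  pm_map T alpha -> ac_invariant T P -> finite_set alpha ->
  inf_image T (charged_cylinders P T alpha) = 0%E ->
  forall n : nat, (0 < n)%N -> mixing_coef (phi_plus_coef P) T alpha n = 1%E.
Proof.
move=> pm acP fa inf0 n n0; have [a [w bs]] := branch_system_ex pm.
have fP A : measurable (A : set MR) -> P A \is a fin_num by move=> ?; exact: fin_num_measure.
apply/eqP; rewrite eq_le; apply/andP; split.
  apply: ge_ereal_sup => _ [k k0 <-].
  apply: ge_ereal_sup => _ [A [D [sA [B bB <-] pA pD ->]]].
  have [[mA AX] _] := sigma_cylinders_split bs k0 sA.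
  have [mpB _] := borel_preX pm (n + k) bB.
  have mI : measurable (A `&` preX T (n + k) B : set MR) by exact: measurableI.
  rewrite lee_fin; set p := fine (P (A `&` _)) / _; set q := fine _.
  have p0 : 0 <= p by rewrite divr_ge0// fine_ge0.
  have p1 : p <= 1.
    rewrite ler_pdivrMr// mul1r; apply: fine_le; rewrite ?fP//.
    by apply: le_measure; rewrite ?inE.
  have q0 : 0 <= q by rewrite fine_ge0.
  have q1 : q <= 1 by rewrite -lee_fin fineK ?fP//; exact: probability_le1.
  by rewrite ler_norml; apply/andP; split; lra.
rewrite leNgt; apply/negP => lt1.
have [e e0 He] : exists2 e : R, 0 < e &
    (mixing_coef (phi_plus_coef P) T alpha n < (1 - e)%:E)%E.
  move: lt1; case: (mixing_coef _ _ _ _) => [x|//|_]; last by exists 1 => //; rewrite ltNyr.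
  rewrite lte_fin => x1; exists ((1 - x) / 2); first by rewrite divr_gt0// subr_gt0.
  by rewrite lte_fin; lra.
have [dl dl0 Pdl] := small_probability acP.1 e0.
have [dl' dl'0 Hdl'] := small_image n pm fa dl0.
have dl3 : 0 < dl' / 3 by rewrite divr_gt0.
have : (inf_image T (charged_cylinders P T alpha) < (dl' / 3)%:E)%E by rewrite inf0 lte_fin.
move=> /ereal_inf_lt[_ [k [c [k0 [ck Pc] ->]]] mc].
have [b sb bE] := cylinder_word bs k0 ck.
have mb : measurable (c : set MR) by rewrite -bE; exact: (measurable_cylinder bs).
have cX : c `<=` X by rewrite -bE; exact: cylinder_subX.
pose E := cylinder_image T a b.
have EE : iter k T @` c = E by rewrite /E /cylinder_image sb bE.
have EX : E `<=` X := cylinder_image_subX bs (b := b).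
have [[x0 cx0] _] := ck.
have Ep : E (iter k T x0) by rewrite -EE; exists x0.
have Elen x y : E x -> E y -> x <= y -> y - x <= dl' / 3.
  move=> Ex Ey xy; rewrite -lee_fin; apply: le_trans (ltW mc).
  have [/andP[x0' _] /andP[_ y1]] : 0 <= x <= 1 /\ 0 <= y <= 1.
    by split; rewrite -XE; exact: EX.
  rewrite EE -m_cc//; apply: le_measure; rewrite ?inE.
  - exact: measurable_itv.
  - exact: (is_interval_measurable (cylinder_image_interval bs (b := b))).
  - by move=> z; rewrite ccP; exact: (cylinder_image_interval bs Ex Ey).
have [c' [d' [c'0 cd' d'1 dc' Hc']]] := small_interval (EX _ Ep) dl3.
have [|B [bB mB HB]] := Hdl' c' d' c'0 cd' d'1; first lra.
have [mB1 BX] := bB.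
have [mpB _] := borel_preX pm (n + k) bB.
have mI : measurable (c `&` preX T (n + k) B : set MR) by exact: measurableI.
have cD : P (c `&` preX T (n + k) B) = P c.
  apply/eqP; rewrite eq_le; apply/andP; split; first by apply: le_measure; rewrite ?inE.
  apply: (P_ae_eq acP) => //.
  have := ae_iterT bs k HB; apply: aeS => x Hx Xx cx; split => //; split => //=.
  rewrite iterD; apply: Hx => //; have Ex : E (iter k T x) by rewrite -EE; exists x.
  apply: Hc'; first exact: EX.
  have [l1|/ltW l1] := leP (iter k T x0) (iter k T x).
    by rewrite ger0_norm ?subr_ge0// Elen.
  by rewrite distrC ger0_norm ?subr_ge0// Elen.
have pc : 0 < fine (P c) by rewrite fine_gt0// Pc ltey_eq fP.
have PB : fine (P B) < e := Pdl B bB mB.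
have pD : fine (P (preX T (n + k) B)) = fine (P B) by rewrite (P_preX pm acP).
have : (`|fine (P (c `&` preX T (n + k) B)) / fine (P c) - fine (P (preX T (n + k) B))|%:E
    <= mixing_coef (phi_plus_coef P) T alpha n)%E.
  apply: le_trans (ereal_sup_ubound (_ : [set _ | _ in _] (phi_plus_coef P
    <<s X, cylinders T alpha k >> [set preX T (n + k) B | B in borelX]))); last by exists k.
  apply: ereal_sup_ubound; exists c, (preX T (n + k) B); split => //.
  - exact: sub_gen_smallest.
  - by exists B.
  (* The coefficient admits only events of positive probability; this one contains the charged
     cylinder [c] up to a P-null set. *)
  - apply: lt_le_trans pc _; rewrite -cD; apply: fine_le; rewrite ?fP//.
    by apply: le_measure; rewrite ?inE.
move=> /le_lt_trans /(_ He); rewrite lte_fin cD pD divff ?gt_eqF//.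
have := ler_norm (1 - fine (P B)); lra.
Qed.

End PartC.

(** * Bounded distortion of branches and words *)

Section LogLipschitz.
Context {R : realType}.

Lemma log_lipschitz (E : set R) (g dg : R -> R) D : is_interval E ->
  (forall z, E z -> is_derive z 1 g (dg z)) -> (forall z, E z -> 0 < g z) ->
  (forall z, E z -> `|dg z| <= D * g z) ->
  forall y y', E y -> E y' -> g y <= g y' * expR (D * `|y - y'|).
Proof.
move=> iE dE g0 gD.
have dL z : E z -> is_derive z 1 (@ln R \o g) ((g z)^-1 * dg z).
  move=> Ez; have dgz := dE z Ez; have dln := is_derive1_ln (g0 z Ez).
  exact: is_derive1_comp.
have L y y' : E y -> E y' -> y <= y' -> `|ln (g y') - ln (g y)| <= D * `|y' - y|.
  move=> Ey Ey' yy'.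
  have sub z : z \in `[y, y'] -> E z by rewrite in_itv /=; exact: iE.
  have [||z zi ->] := @MVT_segment R (@ln R \o g) (fun z => (g z)^-1 * dg z) y y' yy'.
  - by move=> z zi; apply: dL; apply: sub; exact: subset_itv_oo_cc zi.
  - apply: derivable_within_continuous => z zi.
    exact: (@ex_derive _ _ _ _ _ _ _ (dL z (sub z zi))).
  rewrite normrM ler_wpM2r// normrM normfV (gtr0_norm (g0 _ (sub _ zi))).
  by rewrite mulrC ler_pdivrMr ?(g0 _ (sub _ zi))// gD//; exact: sub.
move=> y y' Ey Ey'; rewrite -[g y]lnK ?posrE ?g0// -[g y' in leRHS]lnK ?posrE ?g0//.
rewrite -expRD ler_expR -lerBlDl.
have [yy'|/ltW yy'] := leP y y'.
  by apply: le_trans (ler_norm _) _; rewrite distrC [`|y - y'|]distrC; exact: L.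
by apply: le_trans (ler_norm _) _; exact: L.
Qed.

End LogLipschitz.

Section AdlerDistortion.
Context {R : realType}.
Variables (T : R -> R) (alpha : set (set R)).
Hypothesis afu : afu_map T alpha.
Let pm : pm_map T alpha. Proof. by case: afu. Qed.

(** Where T' = 0 the quotient in (A) is 0 by the convention for division and says nothing, hence the
    second alternative; it is ruled out on the branches by the diffeomorphic extension. *)
Lemma condA_ex : exists2 D : R, 0 <= D & forall x, (\bigcup_(c in alpha) c) x ->
  `|derive1 (derive1 T) x| <= D * (derive1 T x) ^+ 2 \/ derive1 T x = 0.
Proof.
have [_ _ _ _ cA] := afu; move: cA; rewrite /condA; set S := [set _ | _ in _] => cA.
have [D DS] : exists D : R, (ereal_sup S <= D%:E)%E.
  by case: (ereal_sup S) cA => [D| |] //= _; [exists D|exists 0; rewrite leNye].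
exists (Num.max D 0); first by rewrite le_max lexx orbT.
move=> x ax; have [->|Tx] := eqVneq (derive1 T x) 0; [by right|left].
have T2 : 0 < (derive1 T x) ^+ 2 by rewrite lt0r sqr_ge0 sqrf_eq0 Tx.
rewrite -ler_pdivrMr// le_max -!lee_fin; apply/orP; left; apply: le_trans DS.
by apply: ereal_sup_ubound; exists x.
Qed.

Lemma nbhs_open_interval (E : set R) x : open_interval E -> E x -> nbhs x E.
Proof. by move=> oE Ex; apply: open_nbhs_nbhs; split => //; exact: open_interval_open. Qed.

(** The last identity is the chain rule for [G \o S], which is the identity near x; it shows that
    the derivatives do not vanish. *)
Lemma afu_branch c : alpha c -> exists S G : R -> R,
  [/\ C2 S, C2 G,
      {in T @` c, inv_branch T c =1 G} &
      forall x, c x -> [/\ derive1 T x = derive1 S x,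
        derive1 (derive1 T) x = derive1 (derive1 S) x,
        derivable T x 1 & derive1 G (T x) * derive1 S x = 1]].
Proof.
move=> ac; have [_ ext _ _ _] := afu; have [S [G [C2S C2G SE SG ST]]] := ext c ac.
have oc := branch_oi pm ac.
have STx x : c x -> S x = T x by move=> cx; apply: ST; rewrite inE.
have GT x : c x -> G (T x) = x.
  by move=> cx; rewrite -STx// SG// inE; exact: subset_closure.
exists S, G; split; [by []|by []| |].
- by move=> y; rewrite inE => -[x cx <-]; rewrite GT// (branchK pm ac).
have nST x : c x -> \forall z \near x, S z = T z.
  by move=> cx; have := nbhs_open_interval oc cx; apply: filterS => z; exact: STx.
have dT x : c x -> is_derive x 1 T (derive1 S x).
  move=> cx; apply: (near_eq_is_derive (nST x cx)).
  by rewrite derive1E; apply: DeriveDef => //; have [] := C2S.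
have dTE x : c x -> derive1 T x = derive1 S x.
  by move=> cx; rewrite derive1E; exact: (@derive_val _ _ _ _ _ _ _ (dT x cx)).
move=> x cx; split; first exact: dTE.
- rewrite !derive1E; apply: near_eq_derive.
  by have := nbhs_open_interval oc cx; apply: filterS => z; exact: dTE.
- exact: (@ex_derive _ _ _ _ _ _ _ (dT x cx)).
have dS : is_derive x 1 S (derive1 S x).
  by rewrite derive1E; apply: DeriveDef => //; have [] := C2S.
have dG : is_derive (S x) 1 G (derive1 G (S x)).
  by rewrite derive1E; apply: DeriveDef => //; have [] := C2G.
have dGS := is_derive1_comp dG dS.
have did : is_derive x 1 (G \o S) 1.
  apply: (near_eq_is_derive _ (is_derive_id x (1 : R))).
  have := nbhs_open_interval oc cx; apply: filterS => z cz /=.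
  by rewrite SG// inE; exact: subset_closure.
rewrite -STx//.
by rewrite -(@derive_val _ _ _ _ _ _ _ dGS) (@derive_val _ _ _ _ _ _ _ did).
Qed.

(** Differentiating G'(T x) S'(x) = 1 once more gives G''(T x) = - G'(T x) S''(x) / S'(x)^2, so (A)
    becomes |G''| <= D |G'|: the logarithm of |G'| is Lipschitz. *)
Lemma afu_distortion : exists2 D : R, 0 <= D & forall c, alpha c ->
  forall y y', (T @` c) y -> (T @` c) y' ->
  0 < `|derive1 (inv_branch T c) y| <=
    `|derive1 (inv_branch T c) y'| * expR (D * `|y - y'|).
Proof.
have [D D0 HD] := condA_ex; exists D => // c ac.
have [S [G [[dS ddS _] [dG ddG _] vG HG]]] := afu_branch ac.
have oT := branch_image_oi pm ac (@subset_refl _ c) (branch_oi pm ac).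
have dv y : (T @` c) y -> derive1 (inv_branch T c) y = derive1 G y.
  move=> Ty; rewrite !derive1E; apply: near_eq_derive.
  by have := nbhs_open_interval oT Ty; apply: filterS => z Tz; apply: vG; rewrite inE.
have G0 y : (T @` c) y -> derive1 G y != 0.
  move=> [x cx <-]; have [_ _ _ E] := HG x cx; apply/eqP => G0.
  by move: E; rewrite G0 mul0r => /esym/eqP; rewrite oner_eq0.
have ddGE x : c x -> derive1 (derive1 G) (T x) =
    - derive1 G (T x) * (derive1 (derive1 S) x / (derive1 S x) ^+ 2).
  move=> cx; have [_ _ dTx E] := HG x cx.
  have S0 : derive1 S x != 0.
    by apply/eqP => S0; move: E; rewrite S0 mulr0 => /esym/eqP; rewrite oner_eq0.
  have dT' : is_derive x 1 T (derive1 S x).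
    by have [TS _ _ _] := HG x cx; rewrite -TS derive1E; apply: DeriveDef.
  have dG' : is_derive (T x) 1 (derive1 G) (derive1 (derive1 G) (T x)).
    by apply: DeriveDef; rewrite -?derive1E.
  have dS' : is_derive x 1 (derive1 S) (derive1 (derive1 S) x).
    by apply: DeriveDef; rewrite -?derive1E.
  have dP := is_deriveM (is_derive1_comp dG' dT') dS'.
  have d1 : is_derive x 1 ((derive1 G \o T) * derive1 S) 0.
    apply: (near_eq_is_derive _ (is_derive_cst (1 : R) x 1)).
    have := nbhs_open_interval (branch_oi pm ac) cx; apply: filterS => z cz /=.
    by have [_ _ _ <-] := HG z cz.
  have := @derive_val _ _ _ _ _ _ _ dP; rewrite (@derive_val _ _ _ _ _ _ _ d1) /=.
  rewrite /GRing.scale /=.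
  move: (derive1 G (T x)) (derive1 (derive1 G) (T x)) (derive1 (derive1 S) x) => g g' s2.
  move: (derive1 S x) S0 => s S0 eq0.
  have S2 : s ^+ 2 != 0 by rewrite expf_neq0.
  apply: (mulIf S2); rewrite -mulrA divfK//.
  by apply/eqP; rewrite -subr_eq0 mulNr opprK; apply/eqP; rewrite [RHS]eq0; ring.
have ddG_le y : (T @` c) y -> `|derive1 (derive1 G) y| <= D * `|derive1 G y|.
  move=> [x cx <-]; rewrite ddGE// normrM normrN mulrC ler_wpM2r//.
  have [T1 T2 _ E] := HG x cx.
  have S0 : derive1 S x != 0.
    by apply/eqP => S0; move: E; rewrite S0 mulr0 => /esym/eqP; rewrite oner_eq0.
  have /HD : (\bigcup_(c in alpha) c) x by exists c.
  rewrite T1 T2; move: (derive1 S x) (derive1 (derive1 S) x) S0 => s s2 s0.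
  case=> [H|/eqP]; last by rewrite (negbTE s0).
  have ss : 0 < s ^+ 2 by rewrite lt0r sqr_ge0 sqrf_eq0 s0.
  by rewrite normrM normfV (gtr0_norm ss) ler_pdivrMr.
move=> y y' Ty Ty'; rewrite !dv// normr_gt0 G0//=.
(* [log_lipschitz] wants a positive differentiable function, so it is applied to the square of G',
   with constant 2 * D. *)
have dsq z : (T @` c) z -> is_derive z 1 (derive1 G * derive1 G)
    (derive1 G z * derive1 (derive1 G) z + derive1 G z * derive1 (derive1 G) z).
  move=> _; have dG' : is_derive z 1 (derive1 G) (derive1 (derive1 G) z).
    by apply: DeriveDef; rewrite -?derive1E.
  exact: is_deriveM.
rewrite -(@ler_pXn2r _ 2)// ?nnegrE ?mulr_ge0 ?expR_ge0//.
rewrite exprMn !real_normK ?num_real// -expRM_natl mulrA !expr2.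
apply: (log_lipschitz (open_interval_convex oT) dsq) => // z Tz /=.
  by rewrite -expr2 lt0r sqr_ge0 sqrf_eq0 G0.
have -> : (derive1 G * derive1 G) z = `|derive1 G z| * `|derive1 G z|.
  by rewrite -normrM ger0_norm// -expr2 sqr_ge0.
have := ddG_le z Tz; rewrite -mulr2n normrMn normrM.
move: `|derive1 G z| `|derive1 (derive1 G) z| (normr_ge0 (derive1 G z)) => u v u0 H.
by rewrite -[_ *+ 2]mulr_natl -mulrA ler_wpM2l// mulrCA ler_wpM2l.
Qed.

End AdlerDistortion.

Section DistortionBounds.
Context {R : realType}.
Local Notation MR := (measurableTypeR R).
Local Notation mu := (@lebesgue_measure R).
Variables (E G : set R) (f : R -> R) (D delta c : R).
Hypotheses (iE : is_interval E) (EX : E `<=` X) (D0 : 0 <= D).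
Hypothesis Gae : \forall x \ae mu, X x -> G x.
Hypotheses (mf : measurable_fun [set: MR] f) (f0 : forall x, 0 <= f x).
Hypothesis fD : forall y y', (E `&` G) y -> (E `&` G) y' ->
  f y <= f y' * expR (D * `|y - y'|).
Hypothesis fI : (\int[mu]_x (f x)%:E <= c%:E)%E.
Hypotheses (d0 : 0 < delta) (dE : (delta%:E <= m E)%E).

Let dist1 (x y : R) : X x -> X y -> `|x - y| <= 1.
Proof. by rewrite !XE ler_norml; lra. Qed.

(** Integrate f y <= e^D f x over x in [E], whose measure is at least [delta]; distances in X are at
    most 1. *)
Lemma distortion_sup y : (E `&` G) y -> f y <= expR D * (c / delta).
Proof.
move=> Ey; have mE' : measurable (E : set MR) by exact: is_interval_measurable.
suff : ((f y)%:E * m E <= (expR D * c)%:E)%E.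
  have dm : (f y * delta)%:E = ((f y)%:E * delta%:E)%E by [].
  move=> H; rewrite mulrA ler_pdivlMr// -lee_fin dm; apply: le_trans H.
  by rewrite lee_wpmul2l// lee_fin.
rewrite mE setIidl//.
have -> : ((f y)%:E * mu E = \int[mu]_(x in E) (f y)%:E)%E by rewrite integral_cst.
apply: (@le_trans _ _ (\int[mu]_(x in E) ((expR D)%:E * (f x)%:E))%E).
  apply: ae_ge0_le_integral => //.
  - by move=> x _ /=; rewrite lee_fin.
  - by move=> x _; rewrite -EFinM lee_fin mulr_ge0 ?expR_ge0.
  - apply/measurable_EFinP; apply: measurable_funM; first exact: measurable_cst.
    exact: measurable_funTS.
  apply: aeS Gae => x Gx Ex; rewrite -EFinM lee_fin /=.
  have EGx : (E `&` G) x by split => //; exact: Gx (EX Ex).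
  apply: le_trans (fD Ey EGx) _; rewrite mulrC ler_wpM2r// ler_expR.
  by rewrite ler_piMr// dist1//; apply: EX => //; case: Ey.
rewrite ge0_integralZl_EFin ?expR_ge0//; last 2 first.
- by move=> x _; rewrite lee_fin.
- by apply/measurable_EFinP; exact: measurable_funTS.
rewrite EFinM lee_wpmul2l ?lee_fin ?expR_ge0//; apply: le_trans fI.
apply: ge0_subset_integral => //; last by move=> x _; rewrite lee_fin.
exact/measurable_EFinP.
Qed.

Hypothesis GX : G `<=` X.
Hypothesis fout : forall x, ~ E x -> f x = 0.

(** The increments of [phi] dominate those of [f]: its linear part handles pairs inside [E], its two
    unit jumps, each worth the supremum bound [S], the entrance into [E] and the exit from it. These
    account for [D * expR D] and for 2 in the constant. *)
Lemma distortion_lvar t : sorted <%O t -> list_in G t ->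
  lvar (absd f) t <= (2 + D * expR D) * (expR D * (c / delta)).
Proof.
set S := expR D * _; move=> st tG.
have [[e Ee]|noE] := pselect (E !=set0); last first.
  suff : (m E <= 0)%E by move=> mE0; have := le_trans dE mE0; rewrite lee_fin leNgt d0.
  by rewrite (_ : E = set0) ?measure0//; apply/seteqP; split=> x // Ex; case: noE; exists x.
have S0 : 0 <= S.
  have c0 : 0 <= c by rewrite -lee_fin (le_trans _ fI)// integral_ge0// => x _; rewrite lee_fin.
  by rewrite mulr_ge0 ?expR_ge0// divr_ge0// ltW.
pose A x := `[< exists2 z, E z & z <= x >].
pose B x := A x && ~~ `[< E x >].
pose phi (x : R) : R := S * (D * expR D * x + (A x)%:R + (B x)%:R).
have fS y : G y -> f y <= S.
  move=> Gy; have [Ey|nE] := pselect (E y); first exact: distortion_sup.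
  by rewrite fout.
have AE y : E y -> A y by move=> Ey; apply/asboolP; exists y.
have A_mono y z : y < z -> A y -> A z.
  by move=> yz /asboolP[u Eu uy]; apply/asboolP; exists u => //; rewrite (le_trans uy)// ltW.
have De : 0 <= D * expR D by rewrite mulr_ge0// expR_ge0.
have step y z : G y -> G z -> y < z -> absd f y z <= phi z - phi y.
  move=> Gy Gz yz; rewrite /absd /phi -mulrBr.
  have hcl : 0 <= D * expR D * (z - y) by rewrite mulr_ge0// subr_ge0 ltW.
  have [Ey|nEy] := pselect (E y); have [Ez|nEz] := pselect (E z).
  - rewrite /B !AE//= !(asboolT Ey) !(asboolT Ez) /=.
    have key u u' : E u -> G u -> E u' -> G u' -> f u - f u' <= S * (D * expR D * `|u - u'|).
      move=> Eu Gu Eu' Gu'; have := fD (conj Eu Gu) (conj Eu' Gu').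
      have d1 := dist1 (EX Eu) (EX Eu').
      set k := D * `|u - u'| => H.
      have k0 : 0 <= k by rewrite mulr_ge0.
      have kD : k <= D by rewrite ler_piMr.
      (* From 1 - k <= e^(-k) one gets e^k - 1 <= k e^k, and k <= D. *)
      have e1 : expR k - 1 <= k * expR D.
        have := expR_ge1Dx (- k); rewrite expRN => h.
        have : (1 - k) * expR k <= 1 by rewrite -ler_pdivlMr ?expR_gt0// div1r.
        have : k * expR k <= k * expR D by rewrite ler_wpM2l// ler_expR.
        lra.
      apply: (@le_trans _ _ (f u' * (expR k - 1))); first by lra.
      apply: (@le_trans _ _ (S * (expR k - 1))).
        by rewrite ler_wpM2r ?fS// subr_ge0 -expR0 ler_expR.
      by rewrite ler_wpM2l// (le_trans e1)// mulrAC -/k.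
    have := key y z Ey Gy Ez Gz; have := key z y Ez Gz Ey Gy.
    rewrite (distrC y z) (gtr0_norm (_ : 0 < z - y)) ?subr_gt0// ler_norml => k1 k2.
    by apply/andP; split; nra.
  - rewrite (fout nEz) sub0r normrN ger0_norm// (le_trans (fS _ Gy))//.
    rewrite /B (A_mono _ _ yz (AE _ Ey)) (AE _ Ey) (asboolT Ey) (asboolF nEz) /=.
    by rewrite ler_peMr//; lra.
  - have nAy : A y = false.
      apply/negbTE/negP => /asboolP[u Eu uy]; apply: nEy.
      by apply: (iE Eu Ez); rewrite uy ltW.
    rewrite (fout nEy) subr0 ger0_norm// (le_trans (fS _ Gz))//.
    rewrite /B nAy (AE _ Ez) (asboolT Ez) /=.
    by rewrite ler_peMr//; lra.
  - rewrite (fout nEy) (fout nEz) subrr normr0 mulr_ge0//.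
    rewrite /B (asboolF nEy) (asboolF nEz) !andbT.
    have := A_mono _ _ yz; case: (A y) (A z) => [] [] //=; lra.
case: t st tG => [|x t] st tG; first by rewrite /= mulr_ge0// addr_ge0.
apply: le_trans (lvar_monotone (f := phi) st _) _.
  by move=> y z yt zt yz; apply: step => //; exact: tG.
rewrite /phi -mulrBr mulrC ler_wpM2r//.
have : X x by apply: GX; apply: tG; rewrite mem_head.
have : X (last x t) by apply: GX; apply: tG; rewrite mem_last.
rewrite !XE; move: (last x t) => u' /andP[? ?] /andP[? ?].
have : D * expR D * u' <= D * expR D by rewrite ler_piMr.
have : 0 <= D * expR D * x by rewrite mulr_ge0.
by case: (A x) (A u') (B x) (B u') => [] [] [] [] /=; lra.
Qed.

End DistortionBounds.

Lemma m_fin (R : realType) (A : set R) : measurable (A : set (measurableTypeR R)) ->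
  m A \is a fin_num.
Proof.
move=> mA; rewrite ge0_fin_numE//; apply: (@le_lt_trans _ _ (m X)); last by rewrite m_X ltry.
rewrite !mE setIid; apply: le_measure; last by move=> x [].
  by rewrite inE; exact: (measurableI _ _ mA mX).
by rewrite inE; exact: mX.
Qed.

Section AdlerWords.
Context {R : realType}.
Local Notation MR := (measurableTypeR R).
Local Notation mu := (@lebesgue_measure R).
Variables (T : R -> R) (alpha : set (set R)) (a : nat -> set R) (w : nat -> R -> R).
Hypothesis bs : branch_system T alpha a w.
Local Notation v i := (inv_branch T (a i)).
Local Notation cyl := (cylinder T a).
Local Notation img := (cylinder_image T a).

Lemma cylinder_image_consP i b y :
  img (i :: b) y <-> (T @` a i) y /\ img b (v i y).
Proof.
rewrite cylinder_image_cons; split.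
  by move=> [x [bx ax] <-]; split; [exists x|rewrite (sys_branchK bs)].
by move=> [Ty bv]; have [av Tv] := branchP Ty; exists (v i y).
Qed.

Lemma m_words_union L k : uniq L -> {in L, forall b, size b = k} ->
  fine (m (words_union T a L)) = \sum_(b <- L) fine (m (cyl b)).
Proof.
elim: L => [|b L IH] /=.
  move=> _ _; rewrite big_nil /words_union (_ : [set` [::]] = set0); last by apply/seteqP; split.
  by rewrite bigcup_set0 measure0.
move=> /andP[bL uL] sL.
have sL' : {in L, forall b, size b = k} by move=> c cL; apply: sL; rewrite inE cL orbT.
rewrite big_cons -IH//.
have -> : words_union T a (b :: L) = cyl b `|` words_union T a L.
  apply/seteqP; split=> x.
    by move=> [c /=]; rewrite inE => /predU1P[-> ?|cL cx]; [left|right; exists c].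
  by move=> [bx|[c cL cx]]; [exists b => //=; rewrite mem_head|exists c => //=; rewrite inE cL orbT].
have mL := measurable_words_union bs L; have mb := measurable_cylinder bs b.
rewrite -fineD ?m_fin//; congr fine; apply: measureU => //.
apply/seteqP; split=> x // -[bx [c cL cx]].
suff /eqP : b = c by apply/negP; apply: contraNneq bL => ->.
by apply: (cylinder_disj bs) bx cx; rewrite !sL ?mem_head// inE cL orbT.
Qed.

Lemma afu_letters : afu_map T alpha -> exists (D : R) (q : nat -> R -> R),
  [/\ 0 <= D, forall i, \forall x \ae mu, w i x = q i x &
    forall i y y', (T @` a i) y -> (T @` a i) y' ->
      0 < q i y <= q i y' * expR (D * `|y - y'|)].
Proof.
move=> afu; have [D D0 HD] := afu_distortion afu.
exists D, (fun i y => if `[< (T @` a i) y >] then `|derive1 (v i) y| else 0); split => //.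
  move=> i; have [E|ai] := bs_mem bs i.
    have [_ _ wout _] := bs_density bs i.
    by apply: aeW => x; rewrite wout; [case: asboolP => //; rewrite E image_set0|rewrite E image_set0].
  have [s os] := branch_density_derive (bs_pm bs) ai (bs_density bs i).
  apply: aeS => y H; have [_ w0 wout _] := bs_density bs i.
  case: asboolP => [Ty|/wout//]; have [_ ->] := H Ty.
  by rewrite (oriented_norm _ os) ger0_norm.
move=> i y y' Ty Ty'; rewrite !asboolT//; apply: HD => //.
by have [E|//] := bs_mem bs i; rewrite E image_set0 in Ty.
Qed.

Variable G : set R.
Hypotheses (GX : G `<=` X) (aeG : \forall x \ae mu, X x -> G x).
Hypothesis Gv : forall i y, G y -> w i y != 0 -> G (v i y).
Variables (D th delta : R).
Hypotheses (D0 : 0 <= D) (th1 : th < 1) (d0 : 0 < delta).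
Hypothesis wD : forall i y y', (G `&` T @` a i) y -> (G `&` T @` a i) y' ->
  0 < w i y <= w i y' * expR (D * `|y - y'|).
Hypothesis v_lip : forall i y z, (T @` a i) y -> (T @` a i) z ->
  `|v i z - v i y| <= th * `|z - y|.
Hypothesis img_ge : forall b, (0 < size b)%N -> cyl b !=set0 ->
  (delta%:E <= m (img b))%E.
Local Notation W := (word_transfer T a w (\1_X)).
Local Notation D' := (D / (1 - th)).

Lemma branch_good i y : G y -> (T @` a i) y -> G (v i y).
Proof.
move=> Gy Ty; apply: Gv => //.
by have /andP[/lt0r_neq0] := wD (conj Gy Ty) (conj Gy Ty).
Qed.

Lemma word_neq0 b y : G y -> W b y != 0 <-> img b y.
Proof.
elim: b y => [|i b IH] y Gy.
  split => [_|_]; first by exists y => //; exact: GX.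
  by rewrite /= indicE mem_set ?oner_eq0//; exact: GX.
rewrite cylinder_image_consP /= mulf_eq0 negb_or; split.
  move=> /andP[wy Wy]; have Ty := sys_w_out bs wy.
  by split => //; apply/IH => //; exact: branch_good.
move=> [Ty bv]; have /andP[/lt0r_neq0 -> _] := wD (conj Gy Ty) (conj Gy Ty).
by apply/IH => //; exact: branch_good.
Qed.

(** [D'] solves D' = D + th * D': the outer letter contributes D, and its inverse branch shrinks by
    [th] the distance seen by the remaining word. *)
Lemma word_distortion b y y' : (img b `&` G) y -> (img b `&` G) y' ->
  W b y <= W b y' * expR (D' * `|y - y'|).
Proof.
have th2 : 0 < 1 - th by rewrite subr_gt0.
have D'0 : 0 <= D' by rewrite divr_ge0// ltW.
elim: b y y' => [|i b IH] y y' [by_ Gy] [by' Gy'] /=.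
  rewrite !indicE !mem_set ?mul1r; [|exact: GX|exact: GX].
  by rewrite -[leLHS]expR0 ler_expR mulr_ge0.
move: by_ by' => /cylinder_image_consP[Ty bv] /cylinder_image_consP[Ty' bv'].
have {}IH := IH _ _ (conj bv (branch_good Gy Ty)) (conj bv' (branch_good Gy' Ty')).
have W0 z : 0 <= W b z by apply: (word_transfer_ge0 bs) => u; rewrite indicE.
have /andP[w0 wy] := wD (conj Gy Ty) (conj Gy' Ty').
have /andP[w0' _] := wD (conj Gy' Ty') (conj Gy Ty).
apply: le_trans (ler_pM (ltW w0) (W0 _) wy IH) _.
rewrite mulrACA -expRD ler_wpM2l ?mulr_ge0 ?(ltW w0')// ler_expR.
have := v_lip Ty' Ty; move: `|_ - _| `|_ - _| (normr_ge0 (y - y')) => d e e0 de.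
have -> : D' * e = D * e + D' * (th * e).
  by field; rewrite gt_eqF.
by rewrite lerD2l ler_wpM2l.
Qed.

Lemma integral_word b : (\int[mu]_x (W b x)%:E = mu (cyl b))%E.
Proof.
have m1 : measurable_fun [set: MR] (\1_X : R -> R) by exact: measurable_indic mX.
have p1 (x : R) : 0 <= (\1_X x : R) by rewrite indicE.
have o1 (x : R) : ~ X x -> \1_X x = 0 :> R by move=> nX; rewrite indicE memNset.
have := integral_word_transfer bs m1 p1 o1 b (u := cst 1%E).
rewrite (_ : (fun x => _ * cst 1 x)%E = (fun x => (W b x)%:E)); last by apply/funext => x; rewrite mule1.
move=> ->//.
transitivity (\int[mu]_(x in cyl b) (cst 1%E x))%E.
  apply: eq_integral => x; rewrite inE => /cylinder_subX Xx.
  by rewrite indicE mem_set// mule1.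
by rewrite integral_cst ?mul1e//; exact: (measurable_cylinder bs).
Qed.

Let mW b : measurable_fun [set: MR] (W b).
Proof. by apply: (measurable_word_transfer bs); exact: measurable_indic mX. Qed.

Let W0 b z : 0 <= W b z.
Proof. by apply: (word_transfer_ge0 bs) => u; rewrite indicE. Qed.

Let cylfin b : mu (cyl b) = (fine (m (cyl b)))%:E.
Proof.
rewrite -[LHS](_ : m (cyl b) = _); last by rewrite mE setIidl//; exact: cylinder_subX.
by rewrite fineK// m_fin//; exact: (measurable_cylinder bs).
Qed.

Let Dp : 0 <= D'. Proof. by rewrite divr_ge0// subr_ge0 ltW. Qed.

Lemma word_sup b y : (0 < size b)%N -> G y ->
  W b y <= expR D' * (fine (m (cyl b)) / delta).
Proof.
move=> b0 Gy; have [by_|nby] := pselect (img b y); last first.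
  have /eqP -> : W b y == 0 by apply/negbNE/negP => /(word_neq0 b Gy).
  by rewrite mulr_ge0 ?expR_ge0// divr_ge0 ?fine_ge0// ltW.
have iE := cylinder_image_interval bs (b := b).
have EX := @cylinder_image_subX _ T alpha a w bs b.
have I : (\int[mu]_x (W b x)%:E <= (fine (m (cyl b)))%:E)%E by rewrite integral_word cylfin.
apply: (distortion_sup iE EX Dp aeG (mW b) (W0 b) (@word_distortion b) I d0) => //.
by apply: img_ge => //; have [x bx _] := by_; exists x.
Qed.

Lemma word_lvar b t : (0 < size b)%N -> sorted <%O t -> list_in G t ->
  lvar (absd (W b)) t <=
    (2 + D' * expR D') * (expR D' * (fine (m (cyl b)) / delta)).
Proof.
(* [distortion_lvar] needs a function vanishing at every point off the image, and [W b] is known to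
   do so on [G] only; hence the cut-off. *)
move=> b0 st tG; pose f x := if `[< img b x >] then W b x else 0.
have fW : {in G, f =1 W b}.
  move=> x; rewrite inE => Gx; rewrite /f; case: asboolP => // nbx.
  by apply/esym/eqP/negbNE/negP => /(word_neq0 b Gx).
rewrite -(@eq_in_lvar _ f); last by move=> x /tG Gx; apply: fW; rewrite inE.
have iE := cylinder_image_interval bs (b := b).
have EX := @cylinder_image_subX _ T alpha a w bs b.
have f0 x : 0 <= f x by rewrite /f; case: ifP.
have mf : measurable_fun [set: MR] f.
  rewrite (_ : f = fun x => W b x * \1_(img b) x); last first.
    apply/funext => x; rewrite /f indicE; case: asboolP => bx.
      by rewrite mem_set// mulr1.
    by rewrite memNset// mulr0.
  by apply: measurable_funM => //; apply: measurable_indic; exact: is_interval_measurable.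
have [[x bx]|nb] := pselect (cyl b !=set0); last first.
  rewrite lvar_eq0; last first.
    by move=> x _; rewrite /f; case: asboolP => // -[z bz _]; case: nb; exists z.
  apply: mulr_ge0; first by rewrite addr_ge0// mulr_ge0 ?expR_ge0.
  by rewrite mulr_ge0 ?expR_ge0// divr_ge0 ?fine_ge0// ltW.
have I : (\int[mu]_x (f x)%:E <= (fine (m (cyl b)))%:E)%E.
  rewrite -cylfin -integral_word; apply: ge0_le_integral => //.
  - by move=> z _; rewrite lee_fin.
  - exact/measurable_EFinP.
  - exact/measurable_EFinP.
  - by move=> z _; rewrite lee_fin /f; case: ifP.
have fD y y' : (img b `&` G) y -> (img b `&` G) y' ->
    f y <= f y' * expR (D' * `|y - y'|).
  by move=> [by_ Gy] [by' Gy']; rewrite /f !asboolT//; exact: word_distortion.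
apply: (distortion_lvar iE EX Dp aeG mf f0 fD I d0) => //.
- by apply: img_ge => //; exists x.
- by move=> z nz; rewrite /f asboolF.
Qed.

Fixpoint inv_word (b : seq nat) : R -> R :=
  if b is i :: b' then inv_word b' \o v i else id.

Lemma word_transferE (h : R -> R) b y : G y ->
  word_transfer T a w h b y = W b y * h (inv_word b y).
Proof.
elim: b y => [|i b IH] y Gy /=; first by rewrite indicE mem_set ?mul1r//; exact: GX.
have [->|wy] := eqVneq (w i y) 0; first by rewrite !mul0r.
by rewrite IH ?mulrA//; exact: Gv.
Qed.

Lemma inv_word_good b y : G y -> W b y != 0 -> G (inv_word b y).
Proof.
elim: b y => [|i b IH] y Gy //=; rewrite mulf_eq0 negb_or => /andP[wy Wy].
by apply: IH => //; exact: Gv.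
Qed.

(** Inverse branches are monotone, so composing with them one letter at a time does not increase
    variation; pairs with a point of zero weight are left out. *)
Lemma inv_word_lvar (h : R -> R) V b t :
  (forall t, sorted <%O t -> list_in G t -> lvar (absd h) t <= V) ->
  sorted <%O t -> list_in G t ->
  lvar (restrd (fun y => W b y != 0) (absd (h \o inv_word b))) t <= V.
Proof.
move=> hV; elim: b t => [|i b IH] t st tG.
  apply: le_trans (hV t st tG); apply: lvar_le => // x y _ _ _.
  by rewrite /restrd; case: ifP => //= _; exact: normr_ge0.
have [t' [st' tG' tE]] := pull_list bs Gv i st tG.
have tG2 : list_in G t' by move=> x /tG'[].
apply: le_trans (IH t' st' tG2).
rewrite tE; last by move=> x y; rewrite /restrd andbC /absd distrC.
rewrite lvar_map; apply: le_trans (lvar_filter_ge _ _ _); last first.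
  by move=> x y; rewrite /restrd; case: ifP => // _; exact: normr_ge0.
apply: lvar_le => // x y _ _ _; rewrite /restrd /= !mulf_eq0 !negb_or.
by case: (w i x != 0) (w i y != 0) => [] []; rewrite //= ?andbF.
Qed.

Lemma word_transfer_lvar (h : R -> R) M V b t : 0 <= M -> (forall x, 0 <= h x) ->
  (forall x, G x -> h x <= M) ->
  (forall t, sorted <%O t -> list_in G t -> lvar (absd h) t <= V) ->
  (0 < size b)%N -> sorted <%O t -> list_in G t ->
  lvar (absd (word_transfer T a w h b)) t <=
    expR D' / delta * (V + (2 + D' * expR D') * M) * fine (m (cyl b)).
Proof.
move=> M0 h0 hM hV b0 st tG; set c := fine _.
pose S := expR D' * (c / delta).
have S0 : 0 <= S by rewrite mulr_ge0 ?expR_ge0// divr_ge0 ?fine_ge0// ltW.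
have -> : expR D' / delta * (V + (2 + D' * expR D') * M) * c =
    S * V + M * ((2 + D' * expR D') * S) by rewrite /S; ring.
apply: (@le_trans _ _ (lvar (fun x y =>
    S * restrd (fun y => W b y != 0) (absd (h \o inv_word b)) x y
    + M * absd (W b) x y) t)).
  apply: lvar_le => // x y xt yt _; have [Gx Gy] := (tG _ xt, tG _ yt).
  have WS z : G z -> 0 <= W b z <= S by move=> Gz; rewrite W0 word_sup.
  have := @transfer_pair_le _ _ [:: tt] (fun _ => h) (W b) (inv_word b) S M x y
    M0 (WS _ Gx) (WS _ Gy).
  rewrite !big_seq1 /absd (word_transferE h b Gx) (word_transferE h b Gy) => H.
  apply: le_trans (H _ _ _) _.
  - by [].
  - by move=> wx; apply: hM; exact: inv_word_good.
  - by move=> wy; apply: hM; exact: inv_word_good.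
  - by rewrite /restrd big_seq1.
rewrite lvarD !lvarZ; apply: lerD; rewrite ler_wpM2l//.
  exact: inv_word_lvar.
exact: word_lvar.
Qed.

Lemma word_transfer_le (h : R -> R) M b x : (forall x, 0 <= h x) ->
  (forall x, G x -> h x <= M) -> (0 < size b)%N -> G x ->
  word_transfer T a w h b x <= expR D' / delta * M * fine (m (cyl b)).
Proof.
move=> h0 hM b0 Gx; rewrite (word_transferE h b Gx).
have [W_0|W_n0] := eqVneq (W b x) 0.
  rewrite W_0 mul0r !mulr_ge0 ?expR_ge0 ?fine_ge0 ?invr_ge0 ?(ltW d0)//.
  exact: le_trans (h0 x) (hM x Gx).
rewrite [leRHS](_ : _ = expR D' * (fine (m (cyl b)) / delta) * M); last by ring.
by apply: ler_pM => //; [exact: word_sup|exact: hM (inv_word_good Gx W_n0)].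
Qed.

Lemma words_BVnorm (h : R -> R) M V L k : 0 <= M -> (forall x, 0 <= h x) ->
  (forall x, G x -> h x <= M) ->
  (forall t, sorted <%O t -> list_in G t -> lvar (absd h) t <= V) ->
  (0 < k)%N -> uniq L -> {in L, forall b, size b = k} ->
  (BVnorm (fun x => \sum_(b <- L) word_transfer T a w h b x)%R <=
    (expR D' / delta * (2 * V + (7 + 2 * (D' * expR D')) * M)
      * fine (m (words_union T a L)))%:E)%E.
Proof.
move=> M0 h0 hM hV k0 uL sL.
rewrite (m_words_union uL sL).
set S := \sum_(b <- L) _.
(* 2 and 3 are the coefficients in [BVnorm_le], whence 7 = 2 * 2 + 3 in the statement. *)
rewrite (_ : _ * S = 2 * (expR D' / delta * (V + (2 + D' * expR D') * M) * S)
  + 3 * (expR D' / delta * M * S)); last by ring.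
apply: (BVnorm_le aeG); last exact: conull_neq0 aeG.
- move=> x Gx; rewrite ger0_norm; last first.
    by apply: sumr_ge0 => b _; exact: (word_transfer_ge0 bs h0).
  rewrite /S mulr_sumr big_seq [leRHS]big_seq; apply: ler_sum => b bL.
  by apply: word_transfer_le => //; rewrite sL.
- move=> t st tG; rewrite /S mulr_sumr.
  apply: (@le_trans _ _ (\sum_(b <- L) lvar (absd (word_transfer T a w h b)) t)).
    rewrite -lvar_sum; apply: lvar_le => // x y _ _ _.
    by rewrite /absd -sumrB; exact: ler_norm_sum.
  rewrite big_seq [leRHS]big_seq; apply: ler_sum => b bL.
  by apply: word_transfer_lvar => //; rewrite sL.
Qed.

End AdlerWords.

(** * Positivity of h for basic maps *)

Section DensityPositivity.
Context {R : realType}.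
Local Notation MR := (measurableTypeR R).
Local Notation mu := (@lebesgue_measure R).
Variables (T : R -> R) (alpha : set (set R)).
Hypothesis pm : pm_map T alpha.
Variables (P : probability MR R) (h : R -> R).
Hypotheses (acP : ac_invariant T P) (dP : density P h).

Lemma P_X1 : P (X : set MR) = 1%E.
Proof.
have := probability_setC P (measurableC mX); rewrite setCK => ->.
by rewrite (P_XC acP) sube0.
Qed.

Lemma density_null (E : set R) : borelX E -> (forall x, E x -> 0 < h x) -> P E = 0%E ->
  m E = 0%E.
Proof.
move=> [mE' EX] h0 PE; have [mh _ hE] := dP.
have mhE : measurable_fun (E : set MR) (EFin \o h).
  by apply/measurable_EFinP; exact: measurable_funS mX EX mh.
have I0 : (\int[mu]_(x in E) `|(EFin \o h) x| = 0)%E.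
  rewrite -PE hE// ge0_integral_mX//; apply: eq_integral => x; rewrite inE => /h0 hx.
  by rewrite gee0_abs// lee_fin ltW.
have [N [mN N0 HN]] := (ae_eq_integral_abs mu mE' mhE).1 I0.
apply/eqP; rewrite eq_le measure_ge0 andbT -N0 mE setIidl//.
apply: le_measure; rewrite ?inE// => x Ex; apply: HN => /= /(_ Ex) [hx0].
by have := h0 x Ex; rewrite hx0 ltxx.
Qed.

Lemma density_pos_null (E : set R) : (\forall x \ae mu, X x -> 0 < h x) ->
  borelX E -> P E = 0%E -> m E = 0%E.
Proof.
move=> [N [mN N0 HN]] [mE' EX] PE.
have bE : borelX (E `\` N) by split; [exact: measurableD|move=> x [/EX]].
have m0 : m (E `\` N) = 0%E.
  apply: (density_null bE).
    by move=> x [Ex nN]; apply: contrapT => nh; apply: nN; apply: HN => /= /(_ (EX _ Ex)).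
  apply/eqP; rewrite eq_le measure_ge0 andbT -PE; apply: le_measure; rewrite ?inE//.
  exact: bE.1.
have mNX : measurable (N `&` X : set MR) := measurableI _ _ mN mX.
apply/eqP; rewrite eq_le measure_ge0 andbT.
have : (m (E `\` N `|` N `&` X) <= m (E `\` N) + m (N `&` X))%E.
  by apply: measureU2 => //; exact: bE.1.
have mNX0 : (m (N `&` X) <= 0)%E 
  by rewrite m_setIX -N0 mE; apply: le_measure; rewrite ?inE// => x [].
rewrite m0 add0e => H; apply: le_trans (le_trans H mNX0).
rewrite !mE; apply: le_measure; rewrite ?inE.
- exact: (measurableI _ _ mE' mX).
- by apply: (measurableI _ _ _ mX); apply: measurableU => //; exact: bE.1.
- move=> x [Ex Xx]; split => //; have [Nx|nN] := pselect (N x); first by right.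
  by left.
Qed.

(** Let H be the set of points whose whole orbit stays in [h > 0]. It is forward invariant, so the
    points outside H that T sends into H form a wandering set, null by conservativity. Hence H is
    invariant modulo null sets, and by ergodicity it is null or conull; P(H) = 1 leaves the
    latter. *)
Lemma density_pos : conservative T -> ergodic T -> \forall x \ae mu, X x -> 0 < h x.
Proof.
move=> cT eT; have [mh h0 hE] := dP.
pose A : set R := X `&` h @^-1` `]0, +oo[.
have AP x : A x <-> X x /\ 0 < h x.
  by rewrite /A /= in_itv /= andbT.
have bA : borelX A.
  split; first exact: (mh mX _ (measurable_itv `]0, +oo[)).
  by move=> x [].
have bXA : borelX (X `\` A) by split; [exact: measurableD mX bA.1|move=> x []].
have PXA : P (X `\` A) = 0%E.
  rewrite hE// integral0_eq// => x [Xx nA]; congr (_%:E).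
  apply/eqP; rewrite eq_le h0// andbT leNgt; apply/negP => hx.
  by apply: nA; apply/AP.
pose H := \bigcap_n preX T n A.
have bH : borelX H.
  split; last by move=> x /(_ 0%N I)[].
  by apply: bigcap_measurable => // n _; exact: (borel_preX pm n bA).1.
have HT x : H x -> H (T x).
  move=> Hx n _; have [Xx Ax] := Hx n.+1 I.
  by split; [exact: (pm_self pm)|rewrite /= -iterSr].
have HTn n x : H x -> H (iter n T x) by move=> Hx; elim: n => // n /HT.
pose W := preX T 1 H `\` H.
have bW : borelX W.
  have b1 := borel_preX pm 1 bH.
  by split; [exact: measurableD b1.1 bH.1|move=> x [[]]].
have W0 : m W = 0%E.
  apply: cT => // i j _ _ [x [[Xx Wi] [_ Wj]]].
  wlog ij : i j Wi Wj / (i < j)%N.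
    by case: (ltngtP i j) => // ij; [exact|move=> /(_ j i Wj Wi ij)].
  have [_ nH] := Wj; case: nH.
  have [[_ H1] _] := Wi; have := HTn (j - i.+1)%N _ H1.
  by rewrite -iterS /= -iterS -iterD subnK.
have mH : m H = 0%E \/ m (X `\` H) = 0%E.
  apply: eT => //; rewrite /setY (_ : H `\` preX T 1 H = set0) ?setU0//.
  by apply/seteqP; split=> x // [Hx]; apply; split; [exact: bH.2|exact: HT].
have PXH : P (X `\` H) = 0%E.
  have : P.-negligible (\bigcup_n preX T n (X `\` A)).
    apply: negligible_bigcup => n; apply/negligibleP.
      exact: (borel_preX pm n bXA).1.
    by rewrite -PXA; exact: (P_preX pm acP n bXA).
  move=> [N [mN N0 HN]]; apply/eqP; rewrite eq_le measure_ge0 andbT -N0.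
  apply: le_measure; rewrite ?inE//; first exact: measurableD mX bH.1.
  move=> x [Xx nH]; apply: HN.
  have [n nA] : exists n, ~ preX T n A x.
    by apply/existsNP => Hx; apply: nH => n _.
  exists n => //; split => //; split; first exact: (pm_self_iter pm).
  by move=> Ax; apply: nA.
case: mH => [mH|mXH].
  have PH : P H = 0%E by have [/null_content_dominatesP dom _] := acP; apply: dom => //; have [] := bH.
  have : (P X <= P (H `|` (X `\` H)))%E.
    apply: le_measure; rewrite ?inE; [exact: mX| |].
      by apply: measurableU; [exact: bH.1|exact: measurableD mX bH.1].
    by move=> x Xx; have [?|?] := pselect (H x); [left|right].
  have := probabilityU2 P bH.1 (measurableD mX bH.1).
  by rewrite PH PXH adde0 => h1 h2; have := le_trans h2 h1; rewrite P_X1 lee_fin ler10.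
exists (X `\` H); split; first exact: measurableD mX bH.1.
  by rewrite -mXH mE setIidl// => x [].
move=> x /= /not_implyP[Xx nh]; split => // Hx; apply: nh.
by have [_ /AP[]] := Hx 0%N I.
Qed.

End DensityPositivity.

(** * Points near which h is small *)

Section LowSides.
Context {R : realType}.
Local Notation MR := (measurableTypeR R).
Local Notation mu := (@lebesgue_measure R).
Variables (G : set R) (h : R -> R).
Hypotheses (GX : G `<=` X) (aeG : \forall x \ae mu, X x -> G x).
Hypothesis h0 : forall x, G x -> 0 < h x.

Lemma conull_between x y : X x -> X y -> x < y -> exists2 z, G z & x < z < y.
Proof.
move=> Xx Xy xy; apply: contrapT => nz; have [N [mN N0 HN]] := aeG.
have sub : `]x, y[%classic `<=` N.
  move=> z /=; rewrite in_itv /= => xzy; apply: HN => /= Gz; apply: nz.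
  exists z => //; apply: Gz; move: Xx Xy; rewrite !XE; lra.
have : (mu `]x, y[%classic <= 0)%E by rewrite -N0; apply: le_measure; rewrite ?inE.
by rewrite lebesgue_measure_itv /= lte_fin xy -EFinB lee_fin leNgt subr_gt0 xy.
Qed.

Definition bounded_below_on (E : set R) := exists2 c, 0 < c & forall z, G z -> E z -> c <= h z.

Definition low_side (s x : R) := forall eta c, 0 < eta -> 0 < c ->
  exists y, [/\ G y, 0 < s * (y - x) < eta & h y < c].

Lemma not_low_side s x : ~ low_side s x -> exists eta c, [/\ 0 < eta, 0 < c &
  forall y, G y -> 0 < s * (y - x) < eta -> c <= h y].
Proof.
move=> /existsNP[eta /existsNP[c /not_implyP[eta0 /not_implyP[c0 H]]]].
exists eta, c; split => // y Gy xy; rewrite leNgt; apply/negP => hy; apply: H.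
by exists y.
Qed.

(** If no point had a low side, every point of X would have a ball on which h is bounded below, and
    compactness of X would give a common bound. *)
Lemma low_side_ex : ~ bounded_below_on X -> exists s x, (s = 1 \/ s = -1) /\ low_side s x.
Proof.
move=> nb; apply: contrapT => nlow; apply: nb.
have cX : near_covering (X : set R).
  by apply/compact_near_coveringP; exact: segment_compact.
have : \forall c \near 0^'+, X `<=` (fun y => G y -> c <= h y).
  apply: cX => x Xx.
  have [|e1 [c1 [e10 c10 H1]]] := @not_low_side 1 x.
    by move=> l; apply: nlow; exists 1, x; split; [left|].
  have [|e2 [c2 [e20 c20 H2]]] := @not_low_side (-1) x.
    by move=> l; apply: nlow; exists (-1), x; split; [right|].
  (* The centre of the ball belongs to neither side; there the value of h itself serves. *)
  have [c3 c30 H3] : exists2 c3, 0 < c3 & G x -> c3 <= h x.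
    have [Gx|nG] := pselect (G x); first by exists (h x) => //; exact: h0.
    by exists 1.
  pose c0 := Num.min c1 (Num.min c2 c3).
  have c00 : 0 < c0 by rewrite !lt_min c10 c20 c30.
  exists (ball x (Num.min e1 e2), [set c | c <= c0]) => /=.
    split; first by apply: nbhsx_ballx; rewrite lt_min e10 e20.
    by near=> c; apply: ltW; near: c; exact: nbhs_right_lt.
  move=> [y c] /= [xy cc] Gy; apply: le_trans cc _.
  move: xy; rewrite /ball /= lt_min => /andP[xy1 xy2].
  case: (ltgtP x y) => [lxy|lyx|exy].
  - apply: (@le_trans _ _ c1); first by rewrite ge_min lexx.
    apply: H1 => //; rewrite mul1r subr_gt0 lxy /=.
    by rewrite (le_lt_trans _ xy1)// distrC ler_norm.
  - apply: (@le_trans _ _ c2); first by rewrite !ge_min lexx orbT.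
    apply: H2 => //; rewrite mulN1r opprB subr_gt0 lyx /=.
    by rewrite (le_lt_trans _ xy2)// ler_norm.
  - apply: (@le_trans _ _ c3); first by rewrite !ge_min lexx !orbT.
    by rewrite -exy; apply: H3; rewrite exy.
move=> Hc; have [c [c0 Hc']] : exists c, 0 < c /\ (X `<=` (fun y => G y -> c <= h y)).
  near (0 : R)^'+ => c; exists c; split; first by near: c; exact: nbhs_right_gt.
  by near: c.
by exists c => // z Gz Xz; exact: Hc'.
Unshelve. all: by end_near. Qed.

Lemma low_side_X s x : low_side s x -> (s = 1 \/ s = -1) -> X x.
Proof.
move=> low s1; rewrite XE; apply/andP; split; rewrite leNgt; apply/negP => x01.
  have [y [/GX]] := low (- x) 1 ltac:(lra) ltr01; rewrite XE.
  by case: s1 => ->; lra.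
have [y [/GX]] := low (x - 1) 1 ltac:(lra) ltr01; rewrite XE.
by case: s1 => ->; lra.
Qed.

Lemma low_side_notin E s x : (s = 1 \/ s = -1) -> open_interval E ->
  bounded_below_on E -> low_side s x -> ~ E x.
Proof.
move=> s1 [e [f [ef ->]]] [c c0 Hc] low; rewrite ooP => /andP[ex xf].
have [y [Gy sy hy]] := low (Num.min (x - e) (f - x)) c ltac:(rewrite lt_min !subr_gt0 ex xf//) c0.
move: hy; rewrite ltNge Hc//= in_itv /=; move: sy; rewrite lt_min.
by case: s1 => ->; lra.
Qed.

Variable V : R.
Hypothesis h_var : forall t, sorted <%O t -> list_in G t -> lvar (absd h) t <= V.

(** Otherwise h falls below any [c] between any two points of X. Inserting such points between n + 1
    points where h > 2c produces n drops of size at least [c], more than the variation [V] allows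
    for large n. *)
Lemma bounded_below_ex : exists x y, [/\ X x, X y, x < y & bounded_below_on `]x, y[].
Proof.
apply: contrapT => nbb.
have low (c x y : R) : 0 < c -> X x -> X y -> x < y -> exists z, [/\ G z, x < z < y & h z < c].
  move=> c0 Xx Xy xy; apply: contrapT => H; apply: nbb; exists x, y; split => //.
  exists c => // z Gz; rewrite ooP => xzy; rewrite leNgt; apply/negP => hz.
  by apply: H; exists z.
(* Otherwise [G], on which h > 0, would be a countable union of finite sets and thus null. *)
have [c c0 infA] : exists2 c : R, 0 < c & infinite_set (G `&` [set x | c + c < h x]).
  apply: contrapT => H.
  have finA n : finite_set (G `&` [set x | n.+1%:R^-1 + n.+1%:R^-1 < h x]).
    by apply: contrapT => infA; apply: H; exists n.+1%:R^-1; rewrite ?invr_gt0.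
  have cG : countable G.
    apply: (@sub_countable _ _ _ (\bigcup_n (G `&` [set x | n.+1%:R^-1 + n.+1%:R^-1 < h x]))).
      apply: subset_card_le => x Gx; have hx := h0 Gx.
      have h2 : 0 < h x / 2 by rewrite divr_gt0.
      exists (Num.truncn (h x / 2)^-1) => //; split => //=.
      rewrite [ltRHS]splitr; suff hn : (Num.truncn (h x / 2)^-1).+1%:R^-1 < h x / 2 by apply: ltrD.
      by rewrite invf_plt ?posrE// truncnS_gt.
    by apply: bigcup_countable => // n _; exact: finite_set_countable.
  have [N [mN N0 HN]] := aeG.
  have mG : measurable (G : set MR) by exact: countable_measurable.
  have : (mu (X : set R) <= mu (N `|` G))%E.
    apply: le_measure; rewrite ?inE; [exact: mX|exact: measurableU|].
    move=> x Xx; have [Gx|nG] := pselect (G x); [by right|left].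
    by apply: HN => /= /(_ Xx).
  have : (mu (N `|` G) <= mu N + mu G)%E by exact: measureU2.
  rewrite N0 [mu G]countable_lebesgue_measure0// add0e => h1 h2.
  have := le_trans h2 h1; rewrite -[X in mu X]setIid -mE m_X lee_fin.
  by rewrite ler10.
have zigzag t : sorted <%O t -> {in t, forall x, G x /\ c + c < h x} ->
    exists t', [/\ sorted <%O t', list_in G t', ohead t' = ohead t &
      c * (size t).-1%:R <= lvar (absd h) t'].
  elim: t => [|x [|y t] IH] st tA.
  - by exists [::]; split => //=; rewrite mulr0.
  - exists [:: x]; split => //; last by rewrite mulr0 /= addr0.
    by move=> z; rewrite inE => /eqP ->; have [] := tA x (mem_head _ _).
  have [Gx hx] := tA x (mem_head _ _).
  have [Gy hy] : G y /\ c + c < h y by apply: tA; rewrite !inE eqxx orbT.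
  move: st => /= /andP[xy st].
  have [|t' [st' tG' ht' lt']] := IH st.
    by move=> z zt; apply: tA; rewrite inE zt orbT.
  have [z [Gz /andP[xz zy] hz]] := low c x y c0 (GX Gx) (GX Gy) xy.
  case: t' st' tG' ht' lt' => // y' t' st' tG' [yE] lt'; rewrite yE in st' tG' lt' *.
  exists [:: x, z, y & t']; split => //.
  - by rewrite /= xz zy.
  - by move=> u; rewrite inE => /predU1P[->//|]; rewrite inE => /predU1P[->//|/tG'].
  rewrite [lvar _ _](_ : _ = absd h x z + (absd h z y + lvar (absd h) (y :: t')))//.
  have := normr_ge0 (h y - h z); have := ler_norm (- (h z - h x)); rewrite normrN.
  have {}lt' : c * (size t)%:R <= lvar (absd h) (y :: t') by exact: lt'.
  move: lt'; rewrite -[(size t).+1%:R]natr1 mulrDr mulr1 /absd.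
  by move: (lvar _ _) => l; lra.
have [n hn] : exists n, V < c * n%:R.
  exists (Num.truncn (V / c)).+1; rewrite mulrC -ltr_pdivrMr//; exact: truncnS_gt.
have [B BA Bn] := infinite_set_fset n.+1 infA.
have [||t [st tG _]] := zigzag (sort <=%O (finmap.enum_fset B)).
- by rewrite sort_lt_sorted finmap.fset_uniq.
- by move=> x; rewrite mem_sort => xB; apply: BA.
apply/negP; rewrite -ltNge; apply: le_lt_trans (h_var st tG) _.
rewrite (lt_le_trans hn)// ler_wpM2l ?(ltW c0)// ler_nat size_sort.
by rewrite -ltnS prednK// (leq_ltn_trans _ Bn).
Qed.

End LowSides.

(** * Good images of cylinders and the exceptional points *)

Section LowerBound.
Context {R : realType}.
Local Notation MR := (measurableTypeR R).
Local Notation mu := (@lebesgue_measure R).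
Variables (T : R -> R) (alpha : set (set R)) (a : nat -> set R) (w : nat -> R -> R).
Hypothesis bs : branch_system T alpha a w.
Let pm := bs_pm bs.
Local Notation v i := (inv_branch T (a i)).
Local Notation cyl := (cylinder T a).
Local Notation img := (cylinder_image T a).
Variable G : set R.
Hypotheses (GX : G `<=` X) (aeG : \forall x \ae mu, X x -> G x).
Hypothesis Gv : forall i y, G y -> (T @` a i) y -> G (v i y).
Variables (D th delta : R).
Hypotheses (D0 : 0 <= D) (th0 : 0 < th) (th1 : th < 1) (d0 : 0 < delta).
Hypothesis wD : forall i y y', (G `&` T @` a i) y -> (G `&` T @` a i) y' ->
  0 < w i y <= w i y' * expR (D * `|y - y'|).
Hypothesis v_lip : forall i y z, (T @` a i) y -> (T @` a i) z ->
  `|v i z - v i y| <= th * `|z - y|.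
Hypothesis img_ge : forall b, (0 < size b)%N -> cyl b !=set0 ->
  (delta%:E <= m (img b))%E.
Variables (P : probability MR R) (h : R -> R) (V : R).
Hypotheses (acP : ac_invariant T P) (dP : density P h) (eT : ergodic T).
Hypothesis h_gt0 : forall x, G x -> 0 < h x.
Hypothesis h_var : forall t, sorted <%O t -> list_in G t -> lvar (absd h) t <= V.
Hypothesis h_step : forall i y, G y -> (T @` a i) y -> w i y * h (v i y) <= h y.
Local Notation bounded_below := (bounded_below_on G h).

Lemma weight_lower i : exists2 k : R, 0 < k & forall y, G y -> (T @` a i) y -> k <= w i y.
Proof.
have [[y0 [Gy0 Ty0]]|H] := pselect (exists y0, (G `&` T @` a i) y0); last first.
  by exists 1 => // y Gy Ty; case: H; exists y.
exists (w i y0 / expR D).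
  by rewrite divr_gt0 ?expR_gt0//; have /andP[] := wD (conj Gy0 Ty0) (conj Gy0 Ty0).
move=> y Gy Ty; have /andP[_ H0] := wD (conj Gy0 Ty0) (conj Gy Ty).
have /andP[wy _] := wD (conj Gy Ty) (conj Gy Ty).
rewrite ler_pdivrMr ?expR_gt0//; apply: le_trans H0 _.
rewrite ler_wpM2l ?(ltW wy)// ler_expR ler_piMr//.
by move: (GX Gy) (GX Gy0); rewrite !XE ler_norml; lra.
Qed.

Lemma bounded_below_step E i : bounded_below E -> bounded_below (T @` (E `&` a i)).
Proof.
move=> [c c0 Hc]; have [k k0 Hk] := weight_lower i.
exists (k * c); first exact: mulr_gt0.
move=> z Gx [x [Ex ax] xz]; rewrite -{}xz in Gx *.
have Tx : (T @` a i) (T x) by exists x.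
have Gvx := Gv Gx Tx; apply: (le_trans _ (h_step Gx Tx)).
have E1 := sys_branchK bs ax; rewrite E1 in Gvx *.
apply: ler_pM; rewrite ?(ltW k0) ?(ltW c0) ?Hk//.
exact: Hc.
Qed.

Lemma bounded_below_image E b : bounded_below E ->
  bounded_below (iter (size b) T @` (E `&` cyl b)).
Proof.
move=> [c c0 Hc]; elim: b => [|i b IH].
  by exists c => // z Gy [y [Ey _] yz]; rewrite -{}yz in Gy *; exact: Hc.
have [c1 c10 Hc1] := bounded_below_step i IH.
exists c1 => // z Gx [x [Ex [bx [_ ax]]] xz]; rewrite -{}xz in Gx *; apply: Hc1 => //.
by exists (iter (size b) T x) => //; split => //; exists x.
Qed.

Lemma cylinder_diameter b x x' : cyl b x -> cyl b x' ->
  `|x - x'| <= th ^+ size b.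
Proof.
have H : cyl b x -> cyl b x' ->
    `|x - x'| <= th ^+ size b * `|iter (size b) T x - iter (size b) T x'|.
  elim: b => [|i b IH] /=; first by rewrite expr0 mul1r.
  move=> [bx [_ ax]] [bx' [_ ax']]; apply: le_trans (IH bx bx') _.
  rewrite exprSr -mulrA ler_wpM2l ?exprn_ge0 ?(ltW th0)//.
  set u := iter _ T x in ax *; set u' := iter _ T x' in ax' *.
  have Tu : (T @` a i) (T u) by exists u.
  have Tu' : (T @` a i) (T u') by exists u'.
  by have := v_lip Tu' Tu; rewrite !(sys_branchK bs).
move=> bx bx'; apply: le_trans (H bx bx') _.
rewrite ler_piMr ?exprn_ge0 ?(ltW th0)//.
have := pm_self_iter pm (size b) (cylinder_subX bx).
have := pm_self_iter pm (size b) (cylinder_subX bx').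
by rewrite !XE ler_norml; lra.
Qed.

Lemma good_cylinder_ex : exists b, [/\ (0 < size b)%N, cyl b !=set0 & bounded_below (img b)].
Proof.
have [x [y [Xx Xy xy bb]]] := bounded_below_ex GX aeG h_gt0 h_var.
(* A cylinder of diameter below a quarter of y - x that meets the middle half of the interval stays
   inside it. *)
have q0 : 0 < (y - x) / 4 by rewrite divr_gt0// subr_gt0.
have [k kq] : exists k, th ^+ k.+1 < (y - x) / 4.
  have := @cvg_expr _ th; rewrite ger0_norm ?(ltW th0)// => /(_ th1)/cvgrPdist_lt/(_ _ q0)[k _ Hk].
  by exists k; have := Hk k.+1 (leqnSn k); rewrite /= sub0r normrN ger0_norm// exprn_ge0// ltW.
have x1X : X (x + (y - x) / 4) by move: Xx Xy; rewrite !XE; lra.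
have y1X : X (y - (y - x) / 4) by move: Xx Xy; rewrite !XE; lra.
have [z [b bk bz] /andP[xz zy]] := conull_between (cylinder_cover bs k.+1) x1X y1X ltac:(lra).
exists b; split; [by rewrite bk|by exists z|].
have [c c0 Hc] := bounded_below_image b bb; exists c => // z' Gu [u bu uz]; rewrite -{}uz in Gu *.
apply: Hc => //; exists u => //; split => //=; rewrite in_itv /=.
by have := cylinder_diameter bz bu; rewrite bk ler_norml; lra.
Qed.

(** The empty word is excluded, its image being the closed interval X. *)
Lemma img_open b x : (0 < size b)%N -> img b x -> open_interval (img b).
Proof.
elim: b x => // i b IH x _; rewrite cylinder_image_cons => -[z [bz az] _].
have [E|ai] := bs_mem bs i; first by rewrite E in az.
apply: (branch_image_oi pm ai) => //.
case: b IH bz => [|j b] IH bz; last exact: (open_intervalI (IH z isT bz) (branch_oi pm ai) bz az).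
rewrite (_ : img [::] `&` a i = a i); first exact: (branch_oi pm ai).
by apply/setIidPr => u au; exists u => //; exact: (sys_subX bs au).
Qed.

Let U := \bigcup_(b in [set b | (0 < size b)%N /\ bounded_below (img b)]) img b.

(** [U] is forward invariant up to a null set. As P is invariant, the points outside [U] that enter
    it in one step are P-null, hence null since h > 0 a.e.; so ergodicity applies, and a good image
    of measure at least [delta] prevents [U] from being null. *)
Lemma good_conull : \forall x \ae mu, X x -> U x.
Proof.
have bU : borelX U.
  split; last by move=> x [b _]; exact: (cylinder_image_subX bs).
  rewrite (_ : U = \bigcup_(b in [set b | [/\ (0 < size b)%N, bounded_below (img b) & img b !=set0]]) img b).
    apply: open_measurable; apply: bigcup_open => b [b0 _ [x bx]].
    exact: open_interval_open (img_open b0 bx).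
  apply/seteqP; split=> x [b]; last by move=> [b0 bb _] bx; exists b.
  by move=> [b0 bb] bx; exists b => //; split => //; exists x.
have bTU := borel_preX pm 1 bU.
have UT : \forall x \ae mu, X x -> U x -> preX T 1 U x.
  have := sys_cover bs; apply: aeS => x Hx Xx [b [b0 bb] bx].
  have [i ax] := Hx Xx; split => //; exists (i :: b).
    by split => //; rewrite cylinder_image_cons; exact: bounded_below_step.
  by rewrite cylinder_image_cons; exists x.
have PE : P (preX T 1 U `\` U) = 0%E.
  have mI : measurable (preX T 1 U `&` U : set MR) := measurableI _ _ bTU.1 bU.1.
  have mD : measurable (preX T 1 U `\` U : set MR) := measurableD bTU.1 bU.1.
  have E1 : (P (preX T 1 U) = P (preX T 1 U `&` U) + P (preX T 1 U `\` U))%E.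
    rewrite -[in LHS](setUIDK (preX T 1 U) U); apply: measureU => //.
    by apply/seteqP; split=> x // [[_ ?] [_]].
  have E2 : (P U <= P (preX T 1 U `&` U))%E.
    apply: (P_ae_eq acP) => //; first exact: bU.1.
    by apply: aeS UT => x Hx Xx Ux; split => //; exact: Hx.
  have fP A : measurable (A : set MR) -> P A \is a fin_num by move=> ?; exact: fin_num_measure.
  move: E1 E2; rewrite (P_preX pm acP 1 bU).
  rewrite -(fineK (fP _ mI)) -(fineK (fP _ mD)) -(fineK (fP _ bU.1)) -EFinD lee_fin => -[->].
  have : 0 <= fine (P (preX T 1 U `\` U)) by rewrite fine_ge0.
  by move: (fine _) (fine _) => p q q0 H; congr (_%:E); lra.
have mE0 : m (preX T 1 U `\` U) = 0%E.
  have bE : borelX (preX T 1 U `\` U).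
    by split; [exact: (measurableD bTU.1 bU.1)|move=> x [[]]].
  apply: (density_pos_null dP _ bE PE).
  by apply: aeS aeG => x Hx Xx; exact: h_gt0 (Hx Xx).
have mE1 : m (preX T 1 U `+` U) = 0%E.
  have [N [mN N0 HN]] := UT.
  have mUD : measurable (U `\` preX T 1 U : set MR) := measurableD bU.1 bTU.1.
  have m1 : m (U `\` preX T 1 U) = 0%E.
    apply/eqP; rewrite eq_le measure_ge0 andbT -N0 mE; apply: le_measure; rewrite ?inE//.
      exact: (measurableI _ _ mUD mX).
    by move=> x [[Ux nTU] Xx]; apply: HN => /= /(_ Xx Ux).
  apply/eqP; rewrite eq_le measure_ge0 andbT.
  rewrite -[leRHS](adde0 0%E) -[X in (_ <= X + _)%E]mE0 -m1.
  by apply: measureU2 => //; exact: (measurableD bTU.1 bU.1).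
case: (eT bU mE1) => [mU0|mXU].
  have [b [b0 [x bx] bb]] := good_cylinder_ex.
  have : (m (img b) <= m U)%E.
    have bxi : img b (iter (size b) T x) by exists x.
    have mi : measurable (img b : set MR).
      exact: open_interval_measurable (img_open b0 bxi).
    rewrite !mE; apply: le_measure; rewrite ?inE.
    - exact: (measurableI _ _ mi mX).
    - exact: (measurableI _ _ bU.1 mX).
    - by move=> z [bz Xz]; split => //; exists b.
  rewrite mU0 => H; have := le_trans (img_ge b0 (ex_intro _ x bx)) H.
  by rewrite lee_fin leNgt d0.
exists (X `\` U); split; first exact: (measurableD mX bU.1).
  by rewrite -mXU mE setIidl// => x [].
by move=> x /= /not_implyP.
Qed.

Let C := X `\` U.

(** A good image between two points of [C] avoids both, so they are at least [delta] apart and the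
    integer part of x / delta tells them apart. *)
Let finite_bad : finite_set C.
Proof.
have sep x y : C x -> C y -> x < y -> delta <= y - x.
  move=> [Xx nx] [Xy ny] xy.
  have [z [b [b0 bb] bz] xzy] := conull_between good_conull Xx Xy xy.
  have bU u : img b u -> U u by exists b.
  have sub : img b `<=` `]x, y[%classic.
    have iE := cylinder_image_interval bs (b := b).
    move=> u bu; rewrite /= in_itv /=; apply/andP; split; rewrite ltNge; apply/negP => ux.
      by apply: nx; apply: bU; apply: (iE _ _ bu bz); move: xzy; lra.
    by apply: ny; apply: bU; apply: (iE _ _ bz bu); move: xzy; lra.
  have [t bt _] := bz.
  have := img_ge b0 (ex_intro _ t bt) => H; rewrite -lee_fin; apply: le_trans H _.
  apply: (@le_trans _ _ (mu `]x, y[%classic)).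
    rewrite mE setIidl; last exact: (cylinder_image_subX bs).
    apply: le_measure; rewrite ?inE//.
    exact: open_interval_measurable (img_open b0 bz).
  by rewrite lebesgue_measure_itv /= lte_fin xy -EFinB.
pose f (x : R) := Num.truncn (x / delta).
have inj : {in C &, injective f}.
  have H x y : C x -> C y -> x < y -> f x <> f y.
    move=> Cx Cy xy fxy; have := sep x y Cx Cy xy.
    have xd : 0 <= x / delta by rewrite divr_ge0 ?(ltW d0)//; case: Cx => + _; rewrite XE => /andP[].
    have yd : 0 <= y / delta by rewrite divr_ge0 ?(ltW d0)//; case: Cy => + _; rewrite XE => /andP[].
    have /andP[fx _] := truncn_itv xd; have /andP[_ fy] := truncn_itv yd.
    rewrite -/(f x) -/(f y) fxy in fx fy.
    rewrite ler_pdivlMr// in fx; rewrite ltr_pdivrMr// -natr1 mulrDl mul1r in fy.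
    by move: (_ * delta) fx fy => z fx fy dxy; lra.
  move=> x y; rewrite !inE => Cx Cy fxy; case: (ltgtP x y) => // [xy|yx].
    by have := H x y Cx Cy xy.
  by have := H y x Cy Cx yx; rewrite fxy.
rewrite -(eq_finite_set (inj_card_eq inj)).
apply: (@sub_finite_set _ _ `I_(Num.truncn delta^-1).+1) => //.
move=> _ [x [+ _] <-] /=; rewrite XE => /andP[x0 x1]; rewrite ltnS.
by apply: le_truncn; rewrite ler_pdivrMr// mulVf ?gt_eqF.
Qed.

Lemma low_sides_finite : exists l : seq R, forall s x : R,
  s = 1 \/ s = -1 -> low_side G h s x -> x \in l.
Proof.
have [l lE] := (finite_seqP _).1 finite_bad; exists l => s x s1 low.
have : [set` l] x; last by [].
rewrite -lE; split; first exact: (low_side_X GX low s1).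
by move=> [b [b0 bb] bx]; exact: (low_side_notin s1 (img_open b0 bx) bb low bx).
Qed.

End LowerBound.

(** * One-sided neighbourhoods and their inverse images *)

Section OneSidedNeighbourhoods.
Context {R : realType}.

Definition side (s x eta : R) : set R := [set y | 0 < s * (y - x) < eta].

Lemma sub_side s x eta eta' : eta <= eta' -> side s x eta `<=` side s x eta'.
Proof. by move=> ee y /andP[y0 ye]; rewrite /side /= y0 (lt_le_trans ye). Qed.

Lemma side_itv s x eta : s = 1 \/ s = -1 -> 0 < eta ->
  exists e f : R, f - e = eta /\ side s x eta = `]e, f[%classic.
Proof.
move=> s1 eta0; case: s1 => ->.
  exists x, (x + eta); split; first lra.
  by apply/seteqP; split=> y; rewrite /side /= in_itv /=; lra.
exists (x - eta), x; split; first lra.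
by apply/seteqP; split=> y; rewrite /side /= in_itv /=; lra.
Qed.

(** All or nothing: [E] misses the side or contains it, as is the case for small eta. A side that
    meets the image of a branch can then be pulled back as a whole. *)
Definition side_fits (E : set R) s x eta :=
  forall y, E y -> side s x eta y -> side s x eta `<=` E.

Lemma side_fits_sub E s x eta eta' : eta' <= eta -> side_fits E s x eta -> side_fits E s x eta'.
Proof.
move=> ee F y Ey sy z sz; exact: (F y Ey (sub_side ee sy) z (sub_side ee sz)).
Qed.

Lemma side_fits_ex E s x : s = 1 \/ s = -1 -> open_interval E ->
  exists2 eta, 0 < eta & side_fits E s x eta.
Proof.
move=> s1 [e [f [ef ->]]].
have [xe|ex] := ltP x e.
  exists (e - x); first by rewrite subr_gt0.
  by move=> y; rewrite ooP /side /= => ey; case: s1 => ->; lra.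
have [xf|fx] := ltP f x.
  exists (x - f); first by rewrite subr_gt0.
  by move=> y; rewrite ooP /side /= => ey; case: s1 => ->; lra.
have [xe|ne] := eqVneq x e.
  exists (f - e); first by rewrite subr_gt0.
  move=> y; rewrite ooP /side /= => ey; rewrite xe; case: s1 => -> sy z /= sz.
    by rewrite in_itv /=; lra.
  by lra.
have [xf|nf] := eqVneq x f.
  exists (f - e); first by rewrite subr_gt0.
  move=> y; rewrite ooP /side /= => ey; rewrite xf; case: s1 => -> sy z /= sz.
    by lra.
  by rewrite in_itv /=; lra.
have xe' : e < x by rewrite lt_neqAle eq_sym ne.
have xf' : x < f by rewrite lt_neqAle nf.
exists (Num.min (x - e) (f - x)); first by rewrite lt_min !subr_gt0 xe' xf'.
move=> y _ _ z; rewrite /side /= in_itv /= lt_min; case: s1 => ->; lra.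
Qed.

Lemma common_eta (I : eqType) (L : seq I) (Q : I -> R -> Prop) :
  (forall i, i \in L -> exists2 eta, 0 < eta & Q i eta) ->
  (forall i eta eta', eta' <= eta -> Q i eta -> Q i eta') ->
  exists2 eta, 0 < eta & forall i, i \in L -> Q i eta.
Proof.
move=> + Qmono; elim: L => [|i L IH] H; first by exists 1.
have [|e e0 He] := IH; first by move=> j jL; apply: H; rewrite inE jL orbT.
have [e' e'0 He'] := H i (mem_head _ _).
exists (Num.min e e'); first by rewrite lt_min e0 e'0.
move=> j; rewrite inE => /predU1P[->|jL]; first by apply: Qmono He'; rewrite ge_min lexx orbT.
by apply: Qmono (He j jL); rewrite ge_min lexx.
Qed.

(** [x'] is the limit of [f] at x from the given side; it is obtained as an infimum because f, with
    the sign [s * sg], increases away from x and is bounded. The contraction estimate passes to the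
    limit. *)
Lemma side_limit (E : set R) (f : R -> R) th s x eta sg : 0 <= th -> 0 < eta ->
  s = 1 \/ s = -1 -> side s x eta `<=` E -> oriented sg E f ->
  (forall y, E y -> X (f y)) ->
  (forall y z, E y -> E z -> `|f z - f y| <= th * `|z - y|) ->
  exists x', forall y, side s x eta y ->
    0 < (s * sg) * (f y - x') <= th * (s * (y - x)).
Proof.
move=> th0 eta0 s1 sub of_ fX lip.
have ss : s * s = 1 by case: s1 => ->; lra.
have sg2 := oriented_sq of_.
have t2 : (s * sg) * (s * sg) = 1 by rewrite mulrACA ss sg2 mulr1.
have t1 : `|s * sg| = 1.
  by case: s1 of_ => -> [[->|->] _]; rewrite ?mul1r ?mulr1 ?mulrNN ?mulr1 ?normrN normr1.
pose g y := (s * sg) * f y.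
have gmono y z : side s x eta y -> side s x eta z -> s * (y - x) < s * (z - x) -> g y < g z.
  move=> sy sz; have [_ o] := of_; have := o _ _ (sub _ sy) (sub _ sz).
  have := o _ _ (sub _ sz) (sub _ sy); rewrite /g.
  by case: s1 => ->; rewrite ?mul1r ?mulN1r => o1 o2 yz;
    [have := o2 ltac:(lra)|have := o1 ltac:(lra)]; rewrite ?mulNr; lra.
pose B : set R := g @` side s x eta.
have lB : has_lbound B.
  exists (-1) => _ [y sy <-]; rewrite /g; have := fX _ (sub _ sy); rewrite XE => fy.
  have := ler_norm (- (s * sg * f y)); rewrite normrN normrM t1 mul1r ger0_norm; lra.
exists ((s * sg) * inf B) => y sy.
have -> : s * sg * (f y - s * sg * inf B) = g y - inf B.
  by rewrite mulrBr mulrA t2 mul1r.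
(* A point strictly nearer to x than y makes the first inequality strict. *)
have sy' : side s x eta ((x + y) / 2).
  by move: sy; rewrite /side /=; case: s1 => ->; lra.
have sm : s * ((x + y) / 2 - x) < s * (y - x).
  by move: sy; rewrite /side /=; case: s1 => ->; lra.
rewrite subr_gt0; apply/andP; split.
  by apply: le_lt_trans (gmono _ _ sy' sy sm); apply: ge_inf => //; exists ((x + y) / 2).
rewrite lerBlDr addrC -lerBlDr; apply: lb_le_inf; first by exists (g y), y.
move=> _ [z sz <-]; have syp : 0 <= th * (s * (y - x)).
  by rewrite mulr_ge0//; case/andP: sy => /ltW.
have [zy|zy] := ltP (s * (y - x)) (s * (z - x)).
  by have := gmono _ _ sy sz zy; lra.
have : `|f y - f z| <= th * (s * (y - x)).
  apply: le_trans (lip _ _ (sub _ sz) (sub _ sy)) _; rewrite ler_wpM2l//.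
  rewrite ler_norml; move: zy sz; rewrite /side /=; case: s1 => ->; lra.
have := ler_norm (s * sg * (f y - f z)); rewrite normrM t1 mul1r /g mulrBr; lra.
Qed.

End OneSidedNeighbourhoods.

(** * Absence of low sides *)

Section LowSidesVanish.
Context {R : realType}.
Local Notation MR := (measurableTypeR R).
Local Notation mu := (@lebesgue_measure R).
Variables (T : R -> R) (alpha : set (set R)) (a : nat -> set R) (w : nat -> R -> R).
Hypothesis bs : branch_system T alpha a w.
Let pm := bs_pm bs.
Local Notation v i := (inv_branch T (a i)).
Variable G : set R.
Hypotheses (GX : G `<=` X) (aeG : \forall x \ae mu, X x -> G x).
Hypothesis Gv : forall i y, G y -> (T @` a i) y -> G (v i y).
Variable th : R.
Hypotheses (th0 : 0 < th) (th1 : th < 1).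
Hypothesis v_lip : forall i y z, (T @` a i) y -> (T @` a i) z ->
  `|v i z - v i y| <= th * `|z - y|.
Hypothesis cF : condF T alpha.
Variables (P : probability MR R) (h : R -> R) (M : R).
Hypotheses (acP : ac_invariant T P) (dP : density P h).
Hypothesis h_gt0 : forall x, G x -> 0 < h x.
Hypothesis h_le : forall x, G x -> h x <= M.
Hypothesis h_step : forall i y, G y -> (T @` a i) y -> w i y * h (v i y) <= h y.
Hypothesis w_lower : forall i, exists2 k : R, 0 < k &
  forall y, G y -> (T @` a i) y -> k <= w i y.
Variable l : seq R.
Hypothesis low_l : forall s x : R, s = 1 \/ s = -1 -> low_side G h s x -> x \in l.

Lemma common_side_fits : exists2 eta : R, 0 < eta &
  forall i s x, s = 1 \/ s = -1 -> x \in l -> side_fits (T @` a i) s x eta.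
Proof.
have [L LE] := (finite_seqP _).1 cF.
have [||eta eta0 H] := @common_eta R _ L (fun J eta => forall x, x \in l -> forall s, s \in [:: 1; -1] ->
    side_fits J s x eta).
- move=> J JL; have {}JL : [set T @` c | c in alpha] J by rewrite LE.
  have oJ : open_interval J.
    case: JL => c ac <-; apply: (branch_image_oi pm ac) => //.
    exact: (branch_oi pm ac).
  apply: common_eta => [x _|x e e' ee H s s1]; last exact: side_fits_sub ee (H s s1).
  apply: common_eta => [s|s e e' ee]; last exact: side_fits_sub ee.
  by rewrite !inE => s1; apply: side_fits_ex => //; case/orP: s1 => /eqP ->; [left|right].
- by move=> J e e' ee H x xl s s1; exact: side_fits_sub ee (H x xl s s1).
exists eta => // i s x s1 xl; have [->|ai] := bs_mem bs i.
  by move=> y; rewrite image_set0.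
apply: H => //; last by rewrite !inE; case: s1 => ->; rewrite eqxx ?orbT.
have : [set T @` c | c in alpha] (T @` a i) by exists (a i).
by rewrite LE.
Qed.

Definition low_points eta : set R :=
  X `&` \bigcup_(sx in [set sx : R * R | (sx.1 = 1 \/ sx.1 = -1) /\ low_side G h sx.1 sx.2])
    side sx.1 sx.2 eta.

Lemma borel_low_points eta : 0 < eta -> borelX (low_points eta).
Proof.
move=> eta0; split; last by move=> x [].
apply: (measurableI _ _ mX); apply: open_measurable; apply: bigcup_open => sx [s1 _].
by have [e [f [_ ->]]] := side_itv sx.2 s1 eta0; exact: interval_open.
Qed.

Lemma low_points_le eta : 0 < eta -> (m (low_points eta) <= ((size l).*2%:R * eta)%:E)%E.
Proof.
move=> eta0; pose S (l' : seq R) := \bigcup_(x in [set` l']) (side 1 x eta `|` side (-1) x eta).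
have ms s x : s = 1 \/ s = -1 -> measurable (side s x eta : set MR) /\ mu (side s x eta) = eta%:E.
  move=> s1; have [e [f [ef ->]]] := side_itv x s1 eta0; split; first exact: measurable_itv.
  by rewrite lebesgue_measure_itv /= lte_fin -subr_gt0 ef eta0 -EFinB ef.
have m2 x : measurable (side 1 x eta `|` side (-1) x eta : set MR).
  by apply: measurableU; apply: (ms _ _ _).1; [left|right].
have mS l' : measurable (S l' : set MR).
  by apply: fin_bigcup_measurable => // x _; exact: m2.
apply: (@le_trans _ _ (mu (S l))).
  rewrite mE; apply: le_measure; rewrite ?inE//.
    by apply: (measurableI _ _ _ mX); exact: (borel_low_points eta0).1.
  move=> y [[_ [[s x] /= [s1 low] sy]] _]; exists x; first exact: low_l low.
  by case: s1 sy => ->; [left|right].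
elim: (l) => [|x l' IH].
  by rewrite /S (_ : [set` [::]] = set0) ?bigcup_set0 ?measure0 ?lee_fin ?mul0r//; apply/seteqP; split.
have -> : S (x :: l') = (side 1 x eta `|` side (-1) x eta) `|` S l'.
  apply/seteqP; split=> y.
    by move=> [z /=]; rewrite inE => /predU1P[-> ?|zl zy]; [left|right; exists z].
  by move=> [xy|[z zl zy]]; [exists x => //=; rewrite mem_head|exists z => //=; rewrite inE zl orbT].
have h1 : (mu ((side 1 x eta `|` side (-1) x eta) `|` S l') <=
    mu (side 1 x eta `|` side (-1) x eta) + mu (S l'))%E by apply: measureU2.
have h2 : (mu (side 1 x eta `|` side (-1) x eta) <= mu (side 1 x eta) + mu (side (-1) x eta))%E.
  by apply: measureU2; apply: (ms _ _ _).1; [left|right].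
apply: le_trans h1 _; rewrite /= doubleS -[(_.+2)%:R]natr1 -natr1 !mulrDl mul1r.
rewrite [X in (_ <= X%:E)%E](_ : _ = (eta + eta) + (size l').*2%:R * eta); last by ring.
rewrite EFinD; apply: leeD => //; apply: le_trans h2 _.
by rewrite !(ms _ _ _).2; [rewrite EFinD|right|left].
Qed.

(** The limit of the inverse branch along a low side has a low side again: h at the pulled-back
    point is at most h / k, where k > 0 bounds the weight from below. *)
Lemma low_points_pull : exists2 eta0 : R, 0 < eta0 & forall eta, 0 < eta -> eta <= eta0 ->
  \forall x \ae mu, X x -> preX T 1 (low_points eta) x -> low_points (th * eta) x.
Proof.
have [eta0 e0 fits] := common_side_fits; exists eta0 => // eta eta_gt0 eta_le.
have := sys_cover bs; apply: aeS => y Hy Xy [_ [_ [[s x] /= [s1 low] sTy]]].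
have [i ay] := Hy Xy; split => //.
have Ty : (T @` a i) (T y) by exists y.
have sub : side s x eta0 `<=` T @` a i.
  exact: (fits i s x s1 (low_l s1 low) (T y) Ty (sub_side eta_le sTy)).
have [sg osg] := sys_oriented bs i.
have [x' Hx'] := side_limit (ltW th0) e0 s1 sub osg (fun y _ => sys_X bs i y) (v_lip (i := i)).
exists (s * sg, x'); last first.
  have := Hx' _ (sub_side eta_le sTy); rewrite (sys_branchK bs)// => /andP[p q].
  rewrite /side /= p (le_lt_trans q)// ltr_pM2l//.
  by case/andP: sTy.
split => /=.
  by case: s1 osg => -> [[->|->] _]; rewrite ?mul1r ?mulrNN ?mulr1; [left|right|right|left].
have [k k0 Hk] := w_lower i.
move=> e c e_gt0 c_gt0.
have [z [Gz sz hz]] := low (Num.min e eta0) (k * c) ltac:(rewrite lt_min e_gt0 e0//) ltac:(exact: mulr_gt0).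
move: sz; rewrite lt_min => /andP[z0 /andP[ze zeta]].
have sz : side s x eta0 z by rewrite /side /= z0 zeta.
have Tz := sub _ sz.
exists (v i z); split; first exact: Gv.
  have /andP[p q] := Hx' _ sz; rewrite p (le_lt_trans q)//.
  by rewrite (le_lt_trans _ ze)// ler_piMl// ltW.
rewrite -(ltr_pM2l k0); apply: le_lt_trans (le_lt_trans (h_step Gz Tz) hz).
by rewrite ler_wpM2r ?Hk// ltW// h_gt0//; exact: Gv.
Qed.

Lemma low_points_null : exists2 eta : R, 0 < eta & m (low_points eta) = 0%E.
Proof.
have [eta0 e0 pull] := low_points_pull; exists eta0 => //.
have aeh : \forall x \ae mu, X x -> 0 < h x.
  by apply: aeS aeG => x Hx Xx; exact: h_gt0 (Hx Xx).
have [x0 Gx0] := conull_neq0 aeG.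
have M0 : 0 < M := lt_le_trans (h_gt0 Gx0) (h_le Gx0).
apply: (density_pos_null dP aeh (borel_low_points e0)).
have Pk k : (P (low_points eta0) <= P (low_points (th ^+ k * eta0)))%E.
  elim: k => [|k IH]; first by rewrite expr0 mul1r.
  have ek : 0 < th ^+ k * eta0 by rewrite mulr_gt0 ?exprn_gt0.
  have bk := borel_low_points ek.
  apply: le_trans IH _; rewrite -(P_preX pm acP 1 bk).
  apply: (P_ae_eq acP); first exact: (borel_preX pm 1 bk).1.
    by apply: (borel_low_points _).1; rewrite mulr_gt0 ?exprn_gt0.
  rewrite exprS -mulrA; apply: pull => //.
  by apply: ler_piMl; [exact: ltW|apply: exprn_ile1; exact: ltW].
have PM eta : 0 < eta -> (P (low_points eta) <= (M * ((size l).*2%:R * eta))%:E)%E.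
  move=> eta_gt0; have bk := borel_low_points eta_gt0; have [mh _ hE] := dP.
  rewrite hE//; apply: (@le_trans _ _ (\int[m]_(x in low_points eta) M%:E)%E).
    rewrite !ge0_integral_mX; [|exact: bk.1|exact: bk.2|exact: bk.1|exact: bk.2].
    have [_ h0 _] := dP.
    apply: ae_ge0_le_integral; first exact: bk.1.
    - by move=> x /bk.2 Xx; rewrite lee_fin h0.
    - by apply/measurable_EFinP; exact: measurable_funS mX bk.2 mh.
    - by move=> x _; rewrite lee_fin ltW.
    - exact: measurable_cst.
    by apply: aeS aeG => x Hx /bk.2 /Hx Gx; rewrite lee_fin h_le.
  rewrite integral_cst//; last exact: bk.1.
  by rewrite EFinM lee_wpmul2l ?lee_fin ?(ltW M0)// low_points_le.
have fP : P (low_points eta0) \is a fin_num by apply: fin_num_measure; exact: (borel_low_points e0).1.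
apply/eqP; rewrite eq_le measure_ge0 andbT -(fineK fP) lee_fin leNgt; apply/negP => p0.
(* The summand 1 keeps [K] positive even when [l] is empty. *)
pose K := M * ((size l).*2%:R * eta0) + 1.
have K0 : 0 < K by rewrite ltr_wpDl// !mulr_ge0// ltW.
have q0 : 0 < fine (P (low_points eta0)) / K by rewrite divr_gt0.
have := @cvg_expr _ th; rewrite ger0_norm ?(ltW th0)// => /(_ th1)/cvgrPdist_lt/(_ _ q0)[k _ Hk].
have := Hk k (leqnn k); rewrite /= sub0r normrN ger0_norm ?exprn_ge0 ?(ltW th0)//.
rewrite ltr_pdivlMr//; apply/negP; rewrite -leNgt.
rewrite -lee_fin fineK//; apply: le_trans (Pk k) _.
apply: le_trans (PM _ _) _; first by rewrite mulr_gt0 ?exprn_gt0.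
rewrite lee_fin /K mulrDr mulr1 ler_wpDr ?exprn_ge0 ?(ltW th0)//.
by rewrite le_eqVlt; apply/orP; left; apply/eqP; ring.
Qed.

Lemma density_bounded_below : bounded_below_on G h X.
Proof.
apply: contrapT => /(low_side_ex h_gt0)[s [x [s1 low]]].
have [eta eta0 N0] := low_points_null.
have [y [Gy sy hy]] := low eta 1 eta0 ltr01.
(* A second point, strictly between x and y: the interval from z to y lies in the null set of low
   points, a contradiction. *)
have [z [Gz sz hz]] := low (s * (y - x)) 1 ltac:(by case/andP: sy) ltr01.
have Xs u : X u -> side s x eta u -> low_points eta u.
  by move=> Xu su; split => //; exists (s, x).
pose y1 := Num.min y z; pose y2 := Num.max y z.
have y12 : y1 < y2.
  by rewrite /y1 /y2 lt_max !gt_min !ltxx /= ; move: sz; case: s1 => ->; case: (ltgtP y z) => //= ->; lra.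
have sub : `]y1, y2[%classic `<=` low_points eta.
  move=> u; rewrite /= in_itv /= lt_max gt_min => /andP[u1 u2].
  move: (GX Gy) (GX Gz); rewrite !XE => Xy Xz.
  apply: Xs; first by rewrite XE; move: u1 u2 => /orP[] ? /orP[] ?; lra.
  by rewrite /side /=; move: sy sz u1 u2; case: s1 => -> ? ? /orP[] ? /orP[] ?; lra.
have := N0; rewrite mE => N1.
have : (mu `]y1, y2[%classic <= 0)%E.
  rewrite -N1; apply: le_measure; rewrite ?inE//.
    by apply: (measurableI _ _ _ mX); exact: (borel_low_points eta0).1.
  by move=> u uy; split; [exact: sub|have [] := sub _ uy].
by rewrite lebesgue_measure_itv /= lte_fin y12 -EFinB lee_fin leNgt subr_gt0 y12.
Qed.

End LowSidesVanish.

(** * Part (b) *)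

Section PartB.
Context {R : realType}.
Local Notation MR := (measurableTypeR R).
Local Notation mu := (@lebesgue_measure R).

Lemma inf_image_ex (T : R -> R) alpha a w : branch_system T alpha a w ->
  (0 < inf_image T (cylinders T alpha))%E ->
  exists2 delta : R, 0 < delta & forall b, (0 < size b)%N -> cylinder T a b !=set0 ->
    (delta%:E <= m (cylinder_image T a b))%E.
Proof.
rewrite /inf_image; set S := [set _ | _] => bs S0.
have lb b : (0 < size b)%N -> cylinder T a b !=set0 ->
    (ereal_inf S <= m (cylinder_image T a b))%E.
  move=> b0 bn; apply: ereal_inf_lbound; exists (size b), (cylinder T a b).
  by split => //; exact: (word_cylinder bs).
case: (ereal_inf S) S0 lb => [d| |] // d0 lb; first by exists d.
by exists 1 => // b b0 bn; have := lb b b0 bn; rewrite leye_eq => /eqP ->; rewrite leey.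
Qed.

Section Letters.
Variables (T : R -> R) (alpha : set (set R)) (a : nat -> set R) (w : nat -> R -> R).
Hypothesis bs : branch_system T alpha a w.
Variables (D delta : R) (q : nat -> R -> R).
Hypotheses (D0 : 0 <= D) (d0 : 0 < delta).
Hypothesis wq : forall i, \forall x \ae mu, w i x = q i x.
Hypothesis qD : forall i y y', (T @` a i) y -> (T @` a i) y' ->
  0 < q i y <= q i y' * expR (D * `|y - y'|).
Hypothesis img_ge : forall b, (0 < size b)%N -> cylinder T a b !=set0 ->
  (delta%:E <= m (cylinder_image T a b))%E.
Let K := (2 + D * expR D) * (expR D / delta).
Let r i := K * fine (m (a i)).

Let K0 : 0 <= K.
Proof. by rewrite mulr_ge0 ?divr_ge0 ?expR_ge0 ?(ltW d0)// addr_ge0// mulr_ge0// expR_ge0. Qed.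

Let letter_image i : a i !=set0 -> (delta%:E <= m (T @` a i))%E.
Proof.
move=> [x ax]; have := img_ge (b := [:: i]) isT; rewrite cylinder_image_cons.
rewrite (_ : cylinder_image T a [::] `&` a i = a i); last first.
  by apply/setIidPr => u au; exists u => //; exact: (sys_subX bs au).
by apply; exists x; split; [exact: (sys_subX bs ax)|split; [exact: (sys_subX bs ax)|]].
Qed.

(** This plays the role that (R) has in part (a): by distortion a weight and its variation are
    bounded by a multiple of m(a i), and these measures add up to at most 1. *)
Lemma letter_bounds i (Q := [set x | w i x = q i x]) :
  (forall x, (X `&` Q) x -> w i x <= r i) /\
  forall t, sorted <%O t -> list_in (X `&` Q) t -> lvar (absd (w i)) t <= r i.
Proof.
have [E|ai] := bs_mem bs i.
  have wz x : w i x = 0.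
    by have [_ _ wout _] := bs_density bs i; rewrite wout// E image_set0.
  have r0 : 0 <= r i by rewrite mulr_ge0 ?fine_ge0.
  split=> [x _|t _ _]; first by rewrite wz.
  by rewrite lvar_eq0// => x _; rewrite wz.
have [[x0 ax0]|noa] := pselect (a i !=set0); last first.
  by have [e [f [ef E]]] := branch_oi (bs_pm bs) ai; case: noa; exists ((e + f) / 2); rewrite E ooP !midf_lt.
have iE := sys_image_interval bs (i := i).
have EX : T @` a i `<=` X.
  by move=> _ [x ax <-]; apply: (pm_self (bs_pm bs)); exact: (sys_subX bs ax).
have aeQ : \forall x \ae mu, X x -> (X `&` Q) x by apply: aeS (wq i) => x H Xx.
have [_ w0 wout cov] := bs_density bs i.
have mw := sys_measurable_w bs i.
have fD y y' : (T @` a i `&` (X `&` Q)) y -> (T @` a i `&` (X `&` Q)) y' ->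
    w i y <= w i y' * expR (D * `|y - y'|).
  by move=> [Ty [_ ->]] [Ty' [_ ->]]; have /andP[] := qD Ty Ty'.
have ma := sys_measurable bs i.
have I : (\int[mu]_x (w i x)%:E <= (fine (m (a i)))%:E)%E.
  rewrite fineK ?m_fin// mE setIidl; last exact: (sys_subX bs).
  have := cov (cst 1%E); rewrite (_ : (fun x => _ * cst 1 x)%E = (fun x => (w i x)%:E)); last first.
    by apply/funext => x; rewrite mule1.
  by move=> ->//; rewrite integral_cst// mul1e.
have dE : (delta%:E <= m (T @` a i))%E by apply: letter_image; exists x0.
have KE : K * fine (m (a i)) = (2 + D * expR D) * (expR D * (fine (m (a i)) / delta)).
  by rewrite /K; ring.
have c0 : 0 <= expR D * (fine (m (a i)) / delta).
  by rewrite mulr_ge0 ?expR_ge0// divr_ge0 ?fine_ge0// ltW.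
split=> [x [Xx Qx]|t st tQ].
  have [Tx|/wout ->] := pselect ((T @` a i) x); last by rewrite mulr_ge0 ?fine_ge0.
  apply: le_trans (distortion_sup iE EX D0 aeQ mw w0 fD I d0 dE _) _; first by split.
  rewrite /r KE ler_peMl//; have : 0 <= D * expR D by rewrite mulr_ge0 ?expR_ge0.
  lra.
rewrite /r KE; apply: (distortion_lvar iE EX D0 aeQ mw w0 fD I d0 dE) => //.
Qed.

Lemma letters_sum I : uniq I -> \sum_(i <- I) r i <= K.
Proof.
move=> uI; rewrite /r -mulr_sumr ler_piMr//.
have cE i : cylinder T a [:: i] = a i.
  apply/seteqP; split=> x; first by move=> [_ [_]].
  by move=> ax; have Xx := sys_subX bs ax; split.
pose L := [seq [:: i] | i <- I].
have uL : uniq L by rewrite map_inj_uniq// => i j [].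
have sL : {in L, forall b, size b = 1%N} by move=> b /mapP[i _ ->].
have := m_words_union bs uL sL; rewrite big_map.
under eq_bigr do rewrite cE.
have mU : measurable (words_union T a L : set MR) := measurable_words_union bs L.
move=> <-; rewrite -lee_fin fineK ?m_fin// -(m_X (R := R)).
apply: le_measure; rewrite ?inE//; first exact: mX.
by move=> x [b _]; exact: cylinder_subX.
Qed.

End Letters.

Lemma density_le_P (P : probability MR R) (h : R -> R) c E : density P h -> 0 < c ->
  (\forall x \ae mu, X x -> c <= h x) -> borelX E -> fine (m E) <= fine (P E) / c.
Proof.
move=> dP c0 hc bE; have [mE' EX] := bE; have [mh h0 hE] := dP.
rewrite ler_pdivlMr// -lee_fin [leRHS]fineK; last exact: fin_num_measure.
rewrite mulrC EFinM fineK ?m_fin// hE// -integral_cst//.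
rewrite !ge0_integral_mX//; apply: ae_ge0_le_integral => //.
- by move=> x _; rewrite /= lee_fin ltW.
- by move=> x /EX Xx; rewrite lee_fin h0.
- by apply/measurable_EFinP; exact: measurable_funS mX EX mh.
by apply: aeS hc => x Hx /EX /Hx; rewrite lee_fin.
Qed.

Lemma part_b (T : R -> R) (alpha : set (set R)) (P : probability MR R) (h : R -> R) (C r : R) :
  afu_map T alpha -> conservative T -> ergodic T ->
  ac_invariant T P -> density P h ->
  0 < C -> 0 < r -> spectral_gap T h C r -> (0 < inf_image T (cylinders T alpha))%E ->
  exists2 B : R, 0 < B & forall n : nat, (0 < n)%N ->
    (mixing_coef (psi_coef P) T alpha n <= (B * r ^+ n)%:E)%E.
Proof.
move=> afu cT eT acP dP C0 r0 sg inf0.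
have [pm _ cU cF _] := afu.
have [a [w bs]] := branch_system_ex pm.
have [th [th0 th1 wth]] := expansion_ex bs cU.
have [D [q [D0 wq qD]]] := afu_letters bs afu.
have [delta d0 img_ge] := inf_image_ex bs inf0.
have lb := letter_bounds bs D0 d0 wq qD img_ge.
have aeQ : \forall x \ae mu, X x ->
    [/\ forall i, w i x = q i x, forall i, w i x <= th & 0 < h x].
  have := aeI (ae_all wq) (aeI (ae_all wth) (density_pos pm acP dP cT eT)).
  by apply: aeS => x [h1 [h2 h3]] Xx; split => //; exact: h3.
have [G [M [V [[GX GQ aeG Gv] [M0 hM hV] _ FL]]]] :=
  good_system bs acP dP sg (letters_sum bs D0 d0)
    (fun i => aeS (fun x wx Xx => (lb i).1 x (conj Xx wx)) (wq i))
    (fun i => ex_intro _ [set x | w i x = q i x]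
       (conj (aeS (fun x wx _ => wx) (wq i)) (lb i).2)) aeQ.
have wD i y y' : (G `&` T @` a i) y -> (G `&` T @` a i) y' ->
    0 < w i y <= w i y' * expR (D * `|y - y'|).
  by move=> [/GQ[-> _ _] Ty] [/GQ[-> _ _] Ty']; exact: qD.
have v_lip i y z : (T @` a i) y -> (T @` a i) z ->
    `|inv_branch T (a i) z - inv_branch T (a i) y| <= th * `|z - y|.
  have [->|ai] := bs_mem bs i; first by rewrite image_set0.
  exact: (branch_lipschitz pm ai (bs_density bs i) (ltW th0) (wth i)).
have Gv' i y : G y -> (T @` a i) y -> G (inv_branch T (a i) y).
  by move=> Gy Ty; exact: (branch_good Gv wD Gy Ty).
have h_gt0 x : G x -> 0 < h x by move=> /GQ[].
have h_step i y : G y -> (T @` a i) y -> w i y * h (inv_branch T (a i) y) <= h y.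
  move=> Gy Ty; have := FL 1%N [:: [:: i]] y isT; rewrite big_seq1 /= patchE.
  rewrite mem_set; last exact: GX (Gv' _ _ Gy Ty).
  by apply => // b; rewrite inE => /eqP ->.
have [l low_l] := low_sides_finite bs GX aeG Gv' D0 th0 th1 d0 wD v_lip img_ge
  acP dP eT h_gt0 hV h_step.
have [c c0 hc] := density_bounded_below bs GX aeG Gv' th0 th1 v_lip cF acP dP
  h_gt0 hM h_step (weight_lower GX D0 wD) low_l.
have aec : \forall x \ae mu, X x -> c <= h x.
  by apply: aeS aeG => x Hx Xx; exact: hc (Hx Xx) Xx.
have hP := density_le_P dP c0 aec.
have H0 := patch_density_ge0 dP.
have HM x : G x -> (h \_ X) x <= M by move=> Gx; rewrite patch_density_in ?hM//; exact: GX.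
have HV t : sorted <%O t -> list_in G t -> lvar (absd (h \_ X)) t <= V.
  move=> st tG; rewrite (@eq_in_lvar _ _ h); first exact: hV.
  by move=> x /tG/GX Xx; rewrite patch_density_in.
have BVL := words_BVnorm bs GX aeG Gv D0 th1 d0 wD v_lip img_ge M0 H0 HM HV.
set K := expR _ / delta * _ in BVL.
have K0 : 0 <= K.
  have V0 : 0 <= V by have := hV [::] isT; apply.
  apply: mulr_ge0; first by rewrite divr_ge0 ?expR_ge0// ltW.
  have D'0 : 0 <= D / (1 - th) by rewrite divr_ge0// subr_ge0 ltW.
  have De : 0 <= D / (1 - th) * expR (D / (1 - th)) by rewrite mulr_ge0 ?expR_ge0.
  by apply: addr_ge0; apply: mulr_ge0 => //; rewrite addr_ge0// mulr_ge0.
(* One factor 1 / c turns the Lebesgue measure of the union of cylinders into P(A), the other m(B)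
   into P(B); K + 1 makes the constant positive. *)
exists (C * (K + 1) / (c * c)); first by rewrite divr_gt0 ?mulr_gt0// ltr_wpDl.
move=> n n0; apply: ge_ereal_sup => _ [k k0 <-].
apply: ge_ereal_sup => _ [A [D1 [sA [B bB <-] pA pD ->]]].
rewrite lee_fin.
have [[mA AX] _] := sigma_cylinders_split bs k0 sA.
have [mpB _] := borel_preX pm (n + k) bB.
have pB : fine (P (preX T (n + k) B)) = fine (P B) by rewrite (P_preX pm acP).
have rn : 0 < C * r ^+ n by rewrite mulr_gt0 ?exprn_gt0.
pose p := fine (P A); pose s := fine (P B).
have est : `|fine (P (A `&` preX T (n + k) B)) - p * s| <=
    C * r ^+ n * (K * (p / c)) * (s / c).
  apply: (sigma_estimate bs acP k0 sA mpB) => L uL sL LA.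
  apply: le_trans (words_estimate bs dP C0 r0 sg uL sL (BVL L k k0 uL sL) bB n0) _.
  have mU := measurable_words_union bs L.
  have bU : borelX (words_union T a L) by split => //; exact: subset_trans LA AX.
  have U1 : fine (m (words_union T a L)) <= p / c.
    apply: le_trans (hP _ bU) _; rewrite ler_pM2r ?invr_gt0//.
    apply: fine_le; [exact: fin_num_measure|exact: fin_num_measure|].
    by apply: le_measure; rewrite ?inE.
  have KU : 0 <= K * fine (m (words_union T a L)) by rewrite mulr_ge0// fine_ge0.
  apply: ler_pM; [by rewrite mulr_ge0// ltW|by rewrite fine_ge0| |exact: hP].
  by apply: ler_wpM2l; [exact: ltW|exact: ler_wpM2l].
rewrite pB -/p -/s in pA pD *.
have ps : 0 < p * s by rewrite mulr_gt0.
rewrite normrM normfV (gtr0_norm ps) ler_pdivrMr//; apply: le_trans est _.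
have -> : C * (K + 1) / (c * c) * r ^+ n * (p * s) =
    C * r ^+ n * (K * (p / c)) * (s / c) + C * r ^+ n * (p / c) * (s / c).
  by field; rewrite gt_eqF.
by rewrite lerDl !mulr_ge0 ?invr_ge0 ?(ltW C0) ?(ltW pA) ?(ltW pD) ?(ltW c0) ?(ltW (exprn_gt0 _ r0)).
Qed.

End PartB.

Theorem theorem1 (R : realType) :
  [/\
    (forall (T : R -> R) (alpha : set (set R))
        (P : probability (measurableTypeR R) R) (h : R -> R) (C r : R),
      ru_map T alpha -> ergodic T ->
      ac_invariant T P -> density P h -> weakly_mixing T P ->
      0 < C -> 0 < r -> r < 1 -> spectral_gap T h C r ->
      (0 < inf_pos h)%E ->
      exists2 B : R, 0 < B & forall n : nat, (0 < n)%N ->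
        (mixing_coef (phi_minus_coef P) T alpha n <= (B * r ^+ n)%:E)%E),
    (forall (T : R -> R) (alpha : set (set R))
        (P : probability (measurableTypeR R) R) (h : R -> R) (C r : R),
      afu_map T alpha -> conservative T -> ergodic T ->
      ac_invariant T P -> density P h -> weakly_mixing T P ->
      0 < C -> 0 < r -> r < 1 -> spectral_gap T h C r ->
      (0 < inf_image T (cylinders T alpha))%E ->
      exists2 B : R, 0 < B & forall n : nat, (0 < n)%N ->
        (mixing_coef (psi_coef P) T alpha n <= (B * r ^+ n)%:E)%E) &
    (forall (T : R -> R) (alpha : set (set R))
        (P : probability (measurableTypeR R) R),
      pm_map T alpha -> ac_invariant T P ->
      finite_set alpha -> generating T alpha ->
      inf_image T (charged_cylinders P T alpha) = 0%E ->
      forall n : nat, (0 < n)%N ->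
        mixing_coef (phi_plus_coef P) T alpha n = 1%E)].
Proof.
split.
- move=> T alpha P h C r ru _ acP dP _ C0 r0 _ sg ip.
  exact: part_a ru acP dP C0 r0 sg ip.
- move=> T alpha P h C r afu cT eT acP dP _ C0 r0 _ sg inf0.
  exact: part_b afu cT eT acP dP C0 r0 sg inf0.
- move=> T alpha P pm acP fa _ inf0 n n0.
  exact: part_c pm acP fa inf0 n n0.
Qed.
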